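(* Let $\{Y_j\}_{j\in\mathbb{Z}}$ satisfy the usual conditions (see context) with index $\alpha$ and slowly varying $h$, and let $\{c_j\}$ be real with $\sum_j|c_j|<+\infty$ and $\sum_j|c_j|^\alpha h(|c_j|^{-1})<\infty$. Let $X_i=\sum_jc_{i-j}Y_j$, $U_i=\sum_j|c_{i-j}|Y_j$, $S_n(t)=\frac1{a_n}\sum_{i=1}^{[nt]}X_i$, $T_n(t)=\frac1{a_n}\sum_{i=1}^{[nt]}U_i$. If the finite dimensional distributions of $T_n$ converge to those of $A_{|\cdot|}\cdot Z$, where $A_{|\cdot|}=\sum_j|c_j|$, then $S_n\to A\cdot Z$ in distribution on $D([0,1])$ equipped with the $S$ topology, where $A=\sum_jc_j$.
   Context: Usual conditions: $\{Y_j\}_{j\in\mathbb{Z}}$ are i.i.d.; there exist $\alpha\in(0,2)$ and a function $h$ slowly varying at $+\infty$ with $P(|Y_1|>x)=x^{-\alpha}h(x)$ for $x>0$; the limits $\lim_{x\to\infty}P(Y_1>x)/P(|Y_1|>x)=p$ and $\lim_{x\to\infty}P(Y_1<-x)/P(|Y_1|>x)=q$ exist with $p+q=1$; $EY_1=0$ if $\alpha>1$; $Y_1$ is symmetric if $\alpha=1$. The norming constants $a_n>0$ satisfy $nP(|Y_1|>a_n)\to C>0$; $a_n^{-1}\sum_{i=1}^nY_i$ converges in distribution to a strictly $\alpha$-stable $Z$, and $(Z(t))_{t\ge0}$ is the $\alpha$-stable Lévy motion with $Z(1)\overset{d}{=}Z$. $D([0,1])$ is the space of real càdlàg functions on $[0,1]$;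 $V([0,1])$ its subset of functions of bounded variation; $v_n\Rightarrow v_0$ in $V([0,1])$ means $\int_{[0,1]}f\,dv_n\to\int_{[0,1]}f\,dv_0$ for all continuous $f$ ($dv$ the Lebesgue–Stieltjes measure with $v(0-)=0$). $x_n$ $S$-converges to $x_0$ if for every $\varepsilon>0$ there exist $v_{n,\varepsilon}\in V([0,1])$, $n\ge0$, with $\sup_t|x_n(t)-v_{n,\varepsilon}(t)|\le\varepsilon$ for all $n\ge 0$ and $v_{n,\varepsilon}\Rightarrow v_{0,\varepsilon}$; the $S$ topology is the sequential topology determined by this convergence. Convergence in distribution in the $S$ topology means $Ef(S_n)\to Ef(A\cdot Z)$ for every bounded $S$-continuous $f:D([0,1])\to\mathbb{R}$. *)

(* Defs.v *)
From mathcomp Require Import all_boot all_order all_algebra.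
From mathcomp Require Import all_classical all_reals all_analysis.
Import Num.Theory GRing.Theory Order.TTheory numFieldNormedType.Exports.

Set Implicit Arguments.
Unset Strict Implicit.
Unset Printing Implicit Defensive.

Local Open Scope classical_set_scope.
Local Open Scope ring_scope.

Section defs.
Variable R : realType.

Definition psum (a : int -> R) (N : nat) : R :=
  \sum_(0 <= k < N.+1) a (k%:Z) + \sum_(1 <= k < N.+1) a (- (k%:Z)).

Definition zsum (a : int -> R) : R := limn (psum a).

Definition slowly_varying (h : R -> R) : Prop :=
  forall lam : R, 0 < lam -> h (lam * x) / h x @[x --> +oo] --> (1 : R).

Definition mutual_indep d (T : measurableType d) (P : probability T R)
  (I : eqType) (X : I -> T -> R) : Prop :=
  forall (J : seq I) (B : I -> set R),
    uniq J -> (forall j, measurable (B j)) ->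
    P (\bigcap_(j in [set` J]) (X j @^-1` B j)) =
    (\prod_(j <- J) P (X j @^-1` B j))%E.

Definition eq_dist d (T : measurableType d) (P : probability T R)
  d' (T' : measurableType d') (Q : probability T' R)
  (X : T -> R) (Y : T' -> R) : Prop :=
  forall B : set R, measurable B -> P (X @^-1` B) = Q (Y @^-1` B).

Definition cvg_dist d (T : measurableType d) (P : probability T R)
  d' (T' : measurableType d') (Q : probability T' R)
  (Xn : nat -> T -> R) (X : T' -> R) : Prop :=
  forall g : R -> R, continuous g -> (exists M, forall x, `|g x| <= M) ->
    ('E_P[fun w => g (Xn n w)] @[n --> \oo] --> 'E_Q[fun w => g (X w)])%E.

Definition cvg_dist_vec d (T : measurableType d) (P : probability T R)
  d' (T' : measurableType d') (Q : probability T' R) (k : nat)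
  (Xn : nat -> T -> 'rV[R]_k) (X : T' -> 'rV[R]_k) : Prop :=
  forall g : 'rV[R]_k -> R, continuous g -> (exists M, forall x, `|g x| <= M) ->
    ('E_P[fun w => g (Xn n w)] @[n --> \oo] --> 'E_Q[fun w => g (X w)])%E.

(* An element of D([0,1]) is represented by a function R -> R; only its
   values on [0,1] matter. *)

Definition cadlag01 (x : R -> R) : Prop :=
  (forall t, 0 <= t < 1 -> x s @[s --> t^'+] --> x t) /\
  (forall t, 0 < t <= 1 -> exists l : R, x s @[s --> t^'-] --> l).

Definition Vspace (v : R -> R) : Prop :=
  cadlag01 v /\ bounded_variation 0 1 v.

(* points of a partition s of [0,1] : 0 = t_0 < t_1 < ... < t_{size s} = 1 *)
Definition ppt (s : seq R) (i : nat) : R := nth 1 (0 :: s) i.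

(* [LS_integral f v L] : L = int_{[0,1]} f dv, where dv is the
   Lebesgue-Stieltjes (signed) measure of v with v(0-) = 0, i.e. dv has an
   atom v(0) at 0 and dv((s,t]) = v(t) - v(s); for continuous f and v of
   bounded variation this is f(0) v(0) plus the Riemann-Stieltjes integral
   of f against v over [0,1]. *)
Definition LS_integral (f v : R -> R) (L : R) : Prop :=
  forall e : R, 0 < e -> exists2 del : R, 0 < del &
    forall (s : seq R) (xi : nat -> R),
      itv_partition 0 1 s ->
      (forall i, (i < size s)%N ->
         ppt s i <= xi i <= ppt s i.+1 /\ ppt s i.+1 - ppt s i < del) ->
      `| f 0 * v 0 + \sum_(0 <= i < size s) f (xi i) * (v (ppt s i.+1) - v (ppt s i))
         - L | < e.

Definition weak_cvgV (vn : nat -> R -> R) (v0 : R -> R) : Prop :=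
  forall f : R -> R, {within `[0, 1], continuous f} ->
  forall (Ln : nat -> R) (L0 : R),
    (forall n, LS_integral f (vn n) (Ln n)) -> LS_integral f v0 L0 ->
    Ln @ \oo --> L0.

Definition S_cvg (xn : nat -> R -> R) (x0 : R -> R) : Prop :=
  forall e : R, 0 < e -> exists (vn : nat -> R -> R) (v0 : R -> R),
    [/\ Vspace v0, (forall n, Vspace (vn n)),
        (forall t, 0 <= t <= 1 -> `|x0 t - v0 t| <= e),
        (forall n t, 0 <= t <= 1 -> `|xn n t - vn n t| <= e) &
        weak_cvgV vn v0].

(* open sets of the sequential topology on D([0,1]) determined by S-convergence
   (U is identified with the subset  U ∩ D([0,1])) *)
Definition S_open (U : set (R -> R)) : Prop :=
  forall (xn : nat -> R -> R) (x0 : R -> R),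
    (forall n, cadlag01 (xn n)) -> cadlag01 x0 ->
    S_cvg xn x0 -> U x0 -> \forall n \near \oo, U (xn n).

(* f : D([0,1]) -> R, represented by a function on R -> R depending only
   on the values on [0,1] *)
Definition on_D01 (f : (R -> R) -> R) : Prop :=
  forall x y : R -> R, (forall t, 0 <= t <= 1 -> x t = y t) -> f x = f y.

Definition S_continuous (f : (R -> R) -> R) : Prop :=
  forall V : set R, open V -> S_open [set x | cadlag01 x /\ V (f x)].

Definition cvg_dist_S d (T : measurableType d) (P : probability T R)
  d' (T' : measurableType d') (Q : probability T' R)
  (Xn : nat -> T -> R -> R) (X : T' -> R -> R) : Prop :=
  forall f : (R -> R) -> R, on_D01 f -> (exists M, forall x, `|f x| <= M) ->
    S_continuous f ->
    ('E_P[fun w => f (Xn n w)] @[n --> \oo] --> 'E_Q[fun w => f (X w)])%E.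

Definition levy_motion d' (T' : measurableType d') (Q : probability T' R)
  (Z : R -> T' -> R) : Prop :=
  [/\ (forall t, measurable_fun setT (Z t)),
      (forall w, Z 0 w = 0),
      (forall w, cadlag01 (fun t => Z t w)),
      (forall tt : nat -> R, 0 <= tt 0%N -> (forall i, tt i < tt i.+1) ->
         mutual_indep Q (fun i : nat => fun w => Z (tt i.+1) w - Z (tt i) w)) &
      (forall s t, 0 <= s -> s <= t ->
         eq_dist Q Q (fun w => Z t w - Z s w) (Z (t - s)))].

Definition linproc d (T : measurableType d) (c : int -> R) (Y : int -> T -> R)
  (i : int) (w : T) : R :=
  zsum (fun j => c (i - j) * Y j w).

Definition psum_proc d (T : measurableType d) (a : nat -> R)
  (X : int -> T -> R) (n : nat) (w : T) : R -> R :=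
  fun t => (a n)^-1 * \sum_(1 <= i < (Num.truncn (n%:R * t)).+1) X (i%:Z) w.

End defs.

(* Main.v *)
(* Put v_n = 1 / a_n, b_k(j) = c_{1-j} + ... + c_{k-j} and let |b|_k(j) be the same sum for |c|, so
   that S_n(k/n) = sum_j v_n b_k(j) Y_j and T_n(k/n) = sum_j v_n |b|_k(j) Y_j.

   By independence |E exp(iu T_n(1))|^2 is the product over j of |E exp(iu v_n |b|_n(j) Y_j)|^2.
   As T_n(1) converges, this product stays away from 0 for small u, which bounds
   sum_j P(u v_n |b|_n(j) |Y_j| > 1) uniformly in n. Since v_n (Y_1 + ... + Y_n) converges too, the
   part of this sum over |j| > 2n even tends to 0.

   The coefficients of the positive and of the negative part of c give sums b_k(j) that are
   monotone in k, so the Newman-Wright inequality controls the maximum over k of the sum of the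
   truncated, centered terms; the remaining terms form a path whose variation is bounded in
   probability. Hence S_n is uniformly close to paths with a bounded number of bounded jumps.
   For fixed t, b_k(j) is close to A for most j in [1, k] and close to 0 for most other j, and
   likewise for |b|, so S_n(t) - (A / A_{|.|}) T_n(t) tends to 0 in probability.

   Paths close to step functions with boundedly many bounded jumps are relatively compact for S, so
   that an S-continuous f changes little on them when a path is replaced by its values on a fine
   grid. This reduces the claim to the finite dimensional distributions of (A / A_{|.|}) T_n. *)

Require Import Defs.
From mathcomp Require Import all_boot all_order all_algebra.
From mathcomp Require Import all_classical all_reals all_analysis.
From mathcomp Require Import measurable_realfun.
From mathcomp Require Import ring lra zify.
Import Num.Theory GRing.Theory Order.TTheory numFieldNormedType.Exports.
Set Implicit Arguments.
Unset Strict Implicit.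
Unset Printing Implicit Defensive.
Local Open Scope classical_set_scope.
Local Open Scope ring_scope.

(** * Step functions and weak convergence *)

(** When [c] has mixed signs, one large noise variable can push the path up and down at neighbouring
    times, and the Skorokhod topologies need not absorb this. S-convergence only asks for uniformly
    close paths of bounded variation that converge weakly, so control of the number and the size of
    the jumps is enough. The delicate terms are the remote ones. Summability of [c] and of the tails
    makes each X_i converge, but does not by itself say that the noise at |j| > 2n contributes
    little to a sum of n terms. Convergence of T_n(1) supplies this; since |b_k(j)| is at most
    |b|_n(j) for all k <= n, a bound for the nonnegative coefficients at time 1 serves S_n at all
    times. No metrizability of the S topology is used, hence no Prokhorov theorem: S-continuity is
    exploited only along S-convergent sequences, through a contradiction argument that constructs
    the limit path. Likewise, a functional of the path is shown measurable as a limit of functionals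
    of finitely many coordinates. *)

Section paths.
Variable R : realType.
Implicit Types (x y v f : R -> R) (b tau : nat -> R).

Lemma cvg_sumr (I : Type) (r : seq I) (F : nat -> I -> R) (l : I -> R) :
  (forall i, F n i @[n --> \oo] --> l i) ->
  \sum_(i <- r) F n i @[n --> \oo] --> \sum_(i <- r) l i.
Proof.
move=> h; elim: r => [|i r ih].
  by under eq_fun do rewrite big_nil; rewrite big_nil; exact: cvg_cst.
by under eq_fun do rewrite big_cons; rewrite big_cons; exact: cvgD.
Qed.

(** The [b i] are jump sizes rather than levels, and the times [tau i] may be unsorted or equal.
    Limits in [b] and [tau] thus stay in the same class without any reordering, even when jumps
    merge. *)
Definition stp (N : nat) b tau (t : R) : R := \sum_(i < N) b i * (tau i <= t)%R%:R.

Lemma cadlag01D x y : cadlag01 x -> cadlag01 y -> cadlag01 (fun t => x t + y t).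
Proof.
move=> [x1 x2] [y1 y2]; split=> t ht; first exact: cvgD (x1 t ht) (y1 t ht).
have [[l hl] [m hm]] := (x2 t ht, y2 t ht); exists (l + m); exact: cvgD.
Qed.

Lemma cadlag01Z (c : R) x : cadlag01 x -> cadlag01 (fun t => c * x t).
Proof.
move=> [x1 x2]; split=> t ht; first by apply: cvgMr; exact: x1.
by have [l hl] := x2 t ht; exists (c * l); exact: cvgMr.
Qed.

Lemma jump_right (tau t : R) : \forall s \near t^'+, (tau <= s) = (tau <= t).
Proof.
have [h|h] := leP tau t.
  near=> s; apply: (le_trans h); apply: ltW; near: s; exact: nbhs_right_gt.
near=> s; apply/negbTE; rewrite -ltNge; near: s; exact: nbhs_right_lt.
Unshelve. all: by end_near. Qed.

Lemma jump_left (tau t : R) : \forall s \near t^'-, (tau <= s) = (tau < t).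
Proof.
have [h|h] := ltP tau t.
  near=> s; near: s; exact: nbhs_left_ge.
near=> s; apply/negbTE; rewrite -ltNge; apply: (lt_le_trans _ h).
near: s; exact: nbhs_left_lt.
Unshelve. all: by end_near. Qed.

Lemma cadlag01_jump (tau : R) : cadlag01 (fun t => (tau <= t)%R%:R).
Proof.
split=> t ht.
  apply: cvg_near_cst; near=> s.
  suff -> : (tau <= s) = (tau <= t) by [].
  by near: s; exact: jump_right.
exists (tau < t)%R%:R; apply: cvg_near_cst; near=> s.
suff -> : (tau <= s) = (tau < t) by [].
by near: s; exact: jump_left.
Unshelve. all: by end_near. Qed.

Lemma cadlag01_cst (c : R) : cadlag01 (fun=> c).
Proof. by split=> t ht; [exact: cvg_cst|exists c; exact: cvg_cst]. Qed.

Lemma cadlag01_sum (I : Type) (r : seq I) (F : I -> R -> R) :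
  (forall i, cadlag01 (F i)) -> cadlag01 (fun t => \sum_(i <- r) F i t).
Proof.
move=> hF; elim: r => [|i r ih].
  by under [X in cadlag01 X]eq_fun do rewrite big_nil; exact: cadlag01_cst.
by under [X in cadlag01 X]eq_fun do rewrite big_cons; exact: cadlag01D.
Qed.

Lemma cadlag01_stp N b tau : cadlag01 (stp N b tau).
Proof. by apply: cadlag01_sum => i; apply: cadlag01Z; exact: cadlag01_jump. Qed.

Lemma BV_jump (tau : R) : bounded_variation 0 1 (fun t : R => (tau <= t)%R%:R : R).
Proof.
apply: nondecreasing_bounded_variation => s t _ _ st.
by rewrite ler_nat; case: (leP tau s) => //= h; rewrite (le_trans h st).
Qed.

Lemma BVZ (c : R) v : bounded_variation 0 1 v -> bounded_variation 0 1 (fun t => c * v t).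
Proof.
move=> [M hM]; exists (`|c| * M) => _ [s ps <-].
rewrite /variation; apply: (@le_trans _ _ (`|c| * variation 0 1 v s)).
  rewrite /variation mulr_sumr; apply: ler_sum => i _.
  by rewrite -mulrBr normrM.
by apply: ler_wpM2l => //; apply: hM; exists s.
Qed.

Lemma BV_stp N b tau : bounded_variation 0 1 (stp N b tau).
Proof.
rewrite /stp; elim: N => [|N ih].
  under [X in bounded_variation _ _ X]eq_fun do rewrite big_ord0.
  exact: nondecreasing_bounded_variation.
under [X in bounded_variation _ _ X]eq_fun do rewrite big_ord_recr/=.
apply: bounded_variationD => //; apply: BVZ; exact: BV_jump.
Qed.

Lemma Vspace_stp N b tau : Vspace (stp N b tau).
Proof. by split; [exact: cadlag01_stp|exact: BV_stp]. Qed.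

Lemma LS_integralD f v1 v2 (L1 L2 : R) :
  LS_integral f v1 L1 -> LS_integral f v2 L2 ->
  LS_integral f (fun t => v1 t + v2 t) (L1 + L2).
Proof.
move=> h1 h2 e e0; have e20 : 0 < e / 2 by rewrite divr_gt0.
have [d1 d10 H1] := h1 _ e20; have [d2 d20 H2] := h2 _ e20.
exists (Num.min d1 d2); first by rewrite lt_min d10.
move=> s xi ps hs.
have {}H1 := H1 s xi ps; have {}H2 := H2 s xi ps.
have /H1 {}H1 : forall i, (i < size s)%N -> ppt s i <= xi i <= ppt s i.+1 /\
  ppt s i.+1 - ppt s i < d1.
  by move=> i /hs[? ]; rewrite lt_min => /andP[].
have /H2 {}H2 : forall i, (i < size s)%N -> ppt s i <= xi i <= ppt s i.+1 /\
  ppt s i.+1 - ppt s i < d2.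
  by move=> i /hs[? ]; rewrite lt_min => /andP[].
under eq_bigr do rewrite opprD addrACA mulrDr.
rewrite big_split/= mulrDr.
rewrite [ltRHS]splitr; apply: le_lt_trans (ltrD H1 H2).
apply: le_trans (ler_normD _ _); rewrite le_eqVlt; apply/orP; left; apply/eqP.
congr (`|_|); ring.
Qed.

Lemma LS_integralZ (c : R) f v (L : R) :
  LS_integral f v L -> LS_integral f (fun t => c * v t) (c * L).
Proof.
move=> h e e0; have c10 : 0 < `|c| + 1 by rewrite ltr_wpDl.
have [d d0 H] := h _ (divr_gt0 e0 c10); exists d => // s xi ps hs.
have {}H := H s xi ps hs.
under eq_bigr do rewrite -mulrBr mulrCA.
rewrite -mulr_sumr mulrCA -mulrDr -mulrBr normrM.
have [->|c0] := eqVneq c 0; first by rewrite normr0 mul0r.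
rewrite mulrC -ltr_pdivlMr ?normr_gt0//; apply: (lt_le_trans H).
by rewrite ler_pM2l// lef_pV2 ?posrE ?normr_gt0// lerDl.
Qed.

Lemma ppt0 (s : seq R) : ppt s 0 = 0. Proof. by []. Qed.

Lemma ppt_size (s : seq R) : itv_partition 0 1 s -> ppt s (size s) = 1.
Proof. by move=> ps; rewrite /ppt (itv_partition_nth_size _ ps). Qed.

(** Without arbitrarily fine partitions [LS_integral] could hold vacuously; their existence is what
    makes its value unique. *)
Lemma exists_partition (del : R) : 0 < del ->
  exists2 s : seq R, itv_partition 0 1 s &
    forall i, (i < size s)%N -> ppt s i <= ppt s i.+1 /\ ppt s i.+1 - ppt s i < del.
Proof.
move=> del0.
have [n hn] : exists n : nat, (n.+1%:R : R)^-1 < del.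
  exists (Num.truncn (del^-1)); rewrite invf_plt ?posrE//.
  exact: truncnS_gt.
pose g i : R := i%:R / n.+1%:R.
have gS i : g i < g i.+1 by rewrite ltr_pM2r ?invr_gt0// ltr_nat.
have hp i : (i <= n.+1)%N -> ppt (mkseq (fun i => g i.+1) n.+1) i = g i.
  case: i => [_|i hi]; first by rewrite ppt0 /g mul0r.
  by rewrite /ppt/= nth_mkseq.
exists (mkseq (fun i => g i.+1) n.+1).
  split; last first.
    rewrite (last_nth 1) size_mkseq.
    by have := hp n.+1 (leqnn _); rewrite /ppt => ->; rewrite /g divff.
  apply/(pathP 1) => i; rewrite size_mkseq => hi.
  have := hp i (ltnW hi); rewrite /ppt => ->.
  by rewrite nth_mkseq.
move=> i; rewrite size_mkseq => hi.
rewrite !hp// 1?ltnW//; split; first exact/ltW.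
by rewrite /g -mulrBl -natrB ?leqnSn// subSnn mul1r.
Qed.

Lemma LS_integral_unique f v (L1 L2 : R) :
  LS_integral f v L1 -> LS_integral f v L2 -> L1 = L2.
Proof.
move=> h1 h2; apply/eqP; rewrite -subr_eq0 -normr_le0; apply/ler_addgt0Pr => e e0.
have e20 : 0 < e / 2 by rewrite divr_gt0.
have [d1 d10 H1] := h1 _ e20; have [d2 d20 H2] := h2 _ e20.
have [s ps hs] := @exists_partition (Num.min d1 d2) ltac:(by rewrite lt_min d10).
have {}H1 := H1 s (ppt s) ps; have {}H2 := H2 s (ppt s) ps.
have /H1 {}H1 : forall i, (i < size s)%N -> ppt s i <= ppt s i <= ppt s i.+1 /\
  ppt s i.+1 - ppt s i < d1.
  by move=> i /hs[-> ]; rewrite lexx lt_min => /andP[].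
have /H2 {}H2 : forall i, (i < size s)%N -> ppt s i <= ppt s i <= ppt s i.+1 /\
  ppt s i.+1 - ppt s i < d2.
  by move=> i /hs[-> ]; rewrite lexx lt_min => /andP[].
move: H1 H2; set S := _ + \sum_(_ <= _ < _) _.
rewrite add0r => H1 H2; rewrite (splitr e).
apply: le_trans (ltW (ltrD H1 H2)); rewrite distrC.
have -> : L2 - L1 = (S - L1) - (S - L2) by ring.
exact: ler_normB.
Qed.

Lemma within_continuous_eps f (tau : R) : {within `[0, 1], continuous f} ->
  0 <= tau <= 1 -> forall e, 0 < e -> exists2 del : R, 0 < del &
    forall u, 0 <= u <= 1 -> `|u - tau| < del -> `|f u - f tau| < e.
Proof.
move=> /subspace_continuousP fc t01 e e0.
have /cvgrPdist_lt/(_ _ e0) := fc tau ltac:(by rewrite /= in_itv).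
move=> /nbhs_ballP[del /= del0 hd]; exists del => // u u01 ud.
by rewrite distrC; apply: hd; [rewrite /ball/= distrC|rewrite /= in_itv].
Qed.

(** Only the cell with t_k < tau <= t_(k+1) contributes to the Riemann sum, and its tag is within
    the mesh of [tau]. A jump at 0 lies in no such cell; it is carried by the atom [f 0 * v 0]. *)
Lemma LS_integral_jump f (tau : R) : {within `[0, 1], continuous f} ->
  0 <= tau <= 1 -> LS_integral f (fun t => (tau <= t)%R%:R) (f tau).
Proof.
move=> fc t01 e e0; have [del del0 hd] := within_continuous_eps fc t01 e0.
exists del => // s xi ps hs.
have mono : forall i j, (i <= j)%N -> (j <= size s)%N -> ppt s i <= ppt s j.
  move=> i j ij; rewrite -(subnKC ij); elim: (j - i)%N => [|m ih]; rewrite ?addn0// addnS => hm.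
  apply: le_trans (ih (ltnW hm)) _.
  by have [/andP[h1 h2] _] := hs _ hm; exact: le_trans h1 h2.
have p01 i : (i <= size s)%N -> 0 <= ppt s i <= 1.
  by move=> hi; rewrite -(ppt0 s) mono// -(ppt_size ps) mono.
have [tau0|tau0] := leP tau 0.
  rewrite big1_seq ?addr0 ?mulr1.
    have /andP[? _] := t01; have -> : tau = 0 by apply/le_anti/andP.
    by rewrite subrr normr0.
  move=> i; rewrite mem_index_iota => /andP[_ hi].
  have [/andP[h1 _] /andP[h2 _]] := (p01 _ (ltnW hi), p01 _ hi).
  by rewrite !(le_trans tau0)// subrr mulr0.
rewrite mulr0 add0r.
have ex : exists i, tau <= ppt s i by exists (size s); rewrite ppt_size//; case/andP: t01.
case: (ex_minnP ex) => -[|k] hk mink; first by move: hk; rewrite ppt0; lra.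
have ks : (k < size s)%N.
  by apply: mink; rewrite ppt_size//; case/andP: t01.
rewrite big_mkord (bigD1 (Ordinal ks))//= hk big1 => [|i ik].
  have ktau : ppt s k < tau.
    by rewrite ltNge; apply/negP => /mink; rewrite ltnn.
  rewrite leNgt ktau/= subr0 mulr1 addr0.
  have [/andP[h1 h2] h3] := hs _ ks.
  have [/andP[h4 _] /andP[_ h5]] := (p01 _ (ltnW ks), p01 _ ks).
  apply: hd; first by rewrite (le_trans h4 h1) (le_trans h2 h5).
  by rewrite ltr_norml; apply/andP; split; lra.
have ik' : val i != k by apply: contra ik => /eqP ik; apply/eqP/val_inj.
have [hik|hik] := ltnP i k.
  have hh j : (j <= k)%N -> (tau <= ppt s j) = false.
    by move=> jk; apply/negP => /mink; rewrite ltnNge jk.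
  by rewrite !hh// ?subrr ?mulr0// ltnW.
have {}hik : (k < i)%N by rewrite ltn_neqAle eq_sym ik'.
have h1 := le_trans hk (mono _ _ hik (ltnW (ltn_ord i))).
have h2 := le_trans hk (mono k.+1 i.+1 (leqW hik) (ltn_ord i)).
by rewrite h1 h2 subrr mulr0.
Qed.

Lemma LS_integral_stp f N b tau : {within `[0, 1], continuous f} ->
  (forall i, (i < N)%N -> 0 <= tau i <= 1) ->
  LS_integral f (stp N b tau) (\sum_(i < N) b i * f (tau i)).
Proof.
move=> fc; elim: N => [|N ih] ht.
  rewrite big_ord0 => e e0; exists 1 => // s xi _ _.
  rewrite /stp big_ord0 mulr0 add0r big1 ?subrr ?normr0// => i _.
  by rewrite !big_ord0 subrr mulr0.
have -> : stp N.+1 b tau = fun t => stp N b tau t + b N * (tau N <= t)%R%:R.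
  by apply/funext => t; rewrite /stp big_ord_recr.
rewrite big_ord_recr/=; apply: LS_integralD; first by apply: ih => i iN; exact: ht (ltnW iN).
by apply: LS_integralZ; apply: LS_integral_jump => //; exact: ht.
Qed.

(** The integrals are finite sums of the b_i f(tau_i), which are continuous in the jump sizes and
    the jump times. *)
Lemma weak_cvgV_stp N (vn : nat -> R -> R) (bn taun : nat -> nat -> R) b tau :
  (\forall n \near \oo, vn n = stp N (bn n) (taun n)) ->
  (forall k i, (i < N)%N -> 0 <= taun k i <= 1) ->
  (forall i, (i < N)%N -> 0 <= tau i <= 1) ->
  (forall i, (i < N)%N -> bn ^~ i @ \oo --> b i) ->
  (forall i, (i < N)%N -> taun ^~ i @ \oo --> tau i) ->
  weak_cvgV vn (stp N b tau).
Proof.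
move=> hv tn01 t01 hb ht f fc Ln L0 hn h0.
rewrite (LS_integral_unique h0 (LS_integral_stp b fc t01)).
apply: (@cvg_trans _ ((fun n => \sum_(i < N) bn n i * f (taun n i)) @ \oo)).
  apply: near_eq_cvg; apply: filterS hv => n hvn.
  apply/esym/LS_integral_unique; first exact: hn.
  by rewrite hvn; apply: LS_integral_stp => // i; exact: tn01.
apply: cvg_sumr => i; apply: cvgM; first exact: hb.
apply/cvgrPdist_lt => e e0.
have [del del0 hd] := within_continuous_eps fc (t01 i (ltn_ord i)) e0.
have /cvgrPdist_lt/(_ _ del0) := ht i (ltn_ord i).
apply: filterS => n; rewrite distrC => hn'; rewrite distrC; apply: hd => //.
exact: tn01.
Qed.

Lemma stp_ge N b tau (u t : R) : (forall i, (i < N)%N -> tau i <= u) -> u <= t ->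
  stp N b tau t = \sum_(i < N) b i.
Proof.
by move=> h ut; apply: eq_bigr => i _; rewrite (le_trans (h i (ltn_ord i)) ut) mulr1.
Qed.

Lemma stp_add N b tau (u l : R) :
  exists b' tau', [/\ forall t, t < u -> stp N.+1 b' tau' t = stp N b tau t,
    (forall t, u <= t -> (forall i, (i < N)%N -> tau i <= u) -> stp N.+1 b' tau' t = l),
    tau' N = u & forall i, (i < N)%N -> tau' i = tau i].
Proof.
exists (fun i => if (i < N)%N then b i else l - \sum_(i < N) b i).
exists (fun i => if (i < N)%N then tau i else u).
have hs t : \sum_(i < N) (if (i < N)%N then b i else l - \sum_(i0 < N) b i0) *
    ((if (i < N)%N then tau i else u) <= t)%R%:R = stp N b tau t.
  by apply: eq_bigr => i _; rewrite ltn_ord.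
split=> [t tu|t ut h||i ->//]; last by rewrite ltnn.
  by rewrite /stp big_ord_recr/= hs ltnn leNgt tu/= mulr0 addr0.
by rewrite /stp big_ord_recr/= hs ltnn ut (stp_ge _ h ut)//= mulr1 addrC subrK.
Qed.

(** Let s be the supremum of the u for which an approximation exists on [0, u). The left limit at s
    shows that s itself qualifies, and right continuity moves beyond s unless s = 1. The half-open
    intervals leave the value at the end point free; a last jump at 1 restores it. *)
Lemma cadlag_stp_approx x (e : R) : cadlag01 x -> 0 < e ->
  exists N b tau, (forall i, (i < N)%N -> 0 <= tau i <= 1) /\
    forall t, 0 <= t <= 1 -> `|x t - stp N b tau t| <= e.
Proof.
move=> [xr xl] e0.
pose P u := exists N b tau, (forall i, (i < N)%N -> 0 <= tau i <= u) /\
    forall t, 0 <= t < u -> `|x t - stp N b tau t| <= e.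
have Pext u u' l : 0 <= u <= u' -> P u -> (forall t, u <= t < u' -> `|x t - l| <= e) -> P u'.
  move=> /andP[u0 uu'] [N [b [tau [h1 h2]]]] h3.
  have [b' [tau' [g1 g2 g3 g4]]] := stp_add N b tau u l.
  exists N.+1, b', tau'; split=> [i|t].
    rewrite ltnS leq_eqVlt => /predU1P[->|hi]; first by rewrite g3 u0.
    by rewrite g4//; have /andP[-> /= h] := h1 i hi; exact: le_trans uu'.
  move=> /andP[t0 tu]; have [ut|ut] := leP u t; last by rewrite g1// h2// t0.
  rewrite g2 ?h3 ?ut// => i /h1/andP[] //.
have P0 : P 0.
  by exists 0%N, (fun=> 0), (fun=> 0); split=> // t; rewrite le_lt_asym.
pose E := [set u | 0 <= u <= 1 /\ P u].
have E0 : E !=set0 by exists 0; split=> //; rewrite lexx ler01.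
have E1 : has_ubound E by exists 1 => u [/andP[]].
have hsE : has_sup E by [].
set s := sup E.
have s0 : 0 <= s by apply: ub_le_sup => //; split=> //; rewrite lexx ler01.
have s1 : s <= 1 by apply: ge_sup => // u [/andP[]].
have Ps : P s.
  have [s00|s00] := eqVneq s 0; first by rewrite s00.
  have sp : 0 < s by rewrite lt_neqAle eq_sym s00.
  have [l hl] := xl s ltac:(by rewrite sp s1).
  have /cvgrPdist_le/(_ _ e0)[d /= d0 hd] := hl.
  have [u [u01 Pu] us] := sup_adherent d0 hsE.
  have us' : u <= s by apply: ub_le_sup.
  apply: (Pext u s l) => //; first by case/andP: u01 => ->.
  move=> t /andP[ut ts]; rewrite distrC; apply: hd => //=.
  by rewrite -/s ltr_norml; apply/andP; split; rewrite -/s in us; lra.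
have s1' : s = 1.
  apply/eqP; rewrite eq_le s1 leNgt; apply/negP => ls1.
  have /= hr := xr s ltac:(by rewrite s0 ls1).
  have /cvgrPdist_le/(_ _ e0)[d /= d0 hd] := hr.
  pose u := Num.min 1 (s + d / 2).
  have su : s < u by rewrite lt_min ls1 ltrDl divr_gt0.
  have us : u < s + d by rewrite gt_min; apply/orP; right; lra.
  suff : E u by move=> /(ub_le_sup E1); rewrite -/s leNgt su.
  split; first by rewrite (le_trans s0 (ltW su)) ge_min lexx.
  apply: (Pext s u (x s)) => //; first by rewrite s0 ltW.
  move=> t /andP[]; rewrite le_eqVlt => /predU1P[<-|st] tu.
    by rewrite subrr normr0 ltW.
  rewrite distrC; apply: hd => //=; rewrite distrC ltr_norml.
  by apply/andP; split; lra.
move: Ps; rewrite s1' => -[N [b [tau [h1 h2]]]].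
have [b' [tau' [g1 g2 g3 g4]]] := stp_add N b tau 1 (x 1).
exists N.+1, b', tau'; split=> [i|t].
  rewrite ltnS leq_eqVlt => /predU1P[->|hi]; first by rewrite g3 ler01 lexx.
  by rewrite g4// h1.
move=> /andP[t0]; rewrite le_eqVlt => /predU1P[->|t1].
  by rewrite g2 => [|//|i /h1/andP[]//]; rewrite subrr normr0 ltW.
by rewrite g1// h2// t0.
Qed.

Lemma cvg_of_cauchy_ex (F : set_system R) {FF : ProperFilter F} :
  (forall e : R, 0 < e -> exists l : R, F (ball l e)) -> cvg F.
Proof. by move=> h; apply: R_complete; apply: cauchy_exP. Qed.

Lemma cadlag01_uniform_lim x :
  (forall e, 0 < e -> exists2 v, cadlag01 v & forall t, 0 <= t <= 1 -> `|x t - v t| <= e) ->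
  cadlag01 x.
Proof.
move=> h; split=> t ht.
  apply/cvgrPdist_le => e e0; have e30 : 0 < e / 3 by rewrite divr_gt0.
  have [v [vr _] hv] := h _ e30.
  have /cvgrPdist_le/(_ _ e30) hr := vr t ht.
  have /andP[t0 t1] := ht.
  near=> s.
  have ts : t < s by near: s; exact: nbhs_right_gt.
  have s1 : s < 1 by near: s; exact: nbhs_right_lt.
  have h1 : `|x t - v t| <= e / 3 by apply: hv; rewrite t0 ltW.
  have h2 : `|x s - v s| <= e / 3 by apply: hv; rewrite (le_trans t0 (ltW ts)) ltW.
  have h3 : `|v t - v s| <= e / 3 by near: s.
  by move: h1 h2 h3; rewrite !ler_norml => /andP[? ?] /andP[? ?] /andP[? ?]; apply/andP; split; lra.
have /andP[t0 t1] := ht.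
suff : cvg (x s @[s --> t^'-]) by move=> /cvg_ex[l hl]; exists l.
apply: cvg_of_cauchy_ex => e e0; have e30 : 0 < e / 3 by rewrite divr_gt0.
have [v [_ vl] hv] := h _ e30.
have [l /cvgrPdist_le/(_ _ e30) hl] := vl t ht.
exists l; suff : \forall s \near t^'-, ball l e (x s) by [].
near=> s.
have h1 : `|l - v s| <= e / 3 by near: s.
have ts : s < t by near: s; exact: nbhs_left_lt.
have s0 : 0 < s by near: s; exact: nbhs_left_gt.
have h2 : `|x s - v s| <= e / 3 by apply: hv; rewrite (ltW s0)/= (le_trans (ltW ts)).
rewrite /ball/=.
by move: h1 h2; rewrite !ler_norml ltr_norml => /andP[? ?] /andP[? ?]; apply/andP; split; lra.
Unshelve. all: by end_near. Qed.

(** Tychonoff's theorem gives a cluster point in a product of segments. Since [I] is countable, a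
    subsequence reaches it: stage k only constrains the coordinates whose code is at most k. The
    bound [k <= phi k] replaces strict monotonicity and suffices to transport eventual
    properties. *)
Lemma diag_subseq (I : countType) (u : nat -> I -> R) (B : I -> R) :
  (forall n i, `|u n i| <= B i) ->
  exists (phi : nat -> nat) (p : I -> R), (forall k, (k <= phi k)%N) /\
    forall i, u (phi k) i @[k --> \oo] --> p i.
Proof.
move=> hB.
have hK : @compact (prod_topology (fun _ : I => R^o : topologicalType))
    [set f | forall i, `[- B i, B i]%classic (f i)].
  apply: (@tychonoff I (fun=> R^o : topologicalType) (fun i => `[- B i, B i]%classic)) => i.
  exact: segment_compact.
have hu : (u @ \oo) [set f : I -> R | forall i, `[- B i, B i]%classic (f i)].
  by exists 0%N => // n _ i /=; rewrite in_itv/= -ler_norml.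
have [p [_ hp]] := hK (u @ \oo) _ hu.
have FF : @Filter (I -> R) (nbhs (p : prod_topology (fun _ : I => R^o : topologicalType))).
  exact: (@nbhs_filter (prod_topology (fun _ : I => R^o : topologicalType)) p).
have near_p (i : I) (e : R) : 0 < e ->
    nbhs (p : prod_topology (fun _ : I => R^o : topologicalType)) [set f : I -> R | `|p i - f i| < e].
  move=> e0; have := @proj_continuous I (fun=> R^o : topologicalType) i p.
  by move=> /(_ [set y | `|p i - y| < e]); apply; apply/nbhs_ballP; exists e.
have ex k : exists n, (k <= n)%N /\ forall i, (pickle i <= k)%N -> `|p i - u n i| < k.+1%:R^-1.
  have h1 : nbhs (p : prod_topology (fun _ : I => R^o : topologicalType))
      [set f : I -> R | forall j : 'I_k.+1, forall i, pickle i = j -> `|p i - f i| < k.+1%:R^-1].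
    apply: (@filter_forall (prod_topology (fun _ : I => R^o : topologicalType)) _ (fun (j : 'I_k.+1) (f : I -> R) =>
      forall i, pickle i = j -> `|p i - f i| < k.+1%:R^-1) (nbhs (p : prod_topology (fun _ : I => R^o : topologicalType))) _) => j.
    case E : (unpickle j : option I) => [i0|].
      apply: filterS (near_p i0 k.+1%:R^-1 _) => // f hf i hi.
      by move: E; rewrite -hi pickleK => -[->].
    by apply: nearW => f i hi; move: E; rewrite -hi pickleK.
  have h2 : (u @ \oo) [set u n | n in [set n | (k <= n)%N]].
    by exists k => // n /= kn; exists n.
  have [f [[n kn <-] hf]] := hp _ _ h2 h1.
  by exists n; split=> // i ik; exact: (hf (Ordinal (ik : (_ < k.+1)%N))).
exists (fun k => projT1 (cid (ex k))), p; split=> [k|i]; first by case: cid => /= n [].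
apply/cvgrPdist_lt => e e0.
near=> k; case: cid => /= n [_ /(_ i) h].
apply: (lt_trans (h _)); first by near: k; exact: nbhs_infty_ge.
by near: k; apply: near_infty_natSinv_lt (PosNum e0).
Unshelve. all: by end_near. Qed.

End paths.

Section step_function_limits.
Variable R : realType.
Implicit Types (x y v f : R -> R) (b tau : nat -> R).

(** [S_cvg] demands an approximant for every index, while the hypothesis provides one only
    eventually. The remaining paths receive an arbitrary step approximation, which does not affect
    the weak limit. *)
Lemma S_cvg_stp (xn : nat -> R -> R) x0 : (forall n, cadlag01 (xn n)) ->
  (forall e, 0 < e -> exists N bn taun b tau,
    [/\ forall n i, (i < N)%N -> 0 <= taun n i <= 1,
        forall i, (i < N)%N -> (bn ^~ i @ \oo --> b i) /\ (taun ^~ i @ \oo --> tau i),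
        \forall n \near \oo, forall t, 0 <= t <= 1 -> `|xn n t - stp N (bn n) (taun n) t| <= e &
        forall t, 0 <= t <= 1 -> `|x0 t - stp N b tau t| <= e]) ->
  S_cvg xn x0.
Proof.
move=> cx h e e0; have [N [bn [taun [b [tau [h1 h2 h3 h4]]]]]] := h e e0.
have ap n : exists v, Vspace v /\ forall t, 0 <= t <= 1 -> `|xn n t - v t| <= e.
  have [N' [b' [tau' [_ h']]]] := cadlag_stp_approx (cx n) e0.
  by exists (stp N' b' tau'); split=> //; exact: Vspace_stp.
have [w hw] := choice ap.
pose good n := forall t, 0 <= t <= 1 -> `|xn n t - stp N (bn n) (taun n) t| <= e.
exists (fun n => if pselect (good n) then stp N (bn n) (taun n) else w n), (stp N b tau).
have t01 i : (i < N)%N -> 0 <= tau i <= 1.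
  move=> iN; have [_ ht] := h2 i iN; apply/andP; split.
    by apply: (cvgr_to_ge ht); apply: nearW => n; have /andP[] := h1 n i iN.
  by apply: (cvgr_to_le ht); apply: nearW => n; have /andP[] := h1 n i iN.
split=> //.
- exact: Vspace_stp.
- by move=> n; case: pselect => ?; [exact: Vspace_stp|have [] := hw n].
- by move=> n t ht; case: pselect => [g|?]; [exact: g|have [_] := hw n; exact].
- apply: (@weak_cvgV_stp _ N _ bn taun) => //; last 2 first.
  + by move=> i /h2[].
  + by move=> i /h2[].
  by apply: filterS h3 => n gn; case: pselect.
Qed.

Lemma S_continuous_cvg (f : (R -> R) -> R) (xn : nat -> R -> R) x0 : S_continuous f ->
  (forall n, cadlag01 (xn n)) -> cadlag01 x0 -> S_cvg xn x0 ->
  f (xn n) @[n --> \oo] --> f x0.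
Proof.
move=> fc cx c0 hS; apply/cvgrPdist_lt => e e0.
have hO : open (ball (f x0) e) by exact: ball_open.
have := fc _ hO xn x0 cx c0 hS (conj c0 (ballxx (f x0) e0)).
by apply: filterS => n [].
Qed.

(** With [m = n] and [y] the normalized partial sums this is [psum_proc] by conversion, so one
    notion serves both for the processes and for sampled paths. *)
Definition gridv (m : nat) (y : nat -> R) (t : R) : R := y (Num.truncn (m%:R * t)).
Definition grid (m : nat) x : R -> R := gridv m (fun k => x (k%:R / m%:R)).

Lemma truncn_le_grid m (t : R) : 0 <= t <= 1 -> (Num.truncn (m%:R * t) <= m)%N.
Proof.
move=> /andP[t0 t1]; rewrite -[leqRHS](@natrK R); apply: le_truncn.
by rewrite ler_piMr.
Qed.

Lemma gridv_stp m (y : nat -> R) (t : R) : 0 <= t <= 1 -> gridv m y t =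
  stp m.+1 (fun i => y i - (if i is j.+1 then y j else 0)) (fun i => i%:R / m%:R) t.
Proof.
move=> ht; have hk := truncn_le_grid m ht; have /andP[t0 t1] := ht.
rewrite /gridv /stp; set k := Num.truncn _ in hk *.
have -> : \sum_(i < m.+1) (y i - (if val i is j.+1 then y j else 0)) * (i%:R / m%:R <= t)%R%:R =
    \sum_(i < m.+1 | (i < k.+1)%N) (y i - (if val i is j.+1 then y j else 0)).
  rewrite [RHS]big_mkcond; apply: eq_bigr => i _; rewrite ltnS.
  have -> : (i%:R / m%:R <= t) = (i <= k)%N.
    have [m0|m0] := posnP m.
      have i0 : i = 0%N :> nat by have := ltn_ord i; move: (nat_of_ord i) => j; rewrite m0; case: j.
      by rewrite i0 mul0r t0 leq0n.
    by rewrite ler_pdivrMr ?ltr0n// truncn_ge_nat ?mulr_ge0// mulrC.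
  by case: leqP => _; rewrite ?mulr1 ?mulr0.
rewrite (big_ord_narrow (hk : (k < m.+1)%N)) /=.
elim: (k) => [|j ih]; first by rewrite big_ord_recl big_ord0 subr0 addr0.
by rewrite big_ord_recr/= -ih addrC subrK.
Qed.

Lemma cadlag01_ext x y : (forall t, 0 <= t <= 1 -> x t = y t) -> cadlag01 x -> cadlag01 y.
Proof.
move=> h cx; apply: cadlag01_uniform_lim => e e0; exists x => // t ht.
by rewrite h// subrr normr0 ltW.
Qed.

Lemma cadlag01_gridv m (y : nat -> R) : cadlag01 (gridv m y).
Proof.
by apply: (cadlag01_ext (fun t ht => esym (gridv_stp m y ht))); exact: cadlag01_stp.
Qed.

Definition natceil (z : R) : nat :=
  if (Num.truncn z)%:R == z then Num.truncn z else (Num.truncn z).+1.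

Lemma natceil_itv z : 0 <= z -> z <= (natceil z)%:R < z + 1.
Proof.
move=> z0; have /andP[h1 h2] := truncn_itv z0; rewrite /natceil.
case: eqP => [->|/eqP h3]; first by rewrite lexx ltrDl ltr01.
by rewrite (ltW h2) -natr1 ltrD2r lt_neqAle h3.
Qed.

Lemma natceil_le z k : 0 <= z -> (natceil z <= k)%N = (z <= k%:R).
Proof.
move=> z0; have /andP[h1 h2] := natceil_itv z0; apply/idP/idP => h.
  by apply: le_trans h1 _; rewrite ler_nat.
by rewrite -ltnS -(ltr_nat R) -natr1; apply: lt_le_trans h2 _; rewrite lerD2r.
Qed.

(** Sampling delays a jump to the next grid point and keeps its size. A sampled step function is
    therefore a step function with the same number of jumps, each displaced by at most 1/m. *)
Lemma grid_stp m N b tau (t : R) : (0 < m)%N -> 0 <= t -> (forall i, (i < N)%N -> 0 <= tau i) ->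
  grid m (stp N b tau) t = stp N b (fun i => (natceil (m%:R * tau i))%:R / m%:R) t.
Proof.
move=> m0 t0 ht; rewrite /grid /gridv /stp; apply: eq_bigr => i _; congr (_ * _).
have mR : (0 : R) < m%:R by rewrite ltr0n.
rewrite ler_pdivlMr// ler_pdivrMr// mulrC -natceil_le ?mulr_ge0 ?ht//.
by rewrite truncn_ge_nat ?mulr_ge0 ?(ltW mR)// (mulrC t).
Qed.

Lemma natceil_grid m (s : R) : (0 < m)%N -> 0 <= s <= 1 ->
  0 <= ((natceil (m%:R * s))%:R / m%:R : R) <= 1 /\
  `|(natceil (m%:R * s))%:R / m%:R - s| <= m%:R^-1.
Proof.
move=> m0 /andP[s0 s1]; have mR : (0 : R) < m%:R by rewrite ltr0n.
have ms0 : 0 <= m%:R * s by rewrite mulr_ge0// ltW.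
have /andP[h1 h2] := natceil_itv ms0; split.
  rewrite divr_ge0 ?ler_pdivrMr// mul1r ler_nat natceil_le//.
  by rewrite ler_piMr// ltW.
have -> : (natceil (m%:R * s))%:R / m%:R - s = ((natceil (m%:R * s))%:R - m%:R * s) / m%:R.
  by rewrite mulrBl [m%:R * s]mulrC mulfK// gt_eqF.
rewrite ger0_norm ?divr_ge0 ?subr_ge0// ?(ltW mR)//.
by rewrite ler_pdivrMr// mulVf ?gt_eqF// lerBlDl ltW.
Qed.

End step_function_limits.

(** * Compactness for S-convergence *)

Section compactness.
Variable R : realType.
Implicit Types (x y v : R -> R) (b tau : nat -> R).

Definition inv_succ (l : nat) : R := l.+1%:R^-1.

Lemma inv_succ_ge0 l : 0 <= inv_succ l. Proof. by rewrite invr_ge0. Qed.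

Lemma inv_succ_le l l' : (l <= l')%N -> inv_succ l' <= inv_succ l.
Proof. by move=> h; rewrite lef_pV2 ?posrE// ler_nat ltnS. Qed.

Lemma near_inv_succ (c : R) : 0 < c -> \forall l \near \oo, inv_succ l < c.
Proof. by move=> c0; exact: (near_infty_natSinv_lt (PosNum c0)). Qed.

Definition stp_approximable x (N : nat) (L e : R) := exists b tau,
  (forall i, (i < N)%N -> `|b i| <= L /\ 0 <= tau i <= 1) /\
  forall t, 0 <= t <= 1 -> `|x t - stp N b tau t| <= e.

Lemma stp_near_right N b tau (t : R) : \forall s \near t^'+, stp N b tau s = stp N b tau t.
Proof.
have h : \forall s \near t^'+, forall i : 'I_N, (tau i <= s) = (tau i <= t).
  by apply: filter_forall => i; exact: jump_right.
by apply: filterS h => s hs; apply: eq_bigr => i _; rewrite hs.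
Qed.

Lemma near_right_neq (u t : R) : \forall s \near t^'+, s != u.
Proof.
have [h|h] := leP u t.
  near=> s; rewrite gt_eqF//; apply: (le_lt_trans h); near: s; exact: nbhs_right_gt.
near=> s; rewrite lt_eqF//; near: s; exact: nbhs_right_lt.
Unshelve. all: by end_near. Qed.

(** Convergence at [t] can fail when [t] is a limit of jump times. The second alternative is meant
    for t = 1, where all jumps have already taken place, both along the sequence and in the
    limit. *)
Lemma stp_cvg N (bn taun : nat -> nat -> R) b tau (t : R) :
  (forall i, (i < N)%N -> (bn ^~ i @ \oo --> b i) /\ (taun ^~ i @ \oo --> tau i)) ->
  (forall i, (i < N)%N -> t != tau i \/
     (tau i <= t /\ forall n, taun n i <= t)) ->
  stp N (bn n) (taun n) t @[n --> \oo] --> stp N b tau t.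
Proof.
move=> h1 h2; apply: cvg_sumr => i; have [hb ht] := h1 i (ltn_ord i).
apply: cvgM => //; apply: cvg_near_cst.
suff : \forall n \near \oo, (taun n i <= t) = (tau i <= t) by apply: filterS => n ->.
have [ne|[le1 len]] := h2 i (ltn_ord i); last by apply: nearW => n; rewrite le1 len.
have [h|h|h] := ltgtP (tau i) t.
- by move: ht => /cvgr_lt/(_ _ h); apply: filterS => n /ltW ->.
- by move: ht => /cvgr_gt/(_ _ h); apply: filterS => n hn; rewrite leNgt hn.
- by rewrite h eqxx in ne.
Qed.

(** The bound passes to the limit at t = 1 and at every [t] that is not a limit jump time. Only
    finitely many [t] are left, and right continuity covers them. *)
Lemma stp_limits_close N N' (bn taun bn' taun' : nat -> nat -> R) b tau b' tau' (e : R) :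
  (forall n i, (i < N)%N -> 0 <= taun n i <= 1) ->
  (forall n i, (i < N')%N -> 0 <= taun' n i <= 1) ->
  (forall i, (i < N)%N -> (bn ^~ i @ \oo --> b i) /\ (taun ^~ i @ \oo --> tau i)) ->
  (forall i, (i < N')%N -> (bn' ^~ i @ \oo --> b' i) /\ (taun' ^~ i @ \oo --> tau' i)) ->
  (\forall n \near \oo, forall t, 0 <= t <= 1 ->
     `|stp N (bn n) (taun n) t - stp N' (bn' n) (taun' n) t| <= e) ->
  forall t, 0 <= t <= 1 -> `|stp N b tau t - stp N' b' tau' t| <= e.
Proof.
move=> t01 t01' h h' hn.
have le1 M (tn : nat -> nat -> R) s i : (forall n i, (i < M)%N -> 0 <= tn n i <= 1) -> (i < M)%N ->
    tn ^~ i @ \oo --> s -> s <= 1.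
  move=> hM iM hs; apply: (cvgr_to_le hs); apply: nearW => n.
  by have /andP[] := hM n i iM.
have good t : 0 <= t <= 1 -> (t = 1 \/ (forall i, (i < N)%N -> t != tau i) /\
   (forall i, (i < N')%N -> t != tau' i)) ->
   `|stp N b tau t - stp N' b' tau' t| <= e.
  move=> ht hg.
  have c1 : stp N (bn n) (taun n) t @[n --> \oo] --> stp N b tau t.
    apply: stp_cvg => // i iN; have [->|[g1 _]] := hg; last by left; exact: g1.
    right; split; last by move=> n; have /andP[] := t01 n i iN.
    by have [_ /(le1 _ _ _ _ t01 iN)] := h i iN.
  have c2 : stp N' (bn' n) (taun' n) t @[n --> \oo] --> stp N' b' tau' t.
    apply: stp_cvg => // i iN; have [->|[_ g2]] := hg; last by left; exact: g2.
    right; split; last by move=> n; have /andP[] := t01' n i iN.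
    by have [_ /(le1 _ _ _ _ t01' iN)] := h' i iN.
  have c3 : `|stp N (bn n) (taun n) t - stp N' (bn' n) (taun' n) t| @[n --> \oo] -->
    `|stp N b tau t - stp N' b' tau' t| by apply: cvg_norm; exact: cvgB.
  by apply: (cvgr_to_le c3); apply: filterS hn => n; apply.
move=> t ht; have /andP[t0] := ht; rewrite le_eqVlt => /predU1P[t1|t1].
  by apply: good => //; left.
have n1 : \forall s \near t^'+, (forall i : 'I_N, s != tau i) /\ (forall i : 'I_N', s != tau' i).
  apply: filterI.
    by apply: (@filter_forall _ _ (fun (i : 'I_N) s => s != tau i) (t^'+) _) => i; exact: near_right_neq.
  by apply: (@filter_forall _ _ (fun (i : 'I_N') s => s != tau' i) (t^'+) _) => i; exact: near_right_neq.
have n2 := stp_near_right N b tau t; have n3 := stp_near_right N' b' tau' t.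
have n4 : \forall s \near t^'+, s < 1 by exact: nbhs_right_lt.
have n5 : \forall s \near t^'+, t < s by exact: nbhs_right_gt.
have [s [[[[[g1 g2] e1] e2] s1] ts]] := filter_ex (filterI (filterI (filterI (filterI n1 n2) n3) n4) n5).
rewrite -e1 -e2; apply: good; first by rewrite (le_trans t0) ?ltW.
right; split=> i iN; first exact: (g1 (Ordinal iN)).
exact: (g2 (Ordinal iN)).
Qed.

(** If no [k] works, choose a counterexample (x_k, y_k) for each [k]. Along a subsequence the
    approximants of every level l converge; their limits [V l] are uniformly Cauchy and define a
    path [x0]. Both x_k and y_k then S-converge to [x0], so f(x_k) - f(y_k) tends to 0, a
    contradiction. *)
Lemma S_equicontinuous (f : (R -> R) -> R) (N : nat -> nat) (L : nat -> R) (e : R) :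
  S_continuous f -> 0 < e -> exists k : nat, forall m x y,
  (k <= m)%N -> (0 < m)%N -> cadlag01 x -> cadlag01 y ->
  (forall l, (l <= k)%N -> stp_approximable x (N l) (L l) (inv_succ l)) ->
  (forall t, 0 <= t <= 1 -> `|y t - grid m x t| <= inv_succ k) ->
  `|f x - f y| <= e.
Proof.
move=> fc e0; apply: contrapT => hno.
have {}hno k : exists q : nat * (R -> R) * (R -> R), let: (m, x, y) := q in
   [/\ (k <= m)%N /\ (0 < m)%N, cadlag01 x /\ cadlag01 y,
  (forall l, (l <= k)%N -> stp_approximable x (N l) (L l) (inv_succ l)),
  (forall t, 0 <= t <= 1 -> `|y t - grid m x t| <= inv_succ k) &
  e < `|f x - f y|].
  apply: contrapT => h; apply: hno; exists k => m x y km m0 cx cy ha hy.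
  by rewrite leNgt; apply/negP => hlt; apply: h; exists (m, x, y).
have [q hq] := choice hno.
pose m_ k := (q k).1.1; pose x_ k := (q k).1.2; pose y_ k := (q k).2.
have {}hq k : [/\ (k <= m_ k)%N /\ (0 < m_ k)%N, cadlag01 (x_ k) /\ cadlag01 (y_ k),
  (forall l, (l <= k)%N -> stp_approximable (x_ k) (N l) (L l) (inv_succ l)),
  (forall t, 0 <= t <= 1 -> `|y_ k t - grid (m_ k) (x_ k) t| <= inv_succ k) &
  e < `|f (x_ k) - f (y_ k)|].
  by have := hq k; rewrite /m_ /x_ /y_; case: (q k) => [[]].
have ex k l : exists bt : (nat -> R) * (nat -> R), (l <= k)%N ->
    (forall i, (i < N l)%N -> `|bt.1 i| <= L l /\ 0 <= bt.2 i <= 1) /\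
    forall t, 0 <= t <= 1 -> `|x_ k t - stp (N l) bt.1 bt.2 t| <= inv_succ l.
  have [lk|lk] := leqP l k; last by exists (fun=> 0, fun=> 0).
  have [_ _ /(_ l lk)[b [tau hbt]] _ _] := hq k.
  by exists (b, tau).
have [bt hbt] := choice (fun kl : nat * nat => ex kl.1 kl.2).
(* All jump sizes ([true]) and jump times ([false]) of all levels become one countable family, with
   0 where no approximant is available. Hence [|L| + 1] bounds sizes and times alike. *)
pose u k (j : nat * nat * bool) : R := let: (l, i, c) := j in
  if ((l <= k) && (i < N l))%N then (if c then (bt (k, l)).1 i else (bt (k, l)).2 i) else 0.
have hu k j : `|u k j| <= `|L j.1.1| + 1.
  case: j => [[l i] c] /=; case: ifP => [/andP[lk iN]|_]; last first.
    by rewrite normr0 addr_ge0.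
  have [/= /(_ i iN)[h1 /andP[h2 h3]] _] := hbt (k, l) lk.
  case: c; first by rewrite (le_trans h1)// (le_trans (ler_norm _))// lerDl.
  by rewrite ger0_norm// (le_trans h3)// lerDr.
have [phi [p [hphi hp]]] := diag_subseq hu.
pose B l (k i : nat) := u (phi k) (l, i, true).
pose Ta l (k i : nat) := u (phi k) (l, i, false).
pose b l (i : nat) := p (l, i, true).
pose ta l (i : nat) := p (l, i, false).
have hcv l i : (i < N l)%N -> ((B l)^~ i @ \oo --> b l i) /\ ((Ta l)^~ i @ \oo --> ta l i).
  by move=> iN; split; exact: hp.
have hT01 l k i : (i < N l)%N -> 0 <= Ta l k i <= 1.
  move=> iN; rewrite /Ta /u iN andbT; case: leqP => lk; last by rewrite lexx ler01.
  by have [/= /(_ i iN)[]] := hbt (phi k, l) lk.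
have happ l : \forall k \near \oo, forall t, 0 <= t <= 1 ->
    `|x_ (phi k) t - stp (N l) (B l k) (Ta l k) t| <= inv_succ l.
  near=> k => t ht; have lk : (l <= phi k)%N.
    by apply: leq_trans (hphi k); near: k; exact: nbhs_infty_ge.
  have [_ /(_ t ht)] := hbt (phi k, l) lk; rewrite /=.
  congr (`|_ - _| <= _); apply: eq_bigr => i _.
  by rewrite /B /Ta /u lk ltn_ord.
pose V l := stp (N l) (b l) (ta l).
have hV l l' t : 0 <= t <= 1 -> `|V l t - V l' t| <= inv_succ l + inv_succ l'.
  apply: (stp_limits_close (hT01 l) (hT01 l') (hcv l) (hcv l')).
  apply: filterS2 (happ l) (happ l') => k h1 h2 s hs.
  have {}h1 := h1 s hs; have {}h2 := h2 s hs; rewrite distrC in h1.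
  by apply: le_trans (lerD h1 h2); apply: ler_distD.
have hV2 l t : 0 <= t <= 1 -> \forall l' \near \oo, `|V l t - V l' t| <= 2 * inv_succ l.
  move=> ht; near=> l'; apply: le_trans (hV l l' t ht) _.
  have : inv_succ l' <= inv_succ l by apply: inv_succ_le; near: l'; exact: nbhs_infty_ge.
  lra.
have inv_small (c : R) : 0 < c -> exists l : nat, inv_succ l < c.
  by move=> /near_inv_succ[l _ hl]; exists l; exact: (hl l (leqnn _)).
have hcauchy t : 0 <= t <= 1 -> cvg (V l t @[l --> \oo]).
  move=> ht; apply: cvg_of_cauchy_ex => c c0.
  have [l hl] := inv_small (c / 2) ltac:(by rewrite divr_gt0).
  exists (V l t); apply: filterS (hV2 l t ht) => l' h.
  by apply: le_lt_trans h _; lra.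
pose x0 t := lim (V l t @[l --> \oo]).
have hx0 l t : 0 <= t <= 1 -> `|x0 t - V l t| <= 2 * inv_succ l.
  move=> ht; have c1 : `|V l t - V l' t| @[l' --> \oo] --> `|V l t - x0 t|.
    by apply: cvg_norm; apply: cvgB; [exact: cvg_cst|exact: hcauchy].
  rewrite distrC; apply: (cvgr_to_le c1); exact: hV2.
have c0 : cadlag01 x0.
  apply: cadlag01_uniform_lim => c cp.
  have [l hl] := inv_small (c / 2) ltac:(by rewrite divr_gt0).
  exists (V l); first exact: cadlag01_stp.
  by move=> t ht; apply: le_trans (hx0 l t ht) _; lra.
have Sx : S_cvg (x_ \o phi) x0.
  apply: S_cvg_stp => [n|c cp]; first by have [_ []] := hq (phi n).
  have [l hl] := inv_small (c / 2) ltac:(by rewrite divr_gt0).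
  have l0 := inv_succ_ge0 l.
  exists (N l), (B l), (Ta l), (b l), (ta l); split.
  - by move=> k i iN; exact: hT01.
  - exact: hcv.
  - by apply: filterS (happ l) => k h t ht; apply: le_trans (h t ht) _; lra.
  - by move=> t ht; apply: le_trans (hx0 l t ht) _; lra.
have Sy : S_cvg (y_ \o phi) x0.
  apply: S_cvg_stp => [n|c cp]; first by have [_ []] := hq (phi n).
  have [l hl] := inv_small (c / 3) ltac:(by rewrite divr_gt0).
  have l0 := inv_succ_ge0 l.
  (* The approximant of the sampled path: jump times rounded up to the grid. They keep their limits
     because [m_ (phi k)] tends to infinity. *)
  pose T2 k i : R := (natceil ((m_ (phi k))%:R * Ta l k i))%:R / (m_ (phi k))%:R.
  exists (N l), (B l), T2, (b l), (ta l).
  have m0 k : (0 < m_ (phi k))%N by have [[]] := hq (phi k).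
  have km k : (k <= m_ (phi k))%N by have [[/(leq_trans (hphi k))]] := hq (phi k).
  split.
  - by move=> k i iN; have [] := natceil_grid (m0 k) (hT01 l k i iN).
  - move=> i iN; have [hb ht] := hcv l i iN; split=> //.
    apply/cvgrPdist_le => d d0.
    have d20 : 0 < d / 2 by rewrite divr_gt0.
    have /cvgrPdist_le/(_ _ d20) h1 := ht.
    have [l0' hl0] := inv_small (d / 2) d20.
    near=> k.
    have hk1 : `|ta l i - Ta l k i| <= d / 2 by near: k.
    have [_ hk2] := natceil_grid (m0 k) (hT01 l k i iN).
    have hk3 : (m_ (phi k))%:R^-1 <= d / 2.
      apply: le_trans (ltW hl0); rewrite lef_pV2 ?posrE ?ltr0n// ler_nat.
      by apply: leq_trans (km k); near: k; exact: nbhs_infty_ge.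
    have -> : ta l i - T2 k i = (ta l i - Ta l k i) - (T2 k i - Ta l k i) by ring.
    apply: le_trans (ler_normB _ _) _; rewrite -/(T2 k i) in hk2; lra.
  - near=> k => t ht; have [_ _ _ /(_ t ht) h1 _] := hq (phi k).
    have h2 : `|grid (m_ (phi k)) (x_ (phi k)) t - stp (N l) (B l k) (T2 k) t| <= inv_succ l.
      have /andP[t0 t1] := ht.
      rewrite -(@grid_stp _ _ (N l) (B l k) (Ta l k))//; last first.
        by move=> i iN; have /andP[] := hT01 l k i iN.
      have hkl : forall s, 0 <= s <= 1 ->
        `|x_ (phi k) s - stp (N l) (B l k) (Ta l k) s| <= inv_succ l by near: k; exact: happ.
      apply: hkl; rewrite divr_ge0//= ler_pdivrMr ?ltr0n// mul1r ler_nat.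
      exact: truncn_le_grid.
    have h3 : inv_succ (phi k) <= inv_succ l.
      apply: inv_succ_le; apply: leq_trans (hphi k).
      near: k; exact: nbhs_infty_ge.
    apply: le_trans (ler_distD (grid (m_ (phi k)) (x_ (phi k)) t) _ _) _.
    rewrite /=; lra.
  - by move=> t ht; apply: le_trans (hx0 l t ht) _; lra.
have cx n : cadlag01 ((x_ \o phi) n) by have [_ []] := hq (phi n).
have cy n : cadlag01 ((y_ \o phi) n) by have [_ []] := hq (phi n).
have fx := S_continuous_cvg fc cx c0 Sx; have fy := S_continuous_cvg fc cy c0 Sy.
have hcv0 : `|f ((x_ \o phi) k) - f ((y_ \o phi) k)| @[k --> \oo] --> (0 : R).
  by rewrite -(normr0 R) -(subrr (f x0)); apply: cvg_norm; exact: cvgB.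
have hlt : \forall k \near \oo, `|f ((x_ \o phi) k) - f ((y_ \o phi) k)| < e.
  by move: hcv0 => /cvgr_lt; apply.
have [k hk] := filter_ex hlt.
by have [_ _ _ _] := hq (phi k); rewrite ltNge ltW.
Unshelve. all: by end_near. Qed.

End compactness.

Section grids.
Variable R : realType.
Implicit Types (x y : R -> R) (b tau : nat -> R).

(** This makes [f x] a limit of functions of finitely many values of [x]. Both the measurability of
    [f] along a process and the reduction of the limit process to a grid rest on it. *)
Lemma S_continuous_grid (f : (R -> R) -> R) x : S_continuous f -> cadlag01 x ->
  f (grid m x) @[m --> \oo] --> f x.
Proof.
move=> fc cx; apply: (@S_continuous_cvg _ f (fun m => grid m x)) => //.
  by move=> m; exact: cadlag01_gridv.
apply: S_cvg_stp => [m|e e0]; first exact: cadlag01_gridv.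
have [N [b [tau [ht hx]]]] := cadlag_stp_approx cx e0.
pose tn m i : R := if (0 < m)%N then (natceil (m%:R * tau i))%:R / m%:R else 0.
exists N, (fun=> b), tn, b, tau; split=> //.
- move=> m i iN; rewrite /tn; case: ifP => m0; last by rewrite lexx ler01.
  by have [] := natceil_grid m0 (ht i iN).
- move=> i iN; split; first exact: cvg_cst.
  apply/cvgrPdist_le => d d0.
  have [l _ hl] := near_inv_succ d0.
  near=> m.
  have lm : (l < m)%N by near: m; exact: nbhs_infty_gt.
  have m0 : (0 < m)%N by exact: leq_ltn_trans lm.
  rewrite /tn m0 distrC; have [_ h] := natceil_grid m0 (ht i iN).
  apply: (le_trans h); apply: le_trans (ltW (hl l (leqnn l))).
  by rewrite lef_pV2 ?posrE ?ltr0n// ler_nat.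
- near=> m => t t01.
  have m0 : (0 < m)%N by near: m; exact: nbhs_infty_gt.
  have /andP[t0 t1] := t01.
  have -> : stp N b (tn m) t = grid m (stp N b tau) t.
    by rewrite /tn m0 grid_stp// => i /ht/andP[].
  apply: hx; rewrite divr_ge0//= ler_pdivrMr ?ltr0n// mul1r ler_nat.
  exact: truncn_le_grid.
Unshelve. all: by end_near. Qed.

(** Convergence of finite dimensional distributions only tests continuous functions of a vector.
    Here the jump times are fixed and the jump sizes depend linearly on the vector, so convergent
    vectors give S-convergent paths. *)
Lemma continuous_gridv (f : (R -> R) -> R) m : S_continuous f ->
  continuous (fun y : 'rV[R]_m.+1 => f (gridv m (fun k => y ord0 (inord k)))).
Proof.
move=> fc y; apply/(@cvgrPdist_lt _ _ _ _ (nbhs_filter y)) => e e0; apply: contrapT => hno.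
pose F (y : 'rV[R]_m.+1) := f (gridv m (fun k => y ord0 (inord k))).
have ex k : exists z : 'rV[R]_m.+1, (forall i, `|y ord0 i - z ord0 i| < inv_succ R k) /\ e <= `|F y - F z|.
  apply: contrapT => h; apply: hno; apply/nbhs_ballP.
  have k0 : 0 < inv_succ R k by rewrite invr_gt0.
  exists (inv_succ R k) => //= z [_ hz]; rewrite ltNge; apply/negP => hle.
  by apply: h; exists z; split=> // i; exact: hz.
have [z hz] := choice ex.
have hS : S_cvg (fun n => gridv m (fun k => z n ord0 (inord k)))
    (gridv m (fun k => y ord0 (inord k))).
  apply: S_cvg_stp => [n|c c0]; first exact: cadlag01_gridv.
  have zy i : z ^~ ord0 ^~ i @ \oo --> y ord0 i.
    apply/cvgrPdist_lt => d d0; apply: filterS (near_inv_succ d0) => n hn.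
    by apply: lt_trans hn; exact: (hz n).1.
  pose tn i : R := if (0 < m)%N then i%:R / m%:R else 0.
  have st (u : nat -> R) (t : R) : 0 <= t <= 1 -> gridv m u t =
      stp m.+1 (fun i => u i - (if i is j.+1 then u j else 0)) tn t.
    move=> ht; rewrite gridv_stp//; apply: eq_bigr => i _; rewrite /tn; case: ifP => // /negbT.
    rewrite -eqn0Ngt => /eqP m0; have -> : (m%:R : R) = 0 by rewrite m0.
    by rewrite invr0 mulr0.
  exists m.+1, (fun n i => z n ord0 (inord i) - (if i is j.+1 then z n ord0 (inord j) else 0)),
    (fun=> tn), (fun i => y ord0 (inord i) - (if i is j.+1 then y ord0 (inord j) else 0)), tn.
  split.
  - move=> _ i im; rewrite /tn; case: ifP => m0; last by rewrite lexx ler01.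
    by rewrite divr_ge0//= ler_pdivrMr ?ltr0n// mul1r ler_nat -ltnS.
  - move=> i im; split; last exact: cvg_cst.
    apply: cvgB; first exact: zy.
    by case: i im => [|i] im; [exact: cvg_cst|exact: zy].
  - by apply: nearW => n t ht; rewrite st// subrr normr0 ltW.
  - by move=> t ht; rewrite st// subrr normr0 ltW.
have := S_continuous_cvg fc (fun n => cadlag01_gridv m _) (cadlag01_gridv m _) hS.
move=> /cvgrPdist_lt/(_ _ e0) hn.
by have [n] := filter_ex hn; rewrite ltNge (hz n).2.
Qed.

Lemma telescope_prev (u : nat -> R) k :
  \sum_(i < k.+1) (u i - (if val i is j.+1 then u j else 0)) = u k.
Proof.
elim: k => [|j ih]; first by rewrite big_ord_recl big_ord0 subr0 addr0.
by rewrite big_ord_recr/= ih addrC subrK.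
Qed.

(* The approximant jumps whenever the variation of [v] passes a multiple of [e]. *)
Lemma stp_approximable_tv (v : nat -> R) n (L e : R) : 0 < e -> v 0%N = 0 ->
  \sum_(i < n) `|v i.+1 - v i| <= L ->
  stp_approximable (gridv n v) (Num.truncn (L / e)).+1 L e.
Proof.
move=> e0 v0 hL; pose V k := \sum_(i < k) `|v i.+1 - v i|.
have V0 k : 0 <= V k by apply: sumr_ge0.
have VS k : V k.+1 = V k + `|v k.+1 - v k| by rewrite /V big_ord_recr.
have Vdiff k k' : (k <= k')%N -> `|v k' - v k| <= V k' - V k.
  move=> kk; rewrite -(subnKC kk); elim: (k' - k)%N => [|j ih].
    by rewrite addn0 !subrr normr0.
  rewrite addnS VS; have -> : v (k + j).+1 - v k = (v (k + j).+1 - v (k + j)%N) + (v (k + j)%N - v k) by ring.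
  by apply: le_trans (ler_normD _ _) _; lra.
have Vmono k k' : (k <= k')%N -> V k <= V k'.
  by move=> /Vdiff h; rewrite -subr_ge0 (le_trans _ h).
have VL k : (k <= n)%N -> V k <= L by move=> /Vmono h; exact: le_trans hL.
(* The first index at which the variation reaches [j * e], or [n.+1] if it never does; in the latter
   case the j-th jump below gets size 0 and the dummy time 1. *)
pose kap j := find (fun k => j%:R * e <= V k) (iota 0 n.+1).
have kapP j k : (k <= n)%N -> (kap j <= k)%N = (j%:R * e <= V k).
  move=> kn; apply/idP/idP => h.
    have kn' : (kap j < n.+1)%N by rewrite ltnS (leq_trans h).
    have hh : has (fun k => j%:R * e <= V k) (iota 0 n.+1) by rewrite has_find size_iota.
    have := nth_find 0%N hh; rewrite -/(kap j) nth_iota//= add0n => h'.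
    by apply: le_trans h' _; exact: Vmono.
  rewrite leqNgt; apply/negP => hk; have := before_find 0%N hk.
  by rewrite nth_iota// add0n h.
pose w j := v (kap j).
pose b j := if (kap j <= n)%N then w j - (if j is i.+1 then w i else 0) else 0.
pose tau j : R := if (kap j <= n)%N then (if (0 < n)%N then (kap j)%:R / n%:R else 0) else 1.
have kapS j : (kap j <= kap j.+1)%N.
  have [h|h] := leqP (kap j.+1) n; last first.
    apply: leq_trans h; rewrite -[n.+1](size_iota 0); exact: find_size.
  rewrite kapP//; have := kapP j.+1 _ h; rewrite leqnn => /esym; apply: le_trans.
  by rewrite ler_pM2r// ler_nat.
have L0 : 0 <= L by apply: le_trans hL; exact: (V0 n).
exists b, tau; split=> [j hj|t ht].
  split; last first.
    rewrite /tau; case: ifP => h; last by rewrite ler01 lexx.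
    case: ifP => n0; last by rewrite lexx ler01.
    by rewrite divr_ge0//= ler_pdivrMr ?ltr0n// mul1r ler_nat.
  rewrite /b; case: ifP => h; last by rewrite normr0.
  case: j h {hj} => [h|j h].
    rewrite subr0 /w; have := Vdiff 0%N (kap 0%N) (leq0n _); rewrite v0 subr0 => h1.
    by apply: le_trans h1 _; have := VL _ h; have := V0 0%N; lra.
  apply: le_trans (Vdiff _ _ (kapS j)) _.
  by have := VL _ h; have := V0 (kap j); lra.
have hk := truncn_le_grid n ht; rewrite /gridv /stp; set k := Num.truncn (n%:R * t) in hk *.
have /andP[t0 t1] := ht.
(* The last level reached at index [k]. The jumps up to time [t] telescope to [v (kap J)], and the
   variation between [kap J] and [k] is less than [e]. *)
pose J := Num.truncn (V k / e).
have jJ j : (j <= J)%N = (kap j <= k)%N.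
  by rewrite kapP// truncn_ge_nat ?divr_ge0 ?(ltW e0)// ler_pdivlMr.
have JL : (J < (Num.truncn (L / e)).+1)%N.
  by rewrite ltnS; apply: le_truncn; rewrite ler_pM2r ?invr_gt0// VL.
have -> : \sum_(i < (Num.truncn (L / e)).+1) b i * (tau i <= t)%R%:R =
   \sum_(i < (Num.truncn (L / e)).+1 | (i < J.+1)%N) (w i - (if val i is j.+1 then w j else 0)).
  rewrite [RHS]big_mkcond; apply: eq_bigr => i _; rewrite ltnS jJ /b /tau.
  have [h|h] := leqP (kap i) n; last by rewrite mul0r leqNgt (leq_ltn_trans hk h).
  have -> : ((if (0 < n)%N then (kap i)%:R / n%:R else 0) <= t) = (kap i <= k)%N.
    case: ifP => n0; last first.
      have : (kap i <= 0)%N by apply: leq_trans h _; rewrite leqNgt n0.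
      by rewrite leqn0 => /eqP ->; rewrite t0 leq0n.
    by rewrite ler_pdivrMr ?ltr0n// truncn_ge_nat ?mulr_ge0// (mulrC t).
  by case: ifP => _; rewrite ?mulr1 ?mulr0.
rewrite (big_ord_narrow JL) /= telescope_prev /w.
have kJ : (kap J <= k)%N by rewrite -jJ.
apply: le_trans (Vdiff _ _ kJ) _.
have /andP[_ h2] := @truncn_itv _ (V k / e) ltac:(by rewrite divr_ge0// ltW).
have h1 : J%:R * e <= V (kap J) by rewrite -kapP// (leq_trans kJ).
have : V k < J.+1%:R * e by rewrite -ltr_pdivrMr.
by rewrite -natr1 mulrDl mul1r; lra.
Qed.

End grids.

(** * Expectations and independence *)

Section bounded_measurable.
Context d (T : measurableType d) (R : realType).
Implicit Types (f g : T -> R).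

Definition bmfun f := measurable_fun setT f /\ exists M, forall w, `|f w| <= M.

Lemma bmfun_cst (c : R) : bmfun (fun=> c).
Proof. by split; [exact: measurable_cst|exists `|c|]. Qed.

Lemma bmfunD f g : bmfun f -> bmfun g -> bmfun (fun w => f w + g w).
Proof.
move=> [mf [M hM]] [mg [N hN]]; split; first exact: measurable_funD.
by exists (M + N) => w; apply: le_trans (ler_normD _ _) _; exact: lerD.
Qed.

Lemma bmfunM f g : bmfun f -> bmfun g -> bmfun (fun w => f w * g w).
Proof.
move=> [mf [M hM]] [mg [N hN]]; split; first exact: measurable_funM.
by exists (M * N) => w; rewrite normrM; apply: ler_pM.
Qed.

Lemma bmfunZ (c : R) f : bmfun f -> bmfun (fun w => c * f w).
Proof. by move=> bf; apply: bmfunM => //; exact: bmfun_cst. Qed.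

Lemma bmfunN f : bmfun f -> bmfun (fun w => - f w).
Proof.
by move=> /(bmfunZ (-1)); congr bmfun; apply/funext => w; rewrite mulN1r.
Qed.

Lemma bmfunB f g : bmfun f -> bmfun g -> bmfun (fun w => f w - g w).
Proof. by move=> bf bg; apply: bmfunD => //; exact: bmfunN. Qed.

Lemma bmfunX f : bmfun f -> bmfun (fun w => f w ^+ 2).
Proof. by move=> bf; exact: (bmfunM bf bf). Qed.

Lemma bmfun_sum (I : Type) (r : seq I) (F : I -> T -> R) :
  (forall i, bmfun (F i)) -> bmfun (fun w => \sum_(i <- r) F i w).
Proof.
move=> hF; elim: r => [|i r ih].
  by under eq_fun do rewrite big_nil; exact: bmfun_cst.
by under eq_fun do rewrite big_cons; exact: bmfunD.
Qed.

Lemma bmfun_norm f : bmfun f -> bmfun (fun w => `|f w|).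
Proof.
move=> [mf [M hM]]; split; first exact: measurableT_comp.
by exists M => w; rewrite normr_id.
Qed.

Lemma bmfun_max f g : bmfun f -> bmfun g -> bmfun (fun w => Num.max (f w) (g w)).
Proof.
move=> [mf [M hM]] [mg [N hN]]; split; first exact: measurable_maxr.
exists (Num.max M N) => w; have := hM w; have := hN w.
by case: (leP (f w) (g w)) => _ h1 h2; rewrite le_max ?h1 ?h2 ?orbT.
Qed.

Lemma bmfun_indic (A : set T) : measurable A -> bmfun (\1_A).
Proof.
move=> mA; split; first exact: measurable_indic.
by exists 1 => w; rewrite indicE; case: (w \in A); rewrite ?normr1 ?normr0.
Qed.

Lemma bmfun_comp (psi : R -> R) f (M : R) : measurable_fun setT psi ->
  (forall x, `|psi x| <= M) -> measurable_fun setT f -> bmfun (fun w => psi (f w)).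
Proof. by move=> mp hp mf; split; [exact: measurableT_comp|exists M]. Qed.

End bounded_measurable.

Section expectation.
Context d (T : measurableType d) (R : realType) (P : probability T R).
Implicit Types (f g : T -> R) (A B : set T).

Definition Ex f : R := \int[P]_w f w.
Definition Pr A : R := fine (P A).

Lemma bmfun_integrable f : bmfun f -> P.-integrable setT (EFin \o f).
Proof.
move=> [mf [M hM]]; apply: measurable_bounded_integrable => //.
  by rewrite -ge0_fin_numE// fin_num_measure.
exists M; split; first exact: num_real.
by move=> x Mx w _ /=; apply: le_trans (hM w) (ltW Mx).
Qed.

Lemma expectationE f : bmfun f -> ('E_P[f] = (Ex f)%:E)%E.
Proof.
move=> bf; rewrite unlock /Ex /Rintegral fineK//.
exact: (integrable_fin_num _ (bmfun_integrable bf)).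
Qed.

Lemma ExD f g : bmfun f -> bmfun g -> Ex (fun w => f w + g w) = Ex f + Ex g.
Proof. by move=> bf bg; rewrite /Ex RintegralD//; exact: bmfun_integrable. Qed.

Lemma ExB f g : bmfun f -> bmfun g -> Ex (fun w => f w - g w) = Ex f - Ex g.
Proof. by move=> bf bg; rewrite /Ex RintegralB//; exact: bmfun_integrable. Qed.

Lemma ExZ (c : R) f : bmfun f -> Ex (fun w => c * f w) = c * Ex f.
Proof. by move=> bf; rewrite /Ex RintegralZl//; exact: bmfun_integrable. Qed.

Lemma Ex_cst (c : R) : Ex (fun=> c) = c.
Proof. rewrite /Ex /Rintegral (integral_cst P measurableT c%:E).
by have := @probability_setT _ _ _ P => /= ->; rewrite mule1. Qed.

Lemma Ex_le f g : bmfun f -> bmfun g -> (forall w, f w <= g w) -> Ex f <= Ex g.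
Proof. by move=> bf bg fg; apply: le_Rintegral => //; exact: bmfun_integrable. Qed.

Lemma Ex_ge0 f : (forall w, 0 <= f w) -> 0 <= Ex f.
Proof. by move=> f0; apply: Rintegral_ge0. Qed.

Lemma Ex_norm f : bmfun f -> `|Ex f| <= Ex (fun w => `|f w|).
Proof. by move=> bf; apply: le_normr_Rintegral => //; exact: bmfun_integrable. Qed.

Lemma Ex_sum (I : Type) (r : seq I) (F : I -> T -> R) : (forall i, bmfun (F i)) ->
  Ex (fun w => \sum_(i <- r) F i w) = \sum_(i <- r) Ex (F i).
Proof.
move=> hF; elim: r => [|i r ih].
  by under [X in Ex X]eq_fun do rewrite big_nil; rewrite big_nil Ex_cst.
under [X in Ex X]eq_fun do rewrite big_cons.
by rewrite big_cons ExD// ?ih//; exact: bmfun_sum.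
Qed.

Lemma Ex_indic A : measurable A -> Ex (\1_A) = Pr A.
Proof. by move=> mA; rewrite /Ex /Rintegral integral_indic// setIT. Qed.

Lemma PrK A : measurable A -> P A = (Pr A)%:E.
Proof. by move=> mA; rewrite /Pr fineK// fin_num_measure. Qed.

Lemma Pr_ge0 A : 0 <= Pr A.
Proof. by rewrite fine_ge0. Qed.

Lemma Pr_le A B : measurable A -> measurable B -> A `<=` B -> Pr A <= Pr B.
Proof. by move=> mA mB AB; rewrite -lee_fin -!PrK// le_measure// inE. Qed.

Lemma PrU_le A B : measurable A -> measurable B -> Pr (A `|` B) <= Pr A + Pr B.
Proof.
move=> mA mB; rewrite -lee_fin EFinD -!PrK//; last exact: measurableU.
exact: measureU2.
Qed.

Lemma Pr_set0 : Pr set0 = 0. Proof. by rewrite /Pr measure0. Qed.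

Lemma Pr_bigU_le (I : eqType) (s : seq I) (F : I -> set T) :
  (forall i, measurable (F i)) ->
  Pr [set w | exists2 i, i \in s & F i w] <= \sum_(i <- s) Pr (F i).
Proof.
move=> mF; suff : measurable [set w | exists2 i, i \in s & F i w] /\
  Pr [set w | exists2 i, i \in s & F i w] <= \sum_(i <- s) Pr (F i) by case.
elim: s => [|i s [ihm ih]].
  have -> : [set w | exists2 i, i \in [::] & F i w] = set0.
    by apply/seteqP; split=> w // -[].
  by rewrite Pr_set0 big_nil; split.
have -> : [set w | exists2 i0, i0 \in i :: s & F i0 w] =
    F i `|` [set w | exists2 i, i \in s & F i w].
  apply/seteqP; split=> w /=.
    move=> [j]; rewrite inE => /predU1P[->|js] h; first by left.
    by right; exists j.
  move=> [h|[j js h]]; first by exists i; rewrite ?inE ?eqxx.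
  by exists j; rewrite ?inE ?js ?orbT.
split; first exact: measurableU.
by rewrite big_cons; apply: le_trans (PrU_le _ _) _ => //; rewrite lerD2l.
Qed.

Lemma measurable_exists_seq (I : eqType) (s : seq I) (F : I -> set T) :
  (forall i, measurable (F i)) -> measurable [set w | exists2 i, i \in s & F i w].
Proof.
move=> mF; rewrite (_ : [set _ | _] = \bigcup_(i in [set` s]) F i).
  by apply: fin_bigcup_measurable => // i _; exact: mF.
by apply/seteqP; split=> w [i]; exists i.
Qed.

Lemma measurable_set_lt f (c : R) : measurable_fun setT f -> measurable [set w | c < f w].
Proof.
move=> mf; rewrite (_ : [set w | _] = setT `&` f @^-1` `]c, +oo[%classic).
  by apply: mf.
by rewrite setTI; apply/seteqP; split=> w /=; rewrite in_itv/= andbT.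
Qed.

Lemma measurable_set_le f (c : R) : measurable_fun setT f -> measurable [set w | f w <= c].
Proof.
move=> mf; rewrite (_ : [set w | _] = ~` [set w | c < f w]).
  exact/measurableC/measurable_set_lt.
by apply/seteqP; split=> w /=; rewrite leNgt => /negP.
Qed.

Lemma Ex_markov f (c : R) : bmfun f -> (forall w, 0 <= f w) -> 0 < c ->
  c * Pr [set w | c < f w] <= Ex f.
Proof.
move=> bf f0 c0; have mA : measurable [set w | c < f w] by apply: measurable_set_lt; case: bf.
rewrite -Ex_indic// -ExZ; last exact: bmfun_indic.
apply: Ex_le => //; first by apply: bmfunZ; exact: bmfun_indic.
move=> w; rewrite indicE; have [h|h] := boolP (w \in _); last by rewrite mulr0.
by rewrite mulr1 ltW//; rewrite inE in h.
Qed.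

Lemma Ex_close f g A (e M : R) : bmfun f -> bmfun g -> measurable A ->
  (forall w, `|f w| <= M) -> (forall w, `|g w| <= M) -> 0 <= e ->
  (forall w, A w -> `|f w - g w| <= e) ->
  `|Ex f - Ex g| <= e + 2 * M * Pr (~` A).
Proof.
move=> bf bg mA hf hg e0 hA; rewrite -ExB//; apply: le_trans (Ex_norm _) _; first exact: bmfunB.
have mC := measurableC mA.
have -> : e + 2 * M * Pr (~` A) = Ex (fun w => e + 2 * M * (\1_(~` A) w)).
  rewrite ExD ?ExZ ?Ex_cst ?Ex_indic//; first exact: bmfun_indic.
    exact: bmfun_cst.
  by apply: bmfunZ; exact: bmfun_indic.
apply: Ex_le; first by apply: bmfun_norm; exact: bmfunB.
  by apply: bmfunD; [exact: bmfun_cst|apply: bmfunZ; exact: bmfun_indic].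
move=> w; rewrite indicE; have [h|h] := boolP (w \in _).
  rewrite mulr1; apply: le_trans (ler_normB _ _) _.
  by have := hf w; have := hg w; lra.
rewrite mulr0 addr0; apply: hA; apply: contrapT => h'; move/negP: h; apply.
by rewrite inE.
Qed.

End expectation.

Section independence.
Context d (T : measurableType d) (R : realType) (P : probability T R).

(** The hypothesis identifies the law of the pair with the product of the two laws on rectangles,
    hence everywhere, and Fubini's theorem factors the integral. *)
Lemma Ex_mul_indep (U V : T -> R) : bmfun U -> bmfun V ->
  (forall B B', measurable B -> measurable B' ->
     P ((U @^-1` B) `&` (V @^-1` B')) = (P (U @^-1` B) * P (V @^-1` B'))%E) ->
  Ex P (fun w => U w * V w) = Ex P U * Ex P V.
Proof.
move=> bU bV hind.
have [mU _] := bU; have [mV _] := bV.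
pose mU' := isMeasurableFun.Build _ _ _ _ _ mU.
pose U' : {mfun T >-> R} := MeasurableFun.Pack (MeasurableFun.Class mU').
pose mV' := isMeasurableFun.Build _ _ _ _ _ mV.
pose V' : {mfun T >-> R} := MeasurableFun.Pack (MeasurableFun.Class mV').
have mUV : measurable_fun setT (fun w => (U w, V w)) by exact: measurable_fun_pair.
pose mUV' := isMeasurableFun.Build _ _ _ _ _ mUV.
pose W : {mfun T >-> (R * R)%type} := MeasurableFun.Pack (MeasurableFun.Class mUV').
pose m1 := distribution P U'; pose m2 := distribution P V'.
pose f (z : R * R) : \bar R := (z.1 * z.2)%:E.
have mf : measurable_fun setT f.
  apply/measurable_EFinP; apply: measurable_funM; [exact: measurable_fst|exact: measurable_snd].
have intf : P.-integrable setT (f \o W) by exact: bmfun_integrable (bmfunM bU bV).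
have prodE : forall S, measurable S -> (m1 \x m2)%E S = distribution P W S.
  by apply: product_measure_unique => A B mA mB; rewrite -hind.
have iU : m1.-integrable setT EFin.
  by apply: (@integrable_pushforward _ _ _ _ _ U mU P setT EFin) => //; exact: bmfun_integrable bU.
have iV : m2.-integrable setT EFin.
  by apply: (@integrable_pushforward _ _ _ _ _ V mV P setT EFin) => //; exact: bmfun_integrable bV.
have ifprod : (m1 \x m2)%E.-integrable setT f.
  have : (distribution P W).-integrable setT f.
    by apply: (@integrable_pushforward _ _ _ _ _ W mUV P setT f).
  move=> /integrableP[_ h]; apply/integrableP; split => //.
  by rewrite (eq_measure_integral (distribution P W)) // => S mS _; exact: prodE.
have eU : (\int[m1]_x x%:E = (Ex P U)%:E)%E.
  rewrite /m1 (integral_distribution _ (bmfun_integrable _ bU))//.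
  by rewrite -expectationE// unlock.
have eV : (\int[m2]_x x%:E = (Ex P V)%:E)%E.
  rewrite /m2 (integral_distribution _ (bmfun_integrable _ bV))//.
  by rewrite -expectationE// unlock.
apply/EFin_inj; rewrite -expectationE; last exact: bmfunM.
rewrite unlock; transitivity (\int[distribution P W]_z f z)%E.
  by rewrite integral_distribution.
transitivity (\int[(m1 \x m2)%E]_z f z)%E.
  by apply: eq_measure_integral => S mS _; exact/esym/prodE.
rewrite -(integral12_prod_meas1 ifprod) /fubini_F /f /=.
under eq_integral => x _.
  under eq_integral do rewrite EFinM.
  rewrite integralZl// eV.
  over.
by rewrite integralZr// eU -EFinM.
Qed.

Variables (I : eqType) (Y : I -> T -> R).
Hypotheses (mY : forall i, measurable_fun setT (Y i)) (iY : mutual_indep P Y).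

(** A pi-system whose generated sigma-algebra is that of the variables indexed by [s]. Taken as a
    second measurable structure on [T], it expresses that a function depends on these variables
    only. *)
Definition rects (s : seq I) : set (set T) := [set A | exists2 B : I -> set R,
  (forall i, measurable (B i)) & A = \bigcap_(i in [set` s]) (Y i @^-1` B i)].

Lemma setI_closed_rects s : setI_closed (rects s).
Proof.
move=> _ _ [B mB ->] [C mC ->]; exists (fun i => B i `&` C i).
  by move=> i; exact: measurableI.
apply/seteqP; split=> w.
  by move=> [h1 h2] i si; split; [exact: h1|exact: h2].
by move=> h; split=> i si; have [] := h i si.
Qed.

Lemma measurable_rect (B : I -> set R) (s : seq I) : (forall i, measurable (B i)) ->
  measurable (\bigcap_(i in [set` s]) (Y i @^-1` B i)).
Proof.
move=> mB; apply: fin_bigcap_measurable => // i _.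
by rewrite -[X in measurable X]setTI; exact: mY.
Qed.

(** Dynkin's theorem: mutual independence gives the product formula on the pi-system, and the sets
    satisfying it are stable under complements and disjoint countable unions. *)
Lemma indep_rects s j (B : set R) : uniq (j :: s) -> measurable B ->
  forall S, <<s rects s >> S -> measurable S /\
    P ((Y j @^-1` B) `&` S) = (P (Y j @^-1` B) * P S)%E.
Proof.
move=> us mB; set E := Y j @^-1` B.
have mE : measurable E by rewrite -[E]setTI; exact: mY.
apply: (@dynkin_induction _ (g_sigma_algebraType (rects s)) (rects s)) => //.
- exact: setI_closed_rects.
- by split=> //; rewrite setIT probability_setT mule1.
- move=> _ [C mC ->]; split; first exact: measurable_rect.
  pose D i := if i == j then B else C i.
  have mD i : measurable (D i) by rewrite /D; case: ifP.
  have js : forall i, i \in s -> i == j = false.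
    by move=> i si; apply/negP => /eqP ij; move: us; rewrite /= -ij si.
  have := iY us mD; rewrite big_cons /= {1 2}/D eqxx -/E.
  have -> : \bigcap_(i in [set` j :: s]) (Y i @^-1` D i) =
      E `&` \bigcap_(i in [set` s]) (Y i @^-1` C i).
    apply/seteqP; split=> w.
      move=> h; split; first by have := h j; rewrite /= inE eqxx /D eqxx; apply.
      by move=> i /= si; have := h i; rewrite /= inE si orbT /D js//; apply.
    move=> [h1 h2] i /=; rewrite inE => /predU1P[->|si]; first by rewrite /D eqxx.
    by rewrite /D js//; exact: h2.
  move=> ->; congr (_ * _)%E; have us' : uniq s by case/andP: us.
  rewrite (iY us' mC); apply: eq_big_seq => i si; by rewrite /D js.
- move=> S _ [mS hS]; split; first exact: measurableC.
  have h1 := measureDI P mE mS.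
  have h2 : P (E `\` S) = (P E - P (E `&` S))%E.
    rewrite h1 addeK// fin_num_measure//; exact: measurableI.
  rewrite -setDE h2 hS probability_setC// muleBr ?mule1// ?fin_num_measure//.
- move=> F _ tF hF; split; first by apply: bigcup_measurable => i _; have [] := hF i.
  have m1 i : setT i -> @measurable d T (F i) by have [] := hF i.
  have m2 i : setT i -> @measurable d T (E `&` F i) by move=> hi; apply: measurableI => //; exact: m1.
  have t2 : trivIset setT (fun i => E `&` (F i : set T)) by exact: trivIset_setIl.
  rewrite setI_bigcupr !measure_bigcup//.
  rewrite -[P E]fineK ?fin_num_measure// -nneseriesZl// fineK ?fin_num_measure//.
  by apply: eq_eseriesr => i _; have [] := hF i.
Qed.

Lemma measurable_coord s i : i \in s ->
  measurable_fun (setT : set (g_sigma_algebraType (rects s))) (Y i).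
Proof.
move=> si _ B mB; rewrite setTI; apply: sub_sigma_algebra.
exists (fun k => if k == i then B else setT); first by move=> k; case: ifP.
apply/seteqP; split=> w; last by move=> /(_ i si); rewrite eqxx.
by move=> h k _; case: eqP => [->|].
Qed.

Lemma Ex_mul_indep_seq s j (psi : R -> R) (G : T -> R) : uniq (j :: s) ->
  measurable_fun setT psi -> bmfun (psi \o Y j) ->
  measurable_fun (setT : set (g_sigma_algebraType (rects s))) G ->
  (exists M, forall w, `|G w| <= M) ->
  Ex P (fun w => psi (Y j w) * G w) = Ex P (psi \o Y j) * Ex P G.
Proof.
move=> us mpsi bU mG bG.
have mG' B : measurable B -> <<s rects s >> (G @^-1` B).
  by move=> mB; have := mG measurableT B mB; rewrite setTI.
apply: Ex_mul_indep => //.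
  split=> // _ B mB; rewrite setTI.
  by have [] := indep_rects us measurableT (mG' B mB).
move=> B B' mB mB'; rewrite comp_preimage.
have mpB : measurable (psi @^-1` B) by rewrite -[X in measurable X]setTI; exact: mpsi.
by have [_ ->] := indep_rects us mpB (mG' B' mB').
Qed.

End independence.

Lemma measurable_sum_seq d (T : measurableType d) (R : realType) (I : eqType)
    (s : seq I) (F : I -> T -> R) :
  (forall i, i \in s -> measurable_fun setT (F i)) ->
  measurable_fun setT (fun w => \sum_(i <- s) F i w).
Proof.
elim: s => [|i s ih] h.
  by under eq_fun do rewrite big_nil; exact: measurable_cst.
under eq_fun do rewrite big_cons; apply: measurable_funD.
  by apply: h; rewrite inE eqxx.
by apply: ih => j js; apply: h; rewrite inE js orbT.
Qed.

(** * Maximal inequality *)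

Section running_maximum.
Variables (R : realType) (I : eqType) (s : seq I).
Implicit Types (beta : nat -> I -> R) (y : I -> R).

Definition lin_form (c : I -> R) y := \sum_(i <- s) c i * y i.

Fixpoint partial_lin n beta y : R :=
  if n is n'.+1 then lin_form (beta 0%N) y + partial_lin n' (fun k => beta k.+1) y else 0.

(** The maximum of [partial_lin k] over 0 <= k <= n, the empty sum included. Peeling off the first
    increment rather than the last is what the induction for the maximal inequality uses. *)
Fixpoint running_max n beta y : R :=
  if n is n'.+1 then
    Num.max 0 (lin_form (beta 0%N) y + running_max n' (fun k => beta k.+1) y)
  else 0.

Lemma running_max_ge n beta y k : (k <= n)%N ->
  partial_lin k beta y <= running_max n beta y.
Proof.
elim: n k beta => [|n ih] [|k] beta //= kn; first by rewrite le_max lexx.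
by rewrite le_max; apply/orP; right; rewrite lerD2l; exact: ih.
Qed.

Lemma partial_linE n beta y :
  partial_lin n beta y = lin_form (fun i => \sum_(k < n) beta k i) y.
Proof.
elim: n beta => [|n ih] beta /=.
  by rewrite /lin_form big1// => i _; rewrite big_ord0 mul0r.
rewrite ih /lin_form -big_split/=; apply: eq_bigr => i _.
by rewrite big_ord_recl mulrDl.
Qed.

Lemma lin_form_le (c : I -> R) y y' : (forall i, 0 <= c i) -> (forall i, y i <= y' i) ->
  lin_form c y <= lin_form c y'.
Proof. by move=> c0 yy; apply: ler_sum => i _; exact: ler_wpM2l. Qed.

(** The difference S_n - max_k S_k equals min_k (S_n - S_k), a minimum of sums with nonnegative
    coefficients, hence nondecreasing in each variable. *)
Lemma partial_lin_sub_max_le n beta y y' : (forall k i, 0 <= beta k i) ->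
  (forall i, y i <= y' i) ->
  partial_lin n beta y - running_max n beta y <= partial_lin n beta y' - running_max n beta y'.
Proof.
elim: n beta => [//|n ih] beta b0 yy /=.
have h1 := lin_form_le (b0 0%N) yy.
have h2 := ih (fun k => beta k.+1) (fun k => b0 k.+1) yy.
have h3 : partial_lin n (fun k => beta k.+1) y <= partial_lin n (fun k => beta k.+1) y'.
  by rewrite !partial_linE; apply: lin_form_le => // i; apply: sumr_ge0.
move: h1 h2 h3.
set a := lin_form _ y; set a' := lin_form _ y'.
set q := partial_lin n _ y; set q' := partial_lin n _ y'.
set m := running_max n _ y; set m' := running_max n _ y' => h1 h2 h3.
by case: (leP 0 (a + m)) => ?; case: (leP 0 (a' + m')) => ?; lra.
Qed.

Lemma measurable_lin_form d (T : measurableType d) (c : I -> R) (z : I -> T -> R) :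
  (forall i, i \in s -> measurable_fun setT (z i)) ->
  measurable_fun setT (fun w => lin_form c (z ^~ w)).
Proof. by move=> mz; apply: measurable_sum_seq => i si; apply: measurable_funM => //; exact: mz. Qed.

Lemma measurable_partial_lin d (T : measurableType d) n beta (z : I -> T -> R) :
  (forall i, i \in s -> measurable_fun setT (z i)) ->
  measurable_fun setT (fun w => partial_lin n beta (z ^~ w)).
Proof.
by move=> mz; under eq_fun do rewrite partial_linE; exact: measurable_lin_form.
Qed.

Lemma measurable_running_max d (T : measurableType d) n beta (z : I -> T -> R) :
  (forall i, i \in s -> measurable_fun setT (z i)) ->
  measurable_fun setT (fun w => running_max n beta (z ^~ w)).
Proof.
move=> mz; elim: n beta => [|n ih] beta /=; first exact: measurable_cst.
apply: measurable_maxr; first exact: measurable_cst.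
by apply: measurable_funD; [exact: measurable_lin_form|exact: ih].
Qed.

Lemma bmfun_lin_form d (T : measurableType d) (c : I -> R) (z : I -> T -> R) :
  (forall i, bmfun (z i)) -> bmfun (fun w => lin_form c (z ^~ w)).
Proof. by move=> bz; apply: bmfun_sum => i; apply: bmfunZ. Qed.

Lemma bmfun_partial_lin d (T : measurableType d) n beta (z : I -> T -> R) :
  (forall i, bmfun (z i)) -> bmfun (fun w => partial_lin n beta (z ^~ w)).
Proof. by move=> bz; under eq_fun do rewrite partial_linE; exact: bmfun_lin_form. Qed.

Lemma bmfun_running_max d (T : measurableType d) n beta (z : I -> T -> R) :
  (forall i, bmfun (z i)) -> bmfun (fun w => running_max n beta (z ^~ w)).
Proof.
move=> bz; elim: n beta => [|n ih] beta /=; first exact: bmfun_cst.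
apply: bmfun_max; first exact: bmfun_cst.
by apply: bmfunD; [exact: bmfun_lin_form|exact: ih].
Qed.

End running_maximum.

Section maximal_inequality.
Context d (T : measurableType d) (R : realType) (P : probability T R).
Variables (I : eqType) (Y : I -> T -> R).
Hypotheses (mY : forall i, measurable_fun setT (Y i)) (iY : mutual_indep P Y).
Variables (s : seq I) (psi : I -> R -> R).
Hypotheses (us : uniq s) (mpsi : forall i, measurable_fun setT (psi i)).
Hypotheses (bxi : forall i, bmfun (psi i \o Y i)) (xi0 : forall i, Ex P (psi i \o Y i) = 0).
Local Notation xi := (fun i w => psi i (Y i w)).

(** Replacing the j-th variable by 0 inside [F] makes [F] independent of the centered xi_j, so that
    expectation vanishes; monotonicity gives xi_j F >= xi_j F_0 pointwise, F_0 being the modified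
    value. Measurability of [F] is asked over all measurable spaces because it is needed for the
    sigma-algebra of the other variables. *)
Lemma Ex_mul_monotone j (F : (I -> R) -> R) : j \in s ->
  (forall y y', (forall i, y i <= y' i) -> F y <= F y') ->
  (forall d' (T' : measurableType d') (z : I -> T' -> R),
     (forall i, i \in s -> measurable_fun setT (z i)) ->
     measurable_fun setT (fun w => F (z ^~ w))) ->
  (forall z : I -> T -> R, (forall i, bmfun (z i)) -> bmfun (fun w => F (z ^~ w))) ->
  0 <= Ex P (fun w => xi j w * F (xi ^~ w)).
Proof.
move=> js Fmono mF bF.
pose z i w := if i == j then 0 else xi i w.
have bz i : bmfun (z i) by rewrite /z; case: eqP => _; [exact: bmfun_cst|exact: bxi].
have mz : measurable_fun (setT : set (g_sigma_algebraType (rects Y (rem j s))))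
    (fun w => F (z ^~ w)).
  apply: mF => i si; rewrite /z; case: eqVneq => [_|ij]; first exact: measurable_cst.
  apply: measurableT_comp => //; apply: measurable_coord.
  by rewrite (rem_filter _ us) mem_filter /= ij.
have <- : Ex P (fun w => xi j w * F (z ^~ w)) = 0.
  rewrite (@Ex_mul_indep_seq _ _ _ P _ Y mY iY (rem j s) j (psi j) (fun w => F (z ^~ w)))//.
  - by rewrite xi0 mul0r.
  - by rewrite /= mem_rem_uniqF// rem_uniq.
  - by have [] := bF z bz.
apply: Ex_le; first by apply: bmfunM; [exact: bxi|exact: bF].
  by apply: bmfunM; [exact: bxi|exact: (bF _ bxi)].
move=> w; have [h|h] := leP 0 (xi j w).
  apply: ler_wpM2l => //; apply: Fmono => i; rewrite /z.
  by case: eqP => [->|].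
apply: ler_wnM2l; first exact: ltW.
by apply: Fmono => i; rewrite /z; case: eqP => [->|//]; exact: ltW.
Qed.

Lemma Ex_sqr_lin (c : I -> R) : Ex P (fun w => lin_form s c (xi ^~ w) ^+ 2) =
  \sum_(i <- s) c i ^+ 2 * Ex P (fun w => xi i w ^+ 2).
Proof.
rewrite /lin_form; move: us; elim: s => [_|j r ih /= /andP[jr ur]].
  by under [X in Ex P X]eq_fun do rewrite big_nil expr0n; rewrite Ex_cst big_nil.
have bS : bmfun (fun w => \sum_(i <- r) c i * xi i w).
  by apply: bmfun_sum => i; apply: bmfunZ; exact: bxi.
rewrite big_cons -(ih ur).
have -> : (fun w => (\sum_(i <- j :: r) c i * xi i w) ^+ 2) =
   (fun w => (c j ^+ 2 * (xi j w ^+ 2) + 2 * c j * (xi j w * \sum_(i <- r) c i * xi i w)) +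
      (\sum_(i <- r) c i * xi i w) ^+ 2).
  by apply/funext => w; rewrite big_cons; ring.
have b1 : bmfun (fun w => c j ^+ 2 * (xi j w ^+ 2)) by apply: bmfunZ; apply: bmfunX; exact: bxi.
have b2 : bmfun (fun w => xi j w * \sum_(i <- r) c i * xi i w) by apply: bmfunM => //; exact: bxi.
rewrite ExD; [|by apply: bmfunD => //; exact: bmfunZ|exact: bmfunX].
rewrite ExD//; last exact: bmfunZ.
rewrite ExZ; last by apply: bmfunX; exact: bxi.
rewrite ExZ// (@Ex_mul_indep_seq _ _ _ P _ Y mY iY r j (psi j)
  (fun w => \sum_(i <- r) c i * xi i w))//.
- by rewrite xi0 mul0r mulr0 addr0.
- by rewrite /= jr.
- apply: measurable_sum_seq => i ir; apply: measurable_funM; first exact: measurable_cst.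
  by apply: measurableT_comp => //; exact: measurable_coord.
- by case: bS.
Qed.

(* Newman and Wright's inequality: [partial_lin - running_max] is a nondecreasing function
   of the variables, hence nonnegatively correlated with the first increment. *)
Lemma Ex_sqr_running_max n (beta : nat -> I -> R) : (forall k i, 0 <= beta k i) ->
  Ex P (fun w => running_max s n beta (xi ^~ w) ^+ 2) <=
  Ex P (fun w => partial_lin s n beta (xi ^~ w) ^+ 2).
Proof.
elim: n beta => [|n ih] beta b0 /=; first exact: lexx.
have {}ih := ih (fun k => beta k.+1) (fun k => b0 k.+1).
pose X w := lin_form s (beta 0%N) (xi ^~ w).
pose M w := running_max s n (fun k => beta k.+1) (xi ^~ w).
pose D w := partial_lin s n (fun k => beta k.+1) (xi ^~ w).
have bX : bmfun X by apply: bmfun_lin_form; exact: bxi.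
have bM : bmfun M by apply: bmfun_running_max; exact: bxi.
have bD : bmfun D by apply: bmfun_partial_lin; exact: bxi.
have key : 0 <= Ex P (fun w => X w * (D w - M w)).
  have -> : (fun w => X w * (D w - M w)) =
     (fun w => \sum_(j <- s) beta 0%N j * (xi j w * (D w - M w))).
    apply/funext => w; rewrite /X /lin_form mulr_suml.
    by apply: eq_bigr => j _; rewrite mulrA.
  have bK : bmfun (fun w => D w - M w) by exact: bmfunB.
  have bj j : bmfun (fun w => xi j w * (D w - M w)) by apply: bmfunM => //; exact: bxi.
  rewrite Ex_sum => [|j]; last exact: bmfunZ.
  rewrite big_seq; apply: sumr_ge0 => j js; rewrite ExZ//; apply: mulr_ge0 => //.
  apply: (Ex_mul_monotone (F := fun y => partial_lin s n (fun k => beta k.+1) y -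
     running_max s n (fun k => beta k.+1) y)) => //.
  - by move=> y y'; exact: partial_lin_sub_max_le.
  - move=> d' T' z mz; apply: measurable_funB; first exact: measurable_partial_lin.
    exact: measurable_running_max.
  - move=> z bz; apply: bmfunB; first exact: bmfun_partial_lin.
    exact: bmfun_running_max.
have bMX : bmfun (fun w => X w + M w) by exact: bmfunD.
(* As max(0, x)^2 <= x^2, the running maximum may be replaced by X + M. After expansion the cross
   terms compare by [key] and the squares by the induction hypothesis. *)
apply: (@le_trans _ _ (Ex P (fun w => (X w + M w) ^+ 2))).
  apply: Ex_le; last 1 first.
  - move=> w; rewrite -/(X w) -/(M w); case: (leP 0 (X w + M w)) => // _.
    by rewrite expr0n sqr_ge0.
  - by apply: bmfunX; apply: bmfun_max => //; exact: bmfun_cst.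
  - exact: bmfunX.
have e1 : Ex P (fun w => (X w + M w) ^+ 2) =
    Ex P (fun w => X w ^+ 2) + 2 * Ex P (fun w => X w * M w) + Ex P (fun w => M w ^+ 2).
  rewrite -ExZ; last exact: bmfunM.
  rewrite -ExD; [|exact: bmfunX|by apply: bmfunZ; exact: bmfunM].
  rewrite -ExD; [|by apply: bmfunD; [exact: bmfunX|apply: bmfunZ; exact: bmfunM]|exact: bmfunX].
  by congr Ex; apply/funext => w; ring.
have e2 : Ex P (fun w => (X w + D w) ^+ 2) =
    Ex P (fun w => X w ^+ 2) + 2 * Ex P (fun w => X w * D w) + Ex P (fun w => D w ^+ 2).
  rewrite -ExZ; last exact: bmfunM.
  rewrite -ExD; [|exact: bmfunX|by apply: bmfunZ; exact: bmfunM].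
  rewrite -ExD; [|by apply: bmfunD; [exact: bmfunX|apply: bmfunZ; exact: bmfunM]|exact: bmfunX].
  by congr Ex; apply/funext => w; ring.
have e3 : Ex P (fun w => X w * (D w - M w)) = Ex P (fun w => X w * D w) - Ex P (fun w => X w * M w).
  rewrite -ExB; [|exact: bmfunM|exact: bmfunM].
  by congr Ex; apply/funext => w; ring.
rewrite -/X -/D in e2 *; rewrite e1 [leRHS]e2; rewrite e3 in key.
by rewrite -/M -/D in ih; lra.
Qed.

End maximal_inequality.

(** * Maximal inequality and characteristic functions of independent sums *)

Section independent_sums.
Context d (T : measurableType d) (R : realType) (P : probability T R).
Variables (I : eqType) (Y : I -> T -> R).
Hypotheses (mY : forall i, measurable_fun setT (Y i)) (iY : mutual_indep P Y).

(** The increments of the monotone weights [rho] are the nonnegative coefficients of the one-sided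
    inequality. It is applied to [psi] and to [- psi], whence the factor 2. *)
Lemma sum_maximal_inequality (s : seq I) (psi : I -> R -> R) (rho : nat -> I -> R) n (e : R) :
  uniq s -> (forall i, measurable_fun setT (psi i)) ->
  (forall i, bmfun (psi i \o Y i)) -> (forall i, Ex P (psi i \o Y i) = 0) ->
  (forall i, 0 <= rho 0%N i) -> (forall k i, rho k i <= rho k.+1 i) -> 0 < e ->
  Pr P [set w | exists2 k, (k <= n)%N & e < `|\sum_(i <- s) rho k i * psi i (Y i w)|] <=
    2 / e ^+ 2 * \sum_(i <- s) rho n i ^+ 2 * Ex P (fun w => psi i (Y i w) ^+ 2).
Proof.
move=> us mpsi bxi xi0 r0 rS e0.
pose beta k i := if k is k'.+1 then rho k i - rho k' i else rho 0%N i.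
have b0 k i : 0 <= beta k i by case: k => [|k] //=; rewrite subr_ge0.
have bS k i : \sum_(j < k.+1) beta j i = rho k i.
  by elim: k => [|k ih]; rewrite big_ord_recr /= ?big_ord0 ?add0r// ih addrC subrK.
have e20 : 0 < e ^+ 2 by rewrite exprn_gt0.
have one (phi : I -> R -> R) : (forall i, measurable_fun setT (phi i)) ->
    (forall i, bmfun (phi i \o Y i)) -> (forall i, Ex P (phi i \o Y i) = 0) ->
    Pr P [set w | e ^+ 2 < running_max s n.+1 beta (fun i => phi i (Y i w)) ^+ 2] <=
    (e ^+ 2)^-1 * \sum_(i <- s) rho n i ^+ 2 * Ex P (fun w => phi i (Y i w) ^+ 2).
  move=> mphi bphi phi0.
  have bM : bmfun (fun w => running_max s n.+1 beta (fun i => phi i (Y i w))).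
    exact: (bmfun_running_max s n.+1 beta bphi).
  have := @Ex_markov _ _ _ P _ (e ^+ 2) (bmfunX bM) (fun w => sqr_ge0 _) e20.
  rewrite mulrC -ler_pdivlMr// mulrC => h; apply: (le_trans h).
  rewrite ler_pM2l ?invr_gt0//.
  apply: le_trans (Ex_sqr_running_max mY iY us mphi bphi phi0 n.+1 b0) _.
  rewrite le_eqVlt; apply/orP; left; apply/eqP.
  under [X in Ex P X]eq_fun do rewrite partial_linE.
  rewrite Ex_sqr_lin//; apply: eq_bigr => i _; by rewrite bS.
have mN i : measurable_fun setT (fun x => - psi i x) by exact: measurableT_comp.
have bN i : bmfun ((fun x => - psi i x) \o Y i) by exact: bmfunN (bxi i).
have N0 i : Ex P ((fun x => - psi i x) \o Y i) = 0.
  have -> : (fun x => - psi i x) \o Y i = fun w => -1 * (psi i \o Y i) w.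
    by apply/funext => w; rewrite mulN1r.
  by rewrite ExZ// xi0 mulr0.
have h1 := one psi mpsi bxi xi0; have h2 := one (fun i x => - psi i x) mN bN N0.
have e2 : \sum_(i <- s) rho n i ^+ 2 * Ex P (fun w => (- psi i (Y i w)) ^+ 2) =
    \sum_(i <- s) rho n i ^+ 2 * Ex P (fun w => psi i (Y i w) ^+ 2).
  by apply: eq_bigr => i _; congr (_ * Ex P _); apply/funext => w; rewrite sqrrN.
rewrite e2 in h2.
have mA (phi : I -> R -> R) : (forall i, measurable_fun setT (phi i)) ->
   (forall i, bmfun (phi i \o Y i)) ->
   measurable [set w | e ^+ 2 < running_max s n.+1 beta (fun i => phi i (Y i w)) ^+ 2].
  move=> mphi bphi; apply: measurable_set_lt.
  by have [] := bmfunX (bmfun_running_max s n.+1 beta bphi).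
apply: le_trans (_ : _ <= Pr P ([set w | e ^+ 2 < running_max s n.+1 beta (fun i => psi i (Y i w)) ^+ 2]
  `|` [set w | e ^+ 2 < running_max s n.+1 beta (fun i => - psi i (Y i w)) ^+ 2])) _.
  apply: Pr_le.
  - rewrite (_ : [set w | _] = [set w | exists2 k, k \in iota 0 n.+1 &
       [set w | e < `|\sum_(i <- s) rho k i * psi i (Y i w)|] w]).
      apply: measurable_exists_seq => k; apply: measurable_set_lt.
      apply: measurableT_comp => //; apply: measurable_sum_seq => i _.
      by apply: measurable_funM => //; have [] := bxi i.
    by apply/seteqP; split=> w [k hk hw]; exists k => //; move: hk; rewrite mem_iota.
  - by apply: measurableU; [exact: mA|exact: (mA (fun i x => - psi i x))].
  - move=> w [k kn]; rewrite -/(lin_form s (rho k) (fun i => psi i (Y i w))) => hk.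
    have q1 := @running_max_ge R I s n.+1 beta (fun i => psi i (Y i w)) k.+1 kn.
    have q2 := @running_max_ge R I s n.+1 beta (fun i => - psi i (Y i w)) k.+1 kn.
    move: q1 q2; rewrite !partial_linE /lin_form.
    under eq_bigr do rewrite bS; under [in X in _ -> X]eq_bigr do rewrite bS mulrN.
    rewrite sumrN => q1 q2.
    move: hk; rewrite ltr_normr /lin_form => /orP[hk|hk]; [left|right].
      by change (e ^+ 2 < running_max s n.+1 beta (fun i => psi i (Y i w)) ^+ 2);
        rewrite ltrXn2r ?(ltW e0)//; exact: lt_le_trans q1.
    by change (e ^+ 2 < running_max s n.+1 beta (fun i => - psi i (Y i w)) ^+ 2);
      rewrite ltrXn2r ?(ltW e0)//; exact: lt_le_trans q2.
apply: le_trans (PrU_le _ _ _) _; [exact: mA|exact: (mA (fun i x => - psi i x))|].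
have -> : 2 / e ^+ 2 = (e ^+ 2)^-1 + (e ^+ 2)^-1 by ring.
by rewrite mulrDl; exact: lerD.
Qed.

Lemma measurable_cos : measurable_fun setT (@cos R).
Proof. by apply: continuous_measurable_fun; exact: continuous_cos. Qed.

Lemma measurable_sin : measurable_fun setT (@sin R).
Proof. by apply: continuous_measurable_fun; exact: continuous_sin. Qed.

Lemma cos_norm_le1 (x : R) : `|cos x| <= 1.
Proof. by rewrite ler_norml cos_geN1 cos_le1. Qed.

Lemma sin_norm_le1 (x : R) : `|sin x| <= 1.
Proof. by rewrite ler_norml sin_geN1 sin_le1. Qed.

(* |E exp(i X)| ^ 2 *)
Definition charf2 (X : T -> R) : R :=
  Ex P (fun w => cos (X w)) ^+ 2 + Ex P (fun w => sin (X w)) ^+ 2.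

(** Multiplicativity of |E exp(i X)|^2 in real terms: by independence the addition formulas factor,
    and (ac - bd)^2 + (bc + ad)^2 = (a^2 + b^2)(c^2 + d^2). *)
Lemma charf2_sum (s : seq I) (c : I -> R) : uniq s ->
  charf2 (fun w => \sum_(i <- s) c i * Y i w) = \prod_(i <- s) charf2 (fun w => c i * Y i w).
Proof.
elim: s => [_|j r ih /= /andP[jr ur]].
  rewrite big_nil /charf2.
  under [X in Ex P X]eq_fun do rewrite big_nil cos0.
  under [X in _ + Ex P X ^+ _]eq_fun do rewrite big_nil sin0.
  by rewrite !Ex_cst expr1n expr0n addr0.
rewrite big_cons -(ih ur) /charf2.
pose S w := \sum_(i <- r) c i * Y i w.
have mS : measurable_fun setT S by apply: measurable_sum_seq => i _; exact: measurable_funM.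
have mSr : measurable_fun (setT : set (g_sigma_algebraType (rects Y r))) S.
  by apply: measurable_sum_seq => i ir; apply: measurable_funM => //; exact: measurable_coord.
have mcj : measurable_fun setT (fun x : R => c j * x) by exact: measurable_funM.
pose cj x := cos (c j * x); pose sj x := sin (c j * x).
have mc : measurable_fun setT cj by apply: measurableT_comp => //; exact: measurable_cos.
have ms : measurable_fun setT sj by apply: measurableT_comp => //; exact: measurable_sin.
have bc (X : T -> R) : measurable_fun setT X -> bmfun (fun w => cos (X w)).
  by move=> mX; apply: (bmfun_comp (M := 1) measurable_cos) => // x; exact: cos_norm_le1.
have bs (X : T -> R) : measurable_fun setT X -> bmfun (fun w => sin (X w)).
  by move=> mX; apply: (bmfun_comp (M := 1) measurable_sin) => // x; exact: sin_norm_le1.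
have mX : measurable_fun setT (fun w => c j * Y j w) by exact: measurable_funM.
have ujr : uniq (j :: r) by rewrite /= jr.
have icc : Ex P (fun w => cj (Y j w) * cos (S w)) = Ex P (cj \o Y j) * Ex P (fun w => cos (S w)).
  apply: (Ex_mul_indep_seq mY iY ujr mc); first exact: bc.
    by apply: measurableT_comp => //; exact: measurable_cos.
  by exists 1 => w; exact: cos_norm_le1.
have ics : Ex P (fun w => cj (Y j w) * sin (S w)) = Ex P (cj \o Y j) * Ex P (fun w => sin (S w)).
  apply: (Ex_mul_indep_seq mY iY ujr mc); first exact: bc.
    by apply: measurableT_comp => //; exact: measurable_sin.
  by exists 1 => w; exact: sin_norm_le1.
have isc : Ex P (fun w => sj (Y j w) * cos (S w)) = Ex P (sj \o Y j) * Ex P (fun w => cos (S w)).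
  apply: (Ex_mul_indep_seq mY iY ujr ms); first exact: bs.
    by apply: measurableT_comp => //; exact: measurable_cos.
  by exists 1 => w; exact: cos_norm_le1.
have iss : Ex P (fun w => sj (Y j w) * sin (S w)) = Ex P (sj \o Y j) * Ex P (fun w => sin (S w)).
  apply: (Ex_mul_indep_seq mY iY ujr ms); first exact: bs.
    by apply: measurableT_comp => //; exact: measurable_sin.
  by exists 1 => w; exact: sin_norm_le1.
have -> : (fun w => cos (\sum_(i <- j :: r) c i * Y i w)) =
    (fun w => cj (Y j w) * cos (S w) - sj (Y j w) * sin (S w)).
  by apply/funext => w; rewrite big_cons cosD.
have -> : (fun w => sin (\sum_(i <- j :: r) c i * Y i w)) =
    (fun w => sj (Y j w) * cos (S w) + cj (Y j w) * sin (S w)).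
  by apply/funext => w; rewrite big_cons sinD.
rewrite ExB; [|by apply: bmfunM; [exact: bc|exact: bc]|by apply: bmfunM; [exact: bs|exact: bs]].
rewrite ExD; [|by apply: bmfunM; [exact: bs|exact: bc]|by apply: bmfunM; [exact: bc|exact: bs]].
rewrite icc ics isc iss /comp /cj /sj /S; ring.
Qed.

End independent_sums.

Lemma Ex_eq_dist d (T : measurableType d) d' (T' : measurableType d') (R : realType)
    (P : probability T R) (Q : probability T' R) (X : T -> R) (X' : T' -> R) (psi : R -> R) :
  measurable_fun setT X -> measurable_fun setT X' -> eq_dist P Q X X' ->
  measurable_fun setT psi -> (exists M, forall x, `|psi x| <= M) ->
  Ex P (psi \o X) = Ex Q (psi \o X').
Proof.
move=> mX mX' XX' mpsi [M hM].
pose hX := isMeasurableFun.Build _ _ _ _ _ mX.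
pose U : {mfun T >-> R} := MeasurableFun.Pack (MeasurableFun.Class hX).
pose hX' := isMeasurableFun.Build _ _ _ _ _ mX'.
pose U' : {mfun T' >-> R} := MeasurableFun.Pack (MeasurableFun.Class hX').
have bX : bmfun (psi \o X) by exact: bmfun_comp mpsi hM mX.
have bX' : bmfun (psi \o X') by exact: bmfun_comp mpsi hM mX'.
have mE : measurable_fun setT (EFin \o psi) by exact/measurable_EFinP.
apply/EFin_inj; rewrite -!expectationE// unlock.
have <- := integral_distribution (X := U) mE (bmfun_integrable P bX).
have <- := integral_distribution (X := U') mE (bmfun_integrable Q bX').
by apply: eq_measure_integral => A mA _; exact: XX'.
Qed.

(** * Regularly varying tails *)

Section dyadic.
Variable R : realType.

Lemma dyadic_ind (w0 : R) (Q : R -> Prop) : 0 < w0 ->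
  (forall w, w0 / 2 < w <= w0 -> Q w) ->
  (forall w, 0 < w <= w0 -> Q w -> Q (w / 2)) -> forall w, 0 < w <= w0 -> Q w.
Proof.
move=> w00 Q0 QS.
have h k : forall w, 0 < w <= w0 -> w0 < 2 ^+ k * w -> Q w.
  elim: k => [|k ih] w /andP[wp ww0]; first by rewrite expr0 mul1r ltNge ww0.
  have [h1|h1] := ltP (w0 / 2) w; first by move=> _; apply: Q0; rewrite h1.
  move=> h2.
  have -> : w = (w * 2) / 2 by rewrite mulfK.
  have h3 : 0 < w * 2 <= w0 by apply/andP; split; [rewrite mulr_gt0|lra].
  apply: (QS _ h3); apply: ih => //; by rewrite mulrA [_ * 2]mulrC mulrA -exprS.
move=> w /andP[wp ww0].
have [k hk] : exists k : nat, w0 / w < k%:R.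
  by exists (Num.truncn (w0 / w)).+1; exact: truncnS_gt.
apply: (h k); first by rewrite wp.
rewrite -ltr_pdivrMr//; apply: (lt_trans hk).
by rewrite -natrX ltr_nat ltn_expl.
Qed.

(** Values beyond 1 are sent to 0 and not to the boundary; by conversion this is [cutoff 1]. *)
Definition clip1 (x : R) : R := x * (`|x| <= 1)%R%:R.

Lemma clip1_le1 x : `|clip1 x| <= 1.
Proof. by rewrite /clip1; case: (leP `|x| 1) => h; rewrite ?mulr1 ?mulr0 ?normr0. Qed.

Definition cutoff (b x : R) : R := x * (`|x| <= b)%R%:R.

Lemma measurable_cutoff b : measurable_fun setT (cutoff b).
Proof.
rewrite (_ : cutoff b = fun x => x * \1_[set x | `|x| <= b] x).
  apply: measurable_funM => //; apply: measurable_indic.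
  by apply: measurable_set_le; apply: continuous_measurable_fun; exact: norm_continuous.
by apply/funext => x; rewrite indicE /cutoff; congr (_ * (nat_of_bool _)%:R); rewrite mem_setE.
Qed.

Lemma cutoff_norm b x : 0 <= b -> `|cutoff b x| <= b.
Proof. by rewrite /cutoff; case: (leP `|x| b) => h b0; rewrite ?mulr1 ?mulr0 ?normr0. Qed.

Lemma measurable_clip1 : measurable_fun setT clip1.
Proof. exact: (measurable_cutoff 1). Qed.

End dyadic.

Section tail.
Context d (T : measurableType d) (R : realType) (P : probability T R) (X : T -> R).
Hypothesis mX : measurable_fun setT X.

(** The multiplicative form also covers [w = 0], which occurs for vanishing coefficients and then
    gives 0. *)
Definition tailw (w : R) : R := Pr P [set o | 1 < w * `|X o|].

Lemma measurable_tailw (c w : R) : measurable [set o | c < w * `|X o|].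
Proof.
by apply: measurable_set_lt; apply: measurable_funM => //; exact: measurableT_comp.
Qed.

Lemma tailw_ge0 w : 0 <= tailw w. Proof. exact: Pr_ge0. Qed.

Lemma tailw0 : tailw 0 = 0.
Proof.
rewrite /tailw (_ : [set _ | _] = set0) ?Pr_set0//.
by apply/seteqP; split=> o //=; rewrite mul0r ltr10.
Qed.

Lemma tailw_le (w w' : R) : w <= w' -> tailw w <= tailw w'.
Proof.
move=> ww'; apply: Pr_le; [exact: measurable_tailw|exact: measurable_tailw|].
by move=> o /= h; apply: lt_le_trans h _; exact: ler_wpM2r.
Qed.

Lemma bmfun_clip1 w : bmfun (fun o => clip1 (w * X o)).
Proof.
apply: (bmfun_comp (@measurable_clip1 R) (@clip1_le1 R)).
exact: measurable_funM.
Qed.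

Lemma clip1_moment (p : nat) (q1 w0 : R) : (0 < p)%N -> 0 < w0 -> (2 ^+ p)^-1 < q1 ->
  (forall w, 0 < w -> 0 < tailw w) ->
  (forall w, 0 < w <= w0 -> q1 * tailw w <= tailw (w / 2)) ->
  exists2 C, 0 < C & forall w, 0 <= w <= w0 ->
    Ex P (fun o => `|clip1 (w * X o)| ^+ p) <= C * tailw w.
Proof.
move=> p0 w00 hq1 tpos hd.
have r0 : 0 < (2 ^+ p)^-1 :> R by rewrite invr_gt0 exprn_gt0.
set r : R := (2 ^+ p)^-1 in hq1 r0.
have q10 : 0 < q1 by exact: lt_trans hq1.
have bp w : bmfun (fun o => `|clip1 (w * X o)| ^+ p).
  split.
    by apply: measurable_funX; apply: measurableT_comp => //; have [] := bmfun_clip1 w.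
  by exists 1 => o; rewrite normrX normr_id exprn_ile1// clip1_le1.
have le1 w : Ex P (fun o => `|clip1 (w * X o)| ^+ p) <= 1.
  rewrite -[leRHS](Ex_cst P); apply: Ex_le => //; first exact: bmfun_cst.
  by move=> o; rewrite exprn_ile1// clip1_le1.
have step w : 0 < w -> Ex P (fun o => `|clip1 (w / 2 * X o)| ^+ p) <=
    r * Ex P (fun o => `|clip1 (w * X o)| ^+ p) + tailw w.
  move=> wp; rewrite /tailw -Ex_indic; last exact: measurable_tailw.
  have bi : bmfun (\1_[set o | 1 < w * `|X o|] : T -> R) by apply: bmfun_indic; exact: measurable_tailw.
  rewrite -ExZ// -ExD//; last exact: bmfunZ.
  apply: Ex_le => //; first by apply: bmfunD => //; exact: bmfunZ.
  move=> o; rewrite indicE; have [h|h] := boolP (o \in _).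
    apply: (@le_trans _ _ 1); first by rewrite exprn_ile1// clip1_le1.
    by rewrite lerDr mulr_ge0 ?exprn_ge0 ?(ltW r0).
  have {}h : `|w * X o| <= 1.
    by move: h; rewrite notin_setE /= => /negP; rewrite -leNgt normrM gtr0_norm.
  rewrite addr0 /clip1 h mulr1.
  have -> : w / 2 * X o = w * X o / 2 by rewrite mulrAC.
  have -> : (`|w * X o / 2| <= 1)%R%:R = 1 :> R.
    by rewrite normrM (ger0_norm (_ : 0 <= 2^-1)) ?invr_ge0//; case: leP => //; lra.
  by rewrite mulr1 normrM exprMn mulrC (ger0_norm (_ : 0 <= 2^-1)) ?invr_ge0// exprVn.
(* The first entry settles the base layer (w0/2, w0], where the moment is at most 1. The second
   yields r C + 1 <= C q1, which closes the recursion. *)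
pose C := Num.max (tailw (w0 / 2))^-1 (q1 - r)^-1.
have t20 : 0 < tailw (w0 / 2) by apply: tpos; rewrite divr_gt0.
have C0 : 0 < C by rewrite lt_max invr_gt0 t20.
exists C => // w /andP[]; rewrite le_eqVlt => /predU1P[<- _|wp ww0].
  rewrite tailw0 mulr0 (_ : (fun _ => _) = fun=> 0) ?Ex_cst//.
  by apply/funext => o; rewrite mul0r /clip1 mul0r normr0 expr0n -[p]prednK.
apply: (dyadic_ind (w0 := w0) (Q := fun w => Ex P (fun o => `|clip1 (w * X o)| ^+ p) <= C * tailw w)) => //.
- move=> {wp ww0}w /andP[h1 h2]; apply: (le_trans (le1 _)).
  rewrite -ler_pdivrMr ?mul1r; last by apply: tpos; apply: lt_trans h1; rewrite divr_gt0.
  apply: (@le_trans _ _ (tailw (w0 / 2))^-1); last by rewrite le_max lexx.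
  rewrite lef_pV2 ?posrE//; first by apply: tailw_le; exact: ltW.
  by apply: tpos; apply: lt_trans h1; rewrite divr_gt0.
- move=> {wp ww0}w hw ihw; have /andP[wp ww0] := hw.
  apply: (le_trans (step w wp)).
  have h1 : C * (q1 * tailw w) <= C * tailw (w / 2) by rewrite ler_pM2l// hd.
  apply: le_trans h1; rewrite mulrA.
  have h2 : r * Ex P (fun o => `|clip1 (w * X o)| ^+ p) <= r * (C * tailw w) by rewrite ler_pM2l.
  have h3 : 1 <= C * (q1 - r).
    by rewrite -ler_pdivrMr ?subr_gt0// mul1r le_max lexx orbT.
  have h4 : 1 * tailw w <= C * (q1 - r) * tailw w by apply: ler_wpM2r => //; exact: tailw_ge0.
  by move: h4; rewrite mulrBr mulrBl mul1r [r * (C * _)]mulrCA mulrA in h2 *; lra.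
- by rewrite wp.
Qed.

Lemma clip1_mean_sym w : eq_dist P P X (fun o => - X o) -> Ex P (fun o => clip1 (w * X o)) = 0.
Proof.
move=> hsym; have mN : measurable_fun setT (fun o => - X o) by exact: measurableT_comp.
have mt : measurable_fun setT (fun x : R => clip1 (w * x)).
  by apply: measurableT_comp; [exact: measurable_clip1|exact: measurable_funM].
have b1 : exists M, forall x : R, `|clip1 (w * x)| <= M by exists 1 => x; exact: clip1_le1.
have := @Ex_eq_dist _ _ _ _ _ P P X _ (fun x => clip1 (w * x)) mX mN hsym mt b1.
rewrite /comp => h.
have e : Ex P (fun o => clip1 (w * - X o)) = - Ex P (fun o => clip1 (w * X o)).
  rewrite -mulN1r -ExZ; last exact: bmfun_clip1.
  by congr Ex; apply/funext => o; rewrite /clip1 mulrN normrN mulNr mulN1r.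
by rewrite e in h; lra.
Qed.

Lemma Pr_tight (e : R) : 0 < e -> exists2 M, 0 < M & Pr P [set o | M < `|X o|] <= e.
Proof.
move=> e0; pose A n := [set o | (n.+1%:R : R) < `|X o|].
have mA n : measurable (A n) by apply: measurable_set_lt; exact: measurableT_comp.
have A0 : \bigcap_n A n = set0.
  apply/seteqP; split=> o //= h; have := h (Num.truncn `|X o|) I; rewrite /A /=.
  by have := truncnS_gt `|X o|; move=> h1 h2; have := lt_trans h1 h2; rewrite ltxx.
have cvgA : P \o A @ \oo --> P (\bigcap_n A n).
  apply: nonincreasing_cvg_mu => //.
  - by rewrite -ge0_fin_numE// fin_num_measure.
  - by rewrite A0.
  - apply/nonincreasing_seqP => n; apply/subsetPset => o /=; apply: lt_trans.
    by rewrite ltr_nat.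
move: cvgA; rewrite A0 measure0 => /fine_cvgP[_ /cvgrPdist_le/(_ _ e0)].
move=> /filter_ex[n]; rewrite /= sub0r normrN => h.
exists n.+1%:R => //; apply: le_trans h; rewrite -/(A n).
by rewrite ger0_norm// fine_ge0.
Qed.

Lemma Ex_cos_near1 (e : R) : 0 < e -> exists2 s0, 0 < s0 &
  forall s, 0 <= s <= s0 -> 1 - e <= Ex P (fun o => cos (s * X o)).
Proof.
move=> e0; have [M M0 hM] := Pr_tight (e := e / 4) ltac:(by rewrite divr_gt0).
have := @continuous_cos R 0 => /cvgrPdist_le/(_ (e / 2) ltac:(by rewrite divr_gt0)).
move=> /nbhs_ballP[del /= del0 hdel].
exists (del / 2 / M) => [|s /andP[s0 hs]]; first by rewrite !divr_gt0.
have mc : measurable_fun setT (fun o => s * X o) by exact: measurable_funM.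
have bc : bmfun (fun o => cos (s * X o)).
  by apply: (bmfun_comp (M := 1) (@measurable_cos R)) => // x; exact: cos_norm_le1.
have mA : measurable [set o | `|X o| <= M] by apply: measurable_set_le; exact: measurableT_comp.
have e20 : 0 <= e / 2 by rewrite divr_ge0// ltW.
have hc o : `|X o| <= M -> `|cos (s * X o) - 1| <= e / 2.
  move=> ho; have := hdel (s * X o); rewrite cos0 distrC; apply.
  rewrite /ball /= sub0r normrN normrM (ger0_norm s0).
  apply: (@le_lt_trans _ _ (del / 2)); last lra.
  by rewrite -[leRHS](@divfK _ M) ?gt_eqF//; apply: ler_pM.
have n1 : T -> `|1 : R| <= 1 by rewrite normr1.
have := @Ex_close _ _ _ P (fun o => cos (s * X o)) (fun=> 1) [set o | `|X o| <= M] (e / 2) 1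
   bc (bmfun_cst _ _) mA (fun w => cos_norm_le1 _) n1 e20 hc.
rewrite Ex_cst.
have -> : Pr P (~` [set o | `|X o| <= M]) = Pr P [set o | M < `|X o|].
  by congr Pr; apply/seteqP; split=> o /=; rewrite ltNge => /negP.
by move=> {n1}h; move: h; rewrite ler_norml => /andP[h _]; lra.
Qed.

(** 1 - |E exp(i s X)|^2 is the sum of the variances of cos(s X) and sin(s X). For small [s] the
    mean of the cosine is near 1, while the cosine is below cos 1 on the event 1 < s|X| <= 2, whose
    probability is at least (1 - q2) times the tail. The bound 2 keeps the argument within [0, pi],
    where cos decreases. *)
Lemma charf2_tail (q2 w0 : R) : 0 < w0 -> q2 < 1 ->
  (forall w, 0 < w <= w0 -> tailw (w / 2) <= q2 * tailw w) ->
  exists c s0, [/\ 0 < c, 0 < s0 & forall s, 0 <= s <= s0 ->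
    c * tailw s <= 1 - charf2 P (fun o => s * X o)].
Proof.
move=> w00 q21 hd.
have cos1 : cos (1 : R) < 1.
  rewrite -[ltRHS](@cos0 R) ltr_cos ?in_itv/= ?lexx ?pi_ge0 ?ltr01//.
  by rewrite ler01/= (le_trans _ (pi_ge2 R))// ler1n.
(* Half the gap: if the mean is at least 1 - k, it exceeds every value below cos 1 by at least k. *)
pose k := (1 - cos (1 : R)) / 2; have k0 : 0 < k by rewrite divr_gt0// subr_gt0.
have [s1 s10 hs1] := Ex_cos_near1 k0.
exists (k ^+ 2 * (1 - q2)), (Num.min s1 w0); split.
- by rewrite mulr_gt0 ?exprn_gt0 ?subr_gt0.
- by rewrite lt_min s10.
move=> s /andP[s0]; rewrite le_min => /andP[ss1 sw0].
have ms : measurable_fun setT (fun o => s * X o) by exact: measurable_funM.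
have bc : bmfun (fun o => cos (s * X o)).
  by apply: (bmfun_comp (M := 1) (@measurable_cos R)) => // x; exact: cos_norm_le1.
have bs : bmfun (fun o => sin (s * X o)).
  by apply: (bmfun_comp (M := 1) (@measurable_sin R)) => // x; exact: sin_norm_le1.
set p := Ex P (fun o => cos (s * X o)); set q := Ex P (fun o => sin (s * X o)).
have hp : 1 - k <= p by apply: hs1; rewrite s0.
have e1 : 1 - charf2 P (fun o => s * X o) = Ex P (fun o => (cos (s * X o) - p) ^+ 2) +
    Ex P (fun o => (sin (s * X o) - q) ^+ 2).
  have bcp : bmfun (fun o => (cos (s * X o) - p) ^+ 2) by apply: bmfunX; apply: bmfunB => //; exact: bmfun_cst.
  have bsq : bmfun (fun o => (sin (s * X o) - q) ^+ 2) by apply: bmfunX; apply: bmfunB => //; exact: bmfun_cst.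
  rewrite -ExD//.
  have -> : (fun o => (cos (s * X o) - p) ^+ 2 + (sin (s * X o) - q) ^+ 2) =
     (fun o => (1 + p ^+ 2 + q ^+ 2) - ((2 * p) * cos (s * X o) + (2 * q) * sin (s * X o))).
    apply/funext => o; have := cos2Dsin2 (s * X o) => h.
    rewrite -[X in _ = X + _ + _ - _]h; ring.
  rewrite ExB; [|exact: bmfun_cst|by apply: bmfunD; exact: bmfunZ].
  rewrite Ex_cst ExD; [|exact: bmfunZ|exact: bmfunZ].
  rewrite !ExZ// -/p -/q /charf2 -/p -/q; ring.
rewrite e1.
apply: (@le_trans _ _ (Ex P (fun o => (cos (s * X o) - p) ^+ 2))); last first.
  by rewrite lerDl; apply: Ex_ge0 => o; exact: sqr_ge0.
pose A := [set o | 1 < s * `|X o|] `\` [set o | 1 < s / 2 * `|X o|].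
have mA : measurable A by apply: measurableD; exact: measurable_tailw.
have PA : (1 - q2) * tailw s <= Pr P A.
  have : tailw s <= Pr P A + tailw (s / 2).
    apply: le_trans (PrU_le _ _ _) => //; last exact: measurable_tailw.
    apply: Pr_le; [exact: measurable_tailw|by apply: measurableU => //; exact: measurable_tailw|].
    by move=> o h; rewrite /A; have [h'|h'] := pselect (1 < s / 2 * `|X o|); [right|left].
  have : tailw (s / 2) <= q2 * tailw s.
    move: s0; rewrite le_eqVlt => /predU1P[<-|sp]; first by rewrite mul0r tailw0 mulr0.
    by apply: hd; rewrite sp.
  by rewrite mulrBl mul1r; lra.
apply: (@le_trans _ _ (k ^+ 2 * Pr P A)).
  by rewrite -mulrA ler_pM2l ?exprn_gt0.
rewrite -Ex_indic// -ExZ; last exact: bmfun_indic.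
apply: Ex_le; first by apply: bmfunZ; exact: bmfun_indic.
  by apply: bmfunX; apply: bmfunB => //; exact: bmfun_cst.
move=> o; rewrite indicE; have [h|h] := boolP (o \in A); last by rewrite mulr0 sqr_ge0.
move: h; rewrite inE => -[/= h1 /negP]; rewrite -leNgt => h2.
have hc : cos (s * X o) < cos 1.
  rewrite -cos_norm ltr_cos ?in_itv/= ?normr_ge0 ?ler01//.
  - by rewrite normrM (ger0_norm s0).
  - by rewrite (le_trans _ (pi_ge2 R))// ler1n.
  - rewrite normrM (ger0_norm s0); apply: le_trans (pi_ge2 R).
    by move: h2; rewrite mulrAC ler_pdivrMr// mul1r.
have hk : k <= p - cos (s * X o) by rewrite /k in hp *; lra.
rewrite mulr1 -[leRHS]sqrrN opprB ler_pXn2r ?nnegrE ?(ltW k0)//.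
exact: le_trans (ltW k0) hk.
Qed.

(* Summing over dyadic scales: beyond level [2 ^+ k] the mean of [w X] is geometrically small. *)
Lemma cutoff_mean (q2 w : R) : 0 <= q2 -> q2 < 2^-1 ->
  (forall w', 0 < w' <= w -> tailw (w' / 2) <= q2 * tailw w') -> 0 < w -> forall k,
  `|Ex P (fun o => cutoff (2 ^+ k) (w * X o)) - Ex P (fun o => clip1 (w * X o))| <=
     2 / (1 - 2 * q2) * tailw w /\
  Ex P (fun o => `|cutoff (2 ^+ k) (w * X o)|) <= 1 + 2 / (1 - 2 * q2) * tailw w.
Proof.
move=> q20 q2h hd w0 k; set B := 2 / (1 - 2 * q2); set r := 2 * q2.
have r0 : 0 <= r by rewrite mulr_ge0.
have r1 : r < 1 by rewrite /r; lra.
have B0 : 0 <= B by rewrite divr_ge0// subr_ge0 ltW.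
have BE : B * (1 - r) = 2 by rewrite /B divfK// gt_eqF// subr_gt0.
have tk j : tailw (w / 2 ^+ j) <= q2 ^+ j * tailw w.
  elim: j => [|j ih]; first by rewrite !expr0 divr1 mul1r.
  have -> : w / 2 ^+ j.+1 = w / 2 ^+ j / 2 by rewrite exprS invfM mulrA mulrAC.
  apply: (@le_trans _ _ (q2 * tailw (w / 2 ^+ j))).
    apply: hd; rewrite divr_gt0 ?exprn_gt0//= ler_pdivrMr ?exprn_gt0//.
    by rewrite ler_peMr ?(ltW w0)// exprn_ege1// ler1n.
  by rewrite exprS -mulrA; exact: ler_wpM2l.
have bc j : bmfun (fun o => cutoff (2 ^+ j) (w * X o)).
  apply: (bmfun_comp (@measurable_cutoff R _) (M := 2 ^+ j)); last exact: measurable_funM.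
  by move=> x; apply: cutoff_norm; rewrite exprn_ge0.
(* Consecutive cutoffs differ only where |w X| > 2^j, and then by at most 2^(j+1). The expectations
   of the [D j] are dominated by a geometric series of ratio 2 q2, which is where q2 < 1/2
   enters. *)
pose D j o := 2 ^+ j.+1 * (\1_[set o | 1 < w / 2 ^+ j * `|X o|] o : R).
have bD j : bmfun (D j) by apply: bmfunZ; apply: bmfun_indic; exact: measurable_tailw.
have ED j : Ex P (D j) <= 2 * r ^+ j * tailw w.
  rewrite /D ExZ; last by apply: bmfun_indic; exact: measurable_tailw.
  rewrite Ex_indic; last exact: measurable_tailw.
  rewrite -/(tailw _) /r exprMn exprS -2!mulrA ler_pM2l// -mulrA ler_pM2l ?exprn_gt0//.
have step j o : `|cutoff (2 ^+ j.+1) (w * X o) - cutoff (2 ^+ j) (w * X o)| <= D j o.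
  rewrite /cutoff /D indicE.
  have eqw : (1 < w / 2 ^+ j * `|X o|) = (2 ^+ j < `|w * X o|).
    by rewrite normrM (gtr0_norm w0) mulrAC ltr_pdivlMr ?exprn_gt0// mul1r.
  have eqm : (o \in [set o | 1 < w / 2 ^+ j * `|X o|]) = (2 ^+ j < `|w * X o|).
    by apply/idP/idP; rewrite inE /= eqw.
  rewrite eqm; have [h|h] := ltP (2 ^+ j) `|w * X o|.
    rewrite /= mulr0 subr0 mulr1.
    have [h'|h'] := leP `|w * X o| (2 ^+ j.+1); first by rewrite mulr1.
    by rewrite mulr0 normr0 exprn_ge0.
  have -> : `|w * X o| <= 2 ^+ j.+1 by apply: le_trans h _; rewrite ler_eXn2l// ltr1n.
  by rewrite /= mulr1 subrr normr0 mulr0.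
have main j : `|Ex P (fun o => cutoff (2 ^+ j) (w * X o)) - Ex P (fun o => clip1 (w * X o))| <=
     B * (1 - r ^+ j) * tailw w /\
   Ex P (fun o => `|cutoff (2 ^+ j) (w * X o)|) <= 1 + B * (1 - r ^+ j) * tailw w.
  elim: j => [|j [ih1 ih2]].
    have -> : (fun o => cutoff (2 ^+ 0) (w * X o)) = fun o => clip1 (w * X o) by [].
    rewrite !subrr normr0 mulr0 mul0r addr0; split=> //.
    rewrite -[leRHS](Ex_cst P); apply: Ex_le; last by move=> o; exact: clip1_le1.
      by apply: bmfun_norm; exact: bmfun_clip1.
    exact: bmfun_cst.
  have e : B * (1 - r ^+ j.+1) * tailw w = B * (1 - r ^+ j) * tailw w + 2 * r ^+ j * tailw w.
    by rewrite -BE exprS; ring.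
  rewrite e; have hE := ED j; split.
    have h : `|Ex P (fun o => cutoff (2 ^+ j.+1) (w * X o)) - Ex P (fun o => cutoff (2 ^+ j) (w * X o))|
       <= Ex P (D j).
      rewrite -ExB//; apply: le_trans (Ex_norm _ _) _; first exact: bmfunB.
      by apply: Ex_le => //; apply: bmfun_norm; exact: bmfunB.
    apply: le_trans (ler_distD (Ex P (fun o => cutoff (2 ^+ j) (w * X o))) _ _) _.
    by lra.
  apply: (@le_trans _ _ (Ex P (fun o => `|cutoff (2 ^+ j) (w * X o)| + D j o))).
    apply: Ex_le; [exact: bmfun_norm|by apply: bmfunD => //; exact: bmfun_norm|].
    move=> o; have := step j o; have := ler_normD (cutoff (2 ^+ j) (w * X o))
      (cutoff (2 ^+ j.+1) (w * X o) - cutoff (2 ^+ j) (w * X o)).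
    rewrite addrC subrK; lra.
  by rewrite ExD//; [lra|exact: bmfun_norm].
have [h1 h2] := main k.
have h3 : B * (1 - r ^+ k) * tailw w <= B * tailw w.
  rewrite ler_wpM2r ?tailw_ge0// ler_piMr// gerBl; exact: exprn_ge0.
by split; lra.
Qed.

(** For a centered variable the truncated mean is the opposite of the mean beyond the truncation;
    [cutoff_mean] bounds the latter uniformly in the cutoff level, which is then sent to
    infinity. *)
Lemma clip1_mean_centered (q2 w0 : R) : 0 <= q2 -> q2 < 2^-1 -> 0 < w0 ->
  (forall w, 0 < w <= w0 -> tailw (w / 2) <= q2 * tailw w) -> ('E_P[X] = 0)%E ->
  forall w, 0 <= w <= w0 ->
  `|Ex P (fun o => clip1 (w * X o))| <= 2 / (1 - 2 * q2) * tailw w.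
Proof.
move=> q20 q2h w00 hd EX w /andP[]; rewrite le_eqVlt => /predU1P[<- _|wp ww0].
  have -> : (fun o => clip1 (0 * X o)) = fun=> 0.
    by apply/funext => o; rewrite mul0r /clip1 mul0r.
  by rewrite Ex_cst normr0 tailw0 mulr0.
have hd' w' : 0 < w' <= w -> tailw (w' / 2) <= q2 * tailw w'.
  by move=> /andP[h1 h2]; apply: hd; rewrite h1 (le_trans h2).
have cm := cutoff_mean q20 q2h hd' wp.
set B := 2 / (1 - 2 * q2) in cm *.
pose f_ k o := cutoff (2 ^+ k) (w * X o).
have bf k : bmfun (f_ k).
  apply: (bmfun_comp (@measurable_cutoff R _) (M := 2 ^+ k)); last exact: measurable_funM.
  by move=> x; apply: cutoff_norm; rewrite exprn_ge0.
have fE o : \forall k \near \oo, f_ k o = w * X o.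
  exists (Num.truncn `|w * X o|).+1 => // k /= hk; rewrite /f_ /cutoff.
  have -> : `|w * X o| <= 2 ^+ k.
    apply: (le_trans (ltW (truncnS_gt _))); rewrite -natrX ler_nat.
    by apply: (leq_trans hk); exact: ltnW (ltn_expl _ _).
  by rewrite mulr1.
have mwX : measurable_fun setT (fun o => w * X o) by exact: measurable_funM.
(* Integrability is not read off from the vanishing mean: it follows by monotone convergence from
   the uniform bound on the first absolute moments of the cutoffs. *)
have iwX : P.-integrable setT (EFin \o (fun o => w * X o)).
  apply/integrableP; split; first exact/measurable_EFinP.
  have nd o : setT o -> nondecreasing_seq (fun k => `|f_ k o|%:E).
    move=> _ k l kl; rewrite lee_fin /f_ /cutoff.
    have [h|h] := leP `|w * X o| (2 ^+ k); last by rewrite mulr0 normr0.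
    by rewrite (le_trans h) ?mulr1// ler_weXn2l// ler1n.
  have mfk k : measurable_fun setT (fun o => `|f_ k o|%:E).
    by apply/measurable_EFinP; apply: measurableT_comp => //; have [] := bf k.
  have ge0 k o : setT o -> (0 <= `|f_ k o|%:E)%E by rewrite lee_fin.
  have cvgm := @cvg_monotone_convergence _ _ _ P _ measurableT _ mfk ge0 nd.
  have eqf : (fun o => limn (fun k => `|f_ k o|%:E)) = (fun o => `|w * X o|%:E).
    apply/funext => o; apply/cvg_lim => //; apply: cvg_near_cst.
    by apply: filterS (fE o) => k ->.
  rewrite eqf in cvgm.
  apply: (@le_lt_trans _ _ (1 + B * tailw w)%:E); last exact: ltry.
  apply: (cvge_to_le cvgm); apply: nearW => k /=.
  have [_ h] := cm k.
  have := expectationE P (bmfun_norm (bf k)); rewrite unlock => ->.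
  by rewrite lee_fin.
have lim0 : Ex P (f_ k) @[k --> \oo] --> (0 : R).
  have [] := @dominated_convergence _ _ _ P setT measurableT (fun k o => (f_ k o)%:E)
    (EFin \o (fun o => w * X o)) (fun o => `|w * X o|%:E).
  - by move=> k; apply/measurable_EFinP; have [] := bf k.
  - exact/measurable_EFinP.
  - apply: aeW => o _; apply: cvg_near_cst; by apply: filterS (fE o) => k ->.
  - exact: integrable_norm.
  - apply: aeW => o k _; rewrite /= lee_fin /f_ /cutoff.
    by have [h|h] := leP `|w * X o| (2 ^+ k); rewrite /= ?mulr1 ?mulr0 ?normr0.
  move=> _ _.
  have -> : (\int[P]_o (EFin \o (fun o => (w * X o)%R)) o = 0)%E.
    have iX : P.-integrable setT (EFin \o X).
      have := integrableZl measurableT (w^-1) iwX; apply: eq_integrable => // o _ /=.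
      by rewrite -EFinM mulKf ?gt_eqF.
    under eq_integral do rewrite /= EFinM.
    rewrite integralZl//; have := EX; rewrite unlock => ->; by rewrite mule0.
  move=> /fine_cvgP[_]; apply: cvg_trans; apply: near_eq_cvg; apply: nearW => k /=.
  have := expectationE P (bf k); rewrite unlock => e.
  by rewrite /Ex /Rintegral.
have h : `|Ex P (fun o => clip1 (w * X o))| <= B * tailw w + 0.
  have c1 : B * tailw w + `|Ex P (f_ k)| @[k --> \oo] --> B * tailw w + 0.
    by apply: cvgD; [exact: cvg_cst|rewrite -(normr0 R); exact: cvg_norm].
  apply: (cvgr_to_ge c1); apply: nearW => k.
  have [h _] := cm k; rewrite -/(f_ k) in h.
  have -> : Ex P (fun o => clip1 (w * X o)) =
      Ex P (f_ k) - (Ex P (f_ k) - Ex P (fun o => clip1 (w * X o))) by ring.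
  by apply: le_trans (ler_normB _ _) _; rewrite addrC lerD2r.
by rewrite addr0 in h.
Qed.

End tail.

(* What the proof uses of regular variation, as [w] tends to [0]: doubling of the tail
   [tailw P X w] = P(|X| > 1 / w), and Karamata's bounds for the moments truncated at [1 / w]. *)
Definition regular_tail d (T : measurableType d) (R : realType) (P : probability T R)
    (X : T -> R) (q1 q2 K w0 : R) : Prop :=
  [/\ 0 < w0, 4^-1 < q1, 0 <= q2 < 1, 0 < K & forall w, 0 < w -> 0 < tailw P X w] /\
  forall w, 0 <= w <= w0 ->
  [/\ q1 * tailw P X w <= tailw P X (w / 2), tailw P X (w / 2) <= q2 * tailw P X w,
      Ex P (fun o => clip1 (w * X o) ^+ 2) <= K * tailw P X w &
      `|Ex P (fun o => clip1 (w * X o))| <= K * tailw P X w].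

Section regular_variation.
Context d (T : measurableType d) (R : realType) (P : probability T R) (X : T -> R).
Hypothesis mX : measurable_fun setT X.
Variables (alpha : R) (h : R -> R).
Hypotheses (sv : slowly_varying h).
Hypothesis hP : forall x, 0 < x -> P [set w | x < `|X w|] = (powR x (- alpha) * h x)%:E.

Lemma tailwE w : 0 < w -> tailw P X w = powR w alpha * h w^-1.
Proof.
move=> w0; rewrite /tailw /Pr.
have -> : [set o | 1 < w * `|X o|] = [set o | w^-1 < `|X o|].
  by apply/seteqP; split=> o /=; rewrite -ltr_pdivrMl// mulr1.
rewrite hP ?invr_gt0//=; congr (_ * _).
by rewrite -(powR_inv1 (ltW w0)) -powRrM mulN1r opprK.
Qed.

Lemma regular_tail_pos w : 0 < w -> 0 < tailw P X w.
Proof.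
(* With ratio 1, slow variation says that h x / h x tends to 1. As 0 / 0 is 0, this forces [h x] to
   be nonzero for large x, and the tail is positive there, hence at every larger [w]. *)
move=> w0; have := sv (ltr01 : 0 < (1 : R)) => /cvgr_gt/(_ 0 ltr01).
move=> [M [_ hM]].
pose x := Num.max (M + 1) w^-1.
have xM : M < x by rewrite lt_max ltrDl ltr01.
have x0 : 0 < x by rewrite lt_max orbC invr_gt0 w0.
have hx0 : h x != 0 by apply/negP => /eqP h0; have := hM x xM; rewrite h0 invr0 mulr0 ltxx.
have : tailw P X x^-1 <= tailw P X w.
  apply: tailw_le => //; rewrite -[leRHS]invrK lef_pV2 ?posrE ?invr_gt0//.
  by rewrite le_max lexx orbT.
apply: lt_le_trans; rewrite lt_neqAle tailw_ge0 andbT eq_sym.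
rewrite tailwE ?invr_gt0// invrK mulf_neq0//.
by rewrite gt_eqF// powR_gt0// invr_gt0.
Qed.

Lemma tail_doubling (q1 q2 : R) : 0 < q1 -> q1 < 2 `^ (- alpha) -> 2 `^ (- alpha) < q2 ->
  exists2 w0, 0 < w0 & forall w, 0 <= w <= w0 ->
  q1 * tailw P X w <= tailw P X (w / 2) /\ tailw P X (w / 2) <= q2 * tailw P X w.
Proof.
move=> q10 h1 h2; set th := 2 `^ (- alpha) in h1 h2.
have th0 : 0 < th by rewrite powR_gt0.
have hcv := sv (ltr0n R 2 : 0 < 2).
have lt1 : q1 / th < 1 by rewrite ltr_pdivrMr// mul1r.
have gt1 : 1 < q2 / th by rewrite ltr_pdivlMr// mul1r.
have /cvgr_gt/(_ _ lt1)[M1 [_ hM1]] := hcv.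
have /cvgr_lt/(_ _ gt1)[M2 [_ hM2]] := hcv.
pose M := Num.max (Num.max M1 M2) 0 + 1.
have MM : Num.max (Num.max M1 M2) 0 < M by rewrite ltrDl.
have M0 : 0 < M by apply: le_lt_trans MM; rewrite le_max lexx orbT.
exists M^-1 => [|w /andP[]]; first by rewrite invr_gt0.
rewrite le_eqVlt => /predU1P[<- _|w0 wM]; first by rewrite mul0r tailw0 !mulr0.
have Mw : M <= w^-1 by rewrite -[leLHS]invrK lef_pV2 ?posrE ?invr_gt0.
have {}MM := lt_le_trans MM Mw; move: MM; rewrite !gt_max => /andP[/andP[wM1 wM2] _].
have hw1 := hM1 _ wM1; have hw2 := hM2 _ wM2.
have wa0 : 0 < w `^ alpha by rewrite powR_gt0.
have hx0 : 0 < h w^-1 by have := regular_tail_pos w0; rewrite tailwE// pmulr_rgt0.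
have t2 : tailw P X (w / 2) = th * (w `^ alpha * h (2 * w^-1)).
  rewrite tailwE ?divr_gt0// invfM invrK powRM ?invr_ge0 ?(ltW w0)//.
  rewrite -(powR_inv1 (ler0n R 2)) -powRrM mulN1r -/th [w^-1 * 2]mulrC; ring.
rewrite t2 tailwE//; move: hw1 hw2; rewrite ltr_pdivlMr// ltr_pdivrMr// => hw1 hw2.
split.
  rewrite mulrCA [leRHS]mulrCA ler_pM2l//.
  by move: hw1; rewrite mulrAC ltr_pdivrMr// [_ * th]mulrC => /ltW.
rewrite mulrCA [leRHS]mulrCA ler_pM2l//.
by move: hw2; rewrite mulrAC ltr_pdivlMr// [_ * th]mulrC => /ltW.
Qed.

(** The second moment is controlled throughout, since alpha < 2 permits q1 > 1/4. The regimes differ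
    in the truncated mean. For alpha < 1 one may take q1 > 1/2 and bound the first absolute moment;
    for alpha > 1 one may take q2 < 1/2 and use the centering; for alpha = 1 symmetry makes the mean
    0. *)
Lemma regular_tail_exists : 0 < alpha < 2 -> (1 < alpha -> ('E_P[X] = 0)%E) ->
  (alpha = 1 -> eq_dist P P X (fun o => - X o)) ->
  exists q1 q2 K w0, regular_tail P X q1 q2 K w0.
Proof.
move=> /andP[a0 a2] hmean hsym.
set th := 2 `^ (- alpha).
have thlt b : alpha < b -> 2 `^ (- b) < th.
  by move=> ab; rewrite /th /powR gt_eqF// ltr_expR ltr_pM2r ?ln_gt0 ?ltr1n// ltrN2.
have thgt b : b < alpha -> th < 2 `^ (- b).
  by move=> ab; rewrite /th /powR gt_eqF// ltr_expR ltr_pM2r ?ln_gt0 ?ltr1n// ltrN2.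
have p1 : 2 `^ (- 1) = 2^-1 :> R by rewrite powR_inv1.
have p2 : 2 `^ (- 2) = 4^-1 :> R.
  rewrite -[X in - X]/(2%:R) powR_invn// exprnP; congr (_^-1); rewrite -exprnP expr2; lra.
have th4 : 4^-1 < th by rewrite -p2; exact: thlt.
have th1 : th < 1 by rewrite -(powRr0 2) -oppr0; exact: thgt.
suff [q1 [q2 [w0 [C [q14 q21 w00 C0 hw]]]]] : exists q1 q2 w0 C,
    [/\ 4^-1 < q1, 0 <= q2 < 1, 0 < w0, 0 < C & forall w, 0 <= w <= w0 ->
      [/\ q1 * tailw P X w <= tailw P X (w / 2), tailw P X (w / 2) <= q2 * tailw P X w &
       `|Ex P (fun o => clip1 (w * X o))| <= C * tailw P X w]].
  have hq w : 0 < w <= w0 -> q1 * tailw P X w <= tailw P X (w / 2).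
    by move=> /andP[h1 h2]; have [] := hw w ltac:(by rewrite ltW).
  have q14' : (2 ^+ 2)^-1 < q1 by apply: le_lt_trans q14; rewrite expr2; lra.
  have [C2 C20 hC2] := clip1_moment mX (isT : (0 < 2)%N) w00 q14' regular_tail_pos hq.
  exists q1, q2, (Num.max C C2), w0; split.
    by split=> //; [rewrite lt_max C0|exact: regular_tail_pos].
  move=> w hww; have [h1 h2 h3] := hw w hww; split=> //.
    apply: le_trans (_ : _ <= C2 * tailw P X w) _.
      apply: le_trans (hC2 w hww); rewrite le_eqVlt; apply/orP; left; apply/eqP.
      by congr Ex; apply/funext => o; rewrite real_normK// num_real.
    by rewrite ler_wpM2r ?tailw_ge0// le_max lexx orbT.
  by apply: (le_trans h3); rewrite ler_wpM2r ?tailw_ge0// le_max lexx.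
have [a1|a1|a1] := ltgtP alpha 1.
- have th2 : 2^-1 < th by rewrite -p1; exact: thlt.
  pose q1 := (2^-1 + th) / 2; pose q2 := (th + 1) / 2.
  have q10 : 0 < q1 by rewrite /q1; lra.
  have q1th : q1 < th by rewrite /q1; lra.
  have q2th : th < q2 by rewrite /q2; lra.
  have [w0 w00 hw] := tail_doubling q10 q1th q2th.
  have hq w : 0 < w <= w0 -> q1 * tailw P X w <= tailw P X (w / 2).
    by move=> /andP[h1 h2]; have [] := hw w ltac:(by rewrite ltW).
  have q12 : (2 ^+ 1)^-1 < q1 by rewrite expr1 /q1; lra.
  have [C C0 hC] := clip1_moment mX (isT : (0 < 1)%N) w00 q12 regular_tail_pos hq.
  exists q1, q2, w0, C; split=> //; first by rewrite /q1; lra.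
    by rewrite /q2; apply/andP; split; lra.
  move=> w hww; have [h1 h2] := hw w hww; split=> //.
  by apply: le_trans (hC w hww); apply: Ex_norm; exact: bmfun_clip1.
- have th2 : th < 2^-1 by rewrite -p1; exact: thgt.
  pose q1 := (4^-1 + th) / 2; pose q2 := (th + 2^-1) / 2.
  have q10 : 0 < q1 by rewrite /q1; lra.
  have q1th : q1 < th by rewrite /q1; lra.
  have q2th : th < q2 by rewrite /q2; lra.
  have [w0 w00 hw] := tail_doubling q10 q1th q2th.
  have hq w : 0 < w <= w0 -> tailw P X (w / 2) <= q2 * tailw P X w.
    by move=> /andP[h1 h2]; have [] := hw w ltac:(by rewrite ltW).
  have q20 : 0 <= q2 by rewrite /q2; lra.
  have q22 : q2 < 2^-1 by rewrite /q2; lra.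
  have hC := clip1_mean_centered mX q20 q22 w00 hq (hmean a1).
  exists q1, q2, w0, (2 / (1 - 2 * q2)); split=> //; first by rewrite /q1; lra.
    by apply/andP; split => //; lra.
    by rewrite divr_gt0//; lra.
  by move=> w hww; have [h1 h2] := hw w hww; split=> //; exact: hC.
- have th2 : th = 2^-1 by rewrite /th a1 p1.
  have [w0 w00 hw] := @tail_doubling (3 / 8) (3 / 4) ltac:(lra) ltac:(rewrite -/th; lra) ltac:(rewrite -/th; lra).
  exists (3 / 8), (3 / 4), w0, 1; split=> //; [lra|by apply/andP; split; lra|].
  move=> w hww; have [h1 h2] := hw w hww; split=> //.
  by rewrite clip1_mean_sym ?normr0 ?mul1r ?tailw_ge0//; exact: hsym.
Qed.

End regular_variation.

(** * Truncated weighted sums of i.i.d. variables *)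

Section iid.
Context d (T : measurableType d) (R : realType) (P : probability T R).
Variables (I : eqType) (Y : I -> T -> R) (X : T -> R).
Hypotheses (mY : forall i, measurable_fun setT (Y i)) (iY : mutual_indep P Y).
Hypotheses (mX : measurable_fun setT X) (dY : forall i, eq_dist P P (Y i) X).

Lemma iid_Ex (psi : R -> R) (M : R) i : measurable_fun setT psi ->
  (forall x, `|psi x| <= M) -> Ex P (fun o => psi (Y i o)) = Ex P (fun o => psi (X o)).
Proof. by move=> mp hp; apply: (@Ex_eq_dist _ _ _ _ _ P P (Y i) X) => //; exists M. Qed.

Lemma iid_tailw i w : Pr P [set o | 1 < w * `|Y i o|] = tailw P X w.
Proof.
rewrite /tailw /Pr; congr fine.
have mB : measurable [set x : R | 1 < w * `|x|].
  by apply: measurable_set_lt; apply: measurable_funM => //; exact: normr_measurable.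
exact: (dY i mB).
Qed.

Lemma measurable_clip1_scale (w : R) : measurable_fun setT (fun x : R => clip1 (w * x)).
Proof. by apply: measurableT_comp; [exact: measurable_clip1|exact: measurable_funM]. Qed.

Lemma iid_charf2 i w : charf2 P (fun o => w * Y i o) = charf2 P (fun o => w * X o).
Proof.
have mw : measurable_fun setT (fun x : R => w * x) by exact: measurable_funM.
rewrite /charf2 (@iid_Ex (fun x => cos (w * x)) 1); last 2 first.
- by apply: measurableT_comp => //; exact: measurable_cos.
- by move=> x; exact: cos_norm_le1.
rewrite (@iid_Ex (fun x => sin (w * x)) 1)//; last by move=> x; exact: sin_norm_le1.
by apply: measurableT_comp => //; exact: measurable_sin.
Qed.

Variables (q1 q2 K w0 : R).
Hypothesis rt : regular_tail P X q1 q2 K w0.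

Definition cmean (w : R) : R := Ex P (fun o => clip1 (w * X o)).

Lemma maximal_trunc (s : seq I) (w : I -> R) (rho : nat -> I -> R) n (e : R) :
  uniq s -> (forall i, 0 <= w i <= w0) ->
  (forall i, 0 <= rho 0%N i) -> (forall k i, rho k i <= rho k.+1 i) ->
  (forall i, rho n i <= 1) -> 0 < e ->
  Pr P [set o | exists2 k, (k <= n)%N &
      e < `|\sum_(i <- s) rho k i * (clip1 (w i * Y i o) - cmean (w i))|] <=
    2 * K / e ^+ 2 * \sum_(i <- s) tailw P X (w i).
Proof.
move=> us hw r0 rS r1 e0.
pose psi i x := clip1 (w i * x) - cmean (w i).
have mpsi i : measurable_fun setT (psi i).
  by apply: measurable_funB => //; exact: measurable_clip1_scale.
have bt i : bmfun (fun o => clip1 (w i * Y i o)) by exact: bmfun_clip1.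
have bpsi i : bmfun (psi i \o Y i) by apply: bmfunB => //; exact: bmfun_cst.
have Et i : Ex P (fun o => clip1 (w i * Y i o)) = cmean (w i).
  by rewrite (@iid_Ex (fun x => clip1 (w i * x)) 1)//; [exact: measurable_clip1_scale|move=> x; exact: clip1_le1].
have psi0 i : Ex P (psi i \o Y i) = 0.
  rewrite /psi /comp ExB//; last exact: bmfun_cst.
  by rewrite Et Ex_cst subrr.
have hmax := sum_maximal_inequality mY iY n us mpsi bpsi psi0 r0 rS e0.
apply: (le_trans hmax).
have -> : 2 * K / e ^+ 2 * \sum_(i <- s) tailw P X (w i) = 2 / e ^+ 2 * (K * \sum_(i <- s) tailw P X (w i)) by ring.
rewrite ler_pM2l ?divr_gt0 ?exprn_gt0// mulr_sumr; apply: ler_sum => i _.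
have rn : 0 <= rho n i by elim: (n) => // m ih; exact: le_trans (rS m i).
apply: (@le_trans _ _ (1 * Ex P (fun o => psi i (Y i o) ^+ 2))).
  apply: ler_wpM2r; first by apply: Ex_ge0 => o; exact: sqr_ge0.
  by rewrite exprn_ile1.
rewrite mul1r; have [_ _ + _] := rt.2 _ (hw i); apply: le_trans.
have <- : Ex P (fun o => clip1 (w i * Y i o) ^+ 2) = Ex P (fun o => clip1 (w i * X o) ^+ 2).
  apply: (@iid_Ex (fun x => clip1 (w i * x) ^+ 2) 1).
    by apply: measurable_funX; exact: measurable_clip1_scale.
  by move=> x; rewrite normrX exprn_ile1// clip1_le1.
have -> : (fun o => psi i (Y i o) ^+ 2) = (fun o => clip1 (w i * Y i o) ^+ 2 -
    (2 * cmean (w i) * clip1 (w i * Y i o) - cmean (w i) ^+ 2)).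
  by apply/funext => o; rewrite /psi; ring.
rewrite ExB; [|exact: bmfunX|by apply: bmfunB; [exact: bmfunZ|exact: bmfun_cst]].
rewrite ExB; [|exact: bmfunZ|exact: bmfun_cst].
rewrite ExZ// Et Ex_cst gerBl.
have -> : 2 * cmean (w i) * cmean (w i) - cmean (w i) ^+ 2 = cmean (w i) ^+ 2 by ring.
exact: sqr_ge0.
Qed.

Lemma measurable_exists_gt (f : nat -> T -> R) n (e : R) :
  (forall k, measurable_fun setT (f k)) ->
  measurable [set o | exists2 k, (k <= n)%N & e < f k o].
Proof.
move=> mf; rewrite (_ : [set _ | _] = [set o | exists2 k, k \in iota 0 n.+1 & [set o | e < f k o] o]).
  by apply: measurable_exists_seq => k; exact: measurable_set_lt.
by apply/seteqP; split=> o [k hk he]; exists k => //; move: hk; rewrite mem_iota.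
Qed.

(** Signed weights are differences of two monotone families. Each is treated at level e/2, which
    turns the constant 2 into 2 * 4 + 2 * 4 = 16. *)
Lemma maximal_trunc_signed (s : seq I) (w : I -> R) (rp rm : nat -> I -> R) n (e : R) :
  uniq s -> (forall i, 0 <= w i <= w0) ->
  (forall i, 0 <= rp 0%N i) -> (forall k i, rp k i <= rp k.+1 i) -> (forall i, rp n i <= 1) ->
  (forall i, 0 <= rm 0%N i) -> (forall k i, rm k i <= rm k.+1 i) -> (forall i, rm n i <= 1) ->
  0 < e ->
  Pr P [set o | exists2 k, (k <= n)%N &
      e < `|\sum_(i <- s) (rp k i - rm k i) * (clip1 (w i * Y i o) - cmean (w i))|] <=
    16 * K / e ^+ 2 * \sum_(i <- s) tailw P X (w i).
Proof.
move=> us hw p0 pS p1 m0 mS m1 e0; have e20 : 0 < e / 2 by rewrite divr_gt0.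
have hp := maximal_trunc us hw p0 pS p1 e20; have hm := maximal_trunc us hw m0 mS m1 e20.
have mz (rho : nat -> I -> R) k : measurable_fun setT (fun o =>
    `|\sum_(i <- s) rho k i * (clip1 (w i * Y i o) - cmean (w i))|).
  apply: measurableT_comp => //; apply: measurable_sum_seq => i _; apply: measurable_funM => //.
  by apply: measurable_funB => //; have [] := bmfun_clip1 (mY i) (w i).
have -> : 16 * K / e ^+ 2 * \sum_(i <- s) tailw P X (w i) =
   2 * K / (e / 2) ^+ 2 * \sum_(i <- s) tailw P X (w i) +
   2 * K / (e / 2) ^+ 2 * \sum_(i <- s) tailw P X (w i).
  by field; rewrite gt_eqF.
apply: le_trans (lerD hp hm); apply: le_trans (PrU_le _ _ _); try exact: measurable_exists_gt.
apply: Pr_le; first exact: (measurable_exists_gt _ _ (mz (fun k i => rp k i - rm k i))).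
  by apply: measurableU; exact: measurable_exists_gt.
move=> o [k kn].
have -> : \sum_(i <- s) (rp k i - rm k i) * (clip1 (w i * Y i o) - cmean (w i)) =
   \sum_(i <- s) rp k i * (clip1 (w i * Y i o) - cmean (w i)) -
   \sum_(i <- s) rm k i * (clip1 (w i * Y i o) - cmean (w i)).
  by rewrite -sumrB; apply: eq_bigr => i _; rewrite mulrBl.
set a := \sum_(i <- s) rp k i * _; set b := \sum_(i <- s) rm k i * _ => hab.
have [ha|ha] := ltP (e / 2) `|a|; first by left; exists k.
right; exists k => //; rewrite -/b.
have := ler_normB a b; lra.
Qed.

(** Off the event that some w_i |Y_i| exceeds 1, whose probability is at most the sum of the tails,
    truncation changes nothing. The centering costs at most [K] times that sum, because |rp - rm| <=
    1. Thus [kap] makes the drift at most e/2 and the total probability at most e. *)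
Lemma maximal_small (e : R) : 0 < e -> exists2 kap, 0 < kap &
  forall (s : seq I) (w : I -> R) (rp rm : nat -> I -> R) n,
  uniq s -> (forall i, 0 <= w i <= w0) ->
  (forall i, 0 <= rp 0%N i) -> (forall k i, rp k i <= rp k.+1 i) -> (forall i, rp n i <= 1) ->
  (forall i, 0 <= rm 0%N i) -> (forall k i, rm k i <= rm k.+1 i) -> (forall i, rm n i <= 1) ->
  \sum_(i <- s) tailw P X (w i) <= kap ->
  Pr P [set o | exists2 k, (k <= n)%N &
      e < `|\sum_(i <- s) (rp k i - rm k i) * (w i * Y i o)|] <= e.
Proof.
move=> e0; have [[w00 q10 _ K0 _] hrt] := rt.
have e20 : 0 < e / 2 by rewrite divr_gt0.
pose C := 16 * K / (e / 2) ^+ 2.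
have C0 : 0 < C by rewrite divr_gt0 ?mulr_gt0 ?exprn_gt0.
pose kap := Num.min (e / 2 / K) (e / (1 + C)).
have C1 : 0 < 1 + C by rewrite addr_gt0.
have kap0 : 0 < kap by rewrite lt_min !divr_gt0.
exists kap => // s w rp rm n us hw p0 pS p1 m0 mS m1 hs.
have hS0 : 0 <= \sum_(i <- s) tailw P X (w i) by apply: sumr_ge0 => i _; exact: tailw_ge0.
have hKS : K * \sum_(i <- s) tailw P X (w i) <= e / 2.
  rewrite mulrC -ler_pdivlMr//; apply: le_trans hs _; by rewrite ge_min lexx.
have hCS : (1 + C) * \sum_(i <- s) tailw P X (w i) <= e.
  rewrite mulrC -ler_pdivlMr//; apply: le_trans hs _; by rewrite ge_min lexx orbT.
have h1 := maximal_trunc_signed us hw p0 pS p1 m0 mS m1 e20; rewrite -/C in h1.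
pose B := [set o | exists2 i, i \in s & [set o | 1 < w i * `|Y i o|] o].
have mB : measurable B by apply: measurable_exists_seq => i; exact: measurable_tailw.
have hB : Pr P B <= \sum_(i <- s) tailw P X (w i).
  apply: le_trans (Pr_bigU_le _ _ _) _; first by move=> i; exact: measurable_tailw.
  by rewrite le_eqVlt; apply/orP; left; apply/eqP; apply: eq_bigr => i _; rewrite iid_tailw.
have mA : measurable [set o | exists2 k, (k <= n)%N &
      e / 2 < `|\sum_(i <- s) (rp k i - rm k i) * (clip1 (w i * Y i o) - cmean (w i))|].
  apply: measurable_exists_gt => k; apply: measurableT_comp => //.
  apply: measurable_sum_seq => i _; apply: measurable_funM => //.
  by apply: measurable_funB => //; have [] := bmfun_clip1 (mY i) (w i).
apply: le_trans hCS; rewrite mulrDl mul1r; apply: le_trans (lerD hB h1).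
apply: le_trans (PrU_le _ mB mA); apply: Pr_le.
- apply: measurable_exists_gt => k; apply: measurableT_comp => //.
  by apply: measurable_sum_seq => i _; apply: measurable_funM => //; exact: measurable_funM.
- exact: measurableU.
move=> o [k kn hk]; have [hBo|hBo] := pselect (B o); [by left|right].
exists k => //.
have rp01 i : 0 <= rp k i <= 1.
  apply/andP; split; first by elim: (k) => // j ih; exact: le_trans (pS j i).
  apply: le_trans (p1 i); rewrite -(subnKC kn); elim: (n - k)%N => [|j ih]; rewrite ?addn0// addnS.
  exact: le_trans (pS _ _).
have rm01 i : 0 <= rm k i <= 1.
  apply/andP; split; first by elim: (k) => // j ih; exact: le_trans (mS j i).
  apply: le_trans (m1 i); rewrite -(subnKC kn); elim: (n - k)%N => [|j ih]; rewrite ?addn0// addnS.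
  exact: le_trans (mS _ _).
have eqz : \sum_(i <- s) (rp k i - rm k i) * (w i * Y i o) =
    \sum_(i <- s) (rp k i - rm k i) * (clip1 (w i * Y i o) - cmean (w i)) +
    \sum_(i <- s) (rp k i - rm k i) * cmean (w i).
  rewrite -big_split/=; apply: eq_big_seq => i si; rewrite -mulrDr subrK; congr (_ * _).
  rewrite /clip1; have -> : `|w i * Y i o| <= 1; last by rewrite mulr1.
  have /andP[wi0 _] := hw i; rewrite normrM (ger0_norm wi0) leNgt; apply/negP => hi.
  by apply: hBo; exists i.
have hm : `|\sum_(i <- s) (rp k i - rm k i) * cmean (w i)| <= e / 2.
  apply: le_trans hKS; apply: le_trans (ler_norm_sum _ _ _) _; rewrite mulr_sumr.
  apply: ler_sum => i _; rewrite normrM; have [_ _ _ hc] := hrt _ (hw i).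
  rewrite -[leRHS]mul1r; apply: ler_pM => //.
  have /andP[a1 a2] := rp01 i; have /andP[a3 a4] := rm01 i.
  by rewrite ler_norml; apply/andP; split; lra.
rewrite eqz in hk; move: hk hm; set u := \sum_(i <- s) _ * (_ - _); set v := \sum_(i <- s) _ * cmean _.
have := ler_normD u v; lra.
Qed.

End iid.

(** * Linear processes *)

Section integer_windows.
Variable R : realType.
Implicit Types (c f : int -> R) (s : seq int).

(** The order is that of [psum], and 0 is listed only once, so that [psum] is literally a sum over
    this list. *)
Definition zwin (N : nat) : seq int :=
  [seq Posz k | k <- iota 0 N.+1] ++ [seq - Posz k | k <- iota 1 N].

Lemma mem_zwin N (j : int) : (j \in zwin N) = (absz j <= N)%N.
Proof.
rewrite mem_cat; apply/idP/idP.
  by move=> /orP[] /mapP[k]; rewrite mem_iota => hk ->; lia.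
case: j => k hk.
  by apply/orP; left; apply/mapP; exists k => //; rewrite mem_iota; lia.
apply/orP; right; apply/mapP; exists k.+1; last by rewrite NegzE.
by rewrite mem_iota; lia.
Qed.

Lemma zwin_uniq N : uniq (zwin N).
Proof.
rewrite cat_uniq !map_inj_uniq ?iota_uniq/= ?andbT; last 2 first.
- by move=> x y /oppr_inj [].
- by move=> x y [].
apply/hasPn => _ /mapP[k hk ->]; rewrite -[_ :: _]/[seq Posz k | k <- iota 0 N.+1].
apply/negP => /mapP[l _]; move: hk; rewrite mem_iota; lia.
Qed.

Lemma size_zwin N : size (zwin N) = (N + N).+1.
Proof. by rewrite size_cat !size_map !size_iota addSn. Qed.

Lemma psumE c N : psum c N = \sum_(j <- zwin N) c j.
Proof.
by rewrite /psum /zwin big_cat !big_map /index_iota subSS !subn0.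
Qed.

(** A bound on all finite subsums stays within real numbers and survives restriction and injective
    reindexing, such as the shift j to i - j. *)
Definition finsum_le f (A : R) := forall s, uniq s -> \sum_(j <- s) f j <= A.

(** Take a finite sum within [kap] of the supremum: a family disjoint from it can add at most
    [kap]. *)
Lemma finsum_tail f A (kap : R) : (forall j, 0 <= f j) -> finsum_le f A -> 0 < kap ->
  exists N, forall s, uniq s -> (forall j, j \in s -> (N < absz j)%N) ->
    \sum_(j <- s) f j <= kap.
Proof.
move=> f0 hA k0.
pose E := [set x : R | exists2 s, uniq s & x = \sum_(j <- s) f j].
have hE : has_sup E.
  split; first by exists 0, [::] => //; rewrite big_nil.
  by exists A => _ [s us ->]; exact: hA.
have [_ [s0 us0 ->] hs0] := sup_adherent k0 hE.
exists (\max_(j <- s0) absz j)%N => s us hs.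
have ucat : uniq (s0 ++ s).
  rewrite cat_uniq us0 us andbT; apply/hasPn => j js; apply/negP => js0.
  have h1 : (absz j <= \max_(j <- s0) absz j)%N by exact: leq_bigmax_seq.
  by have := leq_trans (hs j js) h1; rewrite ltnn.
have : \sum_(j <- s0 ++ s) f j <= sup E.
  by apply: ub_le_sup; [case: hE|exists (s0 ++ s)].
rewrite big_cat /=; lra.
Qed.

Lemma esum_finsum f : (forall j, 0 <= f j) ->
  (\esum_(j in [set: int]) (f j)%:E < +oo)%E -> exists2 A, 0 <= A & finsum_le f A.
Proof.
move=> f0 hf.
have e0 : (0 <= \esum_(j in [set: int]) (f j)%:E)%E by apply: esum_ge0 => j _; rewrite lee_fin.
exists (fine (\esum_(j in [set: int]) (f j)%:E)%E); first exact: fine_ge0.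
move=> s us; rewrite -lee_fin fineK ?ge0_fin_numE//.
have -> : ((\sum_(j <- s) f j)%:E = \sum_(j \in [set` s]) (f j)%:E)%E.
  by rewrite -fsbig_seq// sumEFin.
apply: ereal_sup_ubound; exists [set` s] => //; split=> //; exact: finite_seq.
Qed.

End integer_windows.

Section coefficient_sums.
Variable R : realType.
Implicit Types (c : int -> R).

(** The coefficient b_k(j) of Y_j in X_1 + ... + X_k. *)
Definition bsum c (k : nat) (j : int) : R := \sum_(1 <= i < k.+1) c (i%:Z - j).

Lemma bsum0 c j : bsum c 0 j = 0.
Proof. by rewrite /bsum big_geq. Qed.

Lemma bsumS c k j : bsum c k.+1 j = bsum c k j + c (k.+1%:Z - j).
Proof. by rewrite /bsum big_nat_recr. Qed.

Lemma bsum_le_mono c k n j : (forall i, 0 <= c i) -> (k <= n)%N -> bsum c k j <= bsum c n j.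
Proof.
move=> c0 kn; rewrite -(subnKC kn); elim: (n - k)%N => [|m ih]; rewrite ?addn0// addnS bsumS.
by apply: le_trans ih _; rewrite lerDl.
Qed.

Lemma bsum_ge0 c k j : (forall i, 0 <= c i) -> 0 <= bsum c k j.
Proof. by move=> c0; apply: sumr_ge0. Qed.

Lemma bsum_norm c k j : `|bsum c k j| <= bsum (fun i => `|c i|) k j.
Proof. exact: ler_norm_sum. Qed.

Lemma bsum_bound c A k j : finsum_le c A -> bsum c k j <= A.
Proof.
move=> hA; rewrite /bsum -(big_map (fun i => i%:Z - j) predT c); apply: hA.
rewrite map_inj_uniq ?iota_uniq// => x y; lia.
Qed.

Lemma sum_linear c k (s : seq int) (y : int -> R) :
  \sum_(1 <= i < k.+1) \sum_(j <- s) c (i%:Z - j) * y j = \sum_(j <- s) bsum c k j * y j.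
Proof. by rewrite exchange_big/=; apply: eq_bigr => j _; rewrite /bsum mulr_suml. Qed.

End coefficient_sums.

Section tail_scaling.
Context d (T : measurableType d) (R : realType) (P : probability T R) (X : T -> R).
Hypothesis mX : measurable_fun setT X.
Variables (q1 q2 K w0 : R).
Hypothesis rt : regular_tail P X q1 q2 K w0.

Lemma q1_gt0 : 0 < q1.
Proof. by have [[_ + _ _ _] _] := rt; apply: lt_trans; rewrite invr_gt0. Qed.

Lemma tailw_upscale m w : 0 <= w -> 2 ^+ m * w <= w0 ->
  tailw P X (2 ^+ m * w) <= q1 ^- m * tailw P X w.
Proof.
have q10 := q1_gt0.
elim: m w => [|m ih] w wge hw; first by rewrite !expr0 invr1 !mul1r.
have h2 : 0 <= 2 ^+ m.+1 * w <= w0 by rewrite hw mulr_ge0 ?exprn_ge0.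
have [_ hrt] := rt; have [h3 _ _ _] := hrt _ h2.
have e : 2 ^+ m.+1 * w / 2 = 2 ^+ m * w by rewrite exprS; field.
have hm : 2 ^+ m * w <= w0.
  rewrite -e; apply: le_trans hw; rewrite ler_pdivrMr// ler_peMr ?ler1n//.
  by have /andP[] := h2.
rewrite e in h3; have := ih w wge hm => h4.
have -> : q1 ^- m.+1 = q1^-1 * q1 ^- m by rewrite exprS invfM.
by rewrite -mulrA ler_pdivlMl//; exact: le_trans h3 h4.
Qed.

Lemma tailw_downscale m w : 0 <= w <= w0 ->
  tailw P X (w / 2 ^+ m) <= q2 ^+ m * tailw P X w.
Proof.
have [[w00 _ /andP[q20 _] _ _] hrt] := rt.
move=> /andP[wge ww0]; elim: m => [|m ih]; first by rewrite !expr0 divr1 mul1r.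
have -> : w / 2 ^+ m.+1 = w / 2 ^+ m / 2 by rewrite exprS invfM mulrA mulrAC.
have hm : 0 <= w / 2 ^+ m <= w0.
  rewrite divr_ge0 ?exprn_ge0//=; apply: le_trans ww0.
  by rewrite ler_pdivrMr ?exprn_gt0// ler_peMr// exprn_ege1// ler1n.
have [_ h _ _] := hrt _ hm; apply: (le_trans h).
by rewrite exprS -mulrA; exact: ler_wpM2l.
Qed.

Variables (v : nat -> R) (C : R).
Hypothesis v0 : forall n, 0 < v n.
Hypothesis vC : n%:R * tailw P X (v n) @[n --> \oo] --> C.

Lemma near_tailw_v : \forall n \near \oo, n%:R * tailw P X (v n) <= C + 1.
Proof. by move: vC => /cvgr_lt/(_ (C + 1)); rewrite ltrDl ltr01 => /(_ isT); apply: filterS => n /ltW. Qed.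

Lemma v_cvg0 : v n @[n --> \oo] --> (0 : R).
Proof.
have [[_ _ _ _ tpos] _] := rt.
apply/cvgrPdist_lt => e e0; have te := tpos e e0.
near=> n.
have h1 : n%:R * tailw P X (v n) <= C + 1 by near: n; exact: near_tailw_v.
rewrite sub0r normrN gtr0_norm// ltNge; apply/negP => h2.
have h3 : tailw P X e <= tailw P X (v n) by exact: tailw_le.
have h4 : (C + 1) / tailw P X e < n%:R.
  by near: n; apply: nbhs_infty_gtr; exact: num_real.
move: h4; rewrite ltr_pdivrMr// ltNge; case/negP.
by apply: le_trans h1; exact: ler_wpM2l.
Unshelve. all: by end_near. Qed.

Lemma near_v_small (B e : R) : 0 < e -> \forall n \near \oo, B * v n <= e.
Proof.
move=> e0; have : B * v n @[n --> \oo] --> (0 : R) by rewrite -(mulr0 B); apply: cvgMr; exact: v_cvg0.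
by move=> /cvgr_lt/(_ e e0); apply: filterS => n /ltW.
Qed.

Lemma tailw_v_cvg0 (B : R) : 0 <= B -> tailw P X (B * v n) @[n --> \oo] --> (0 : R).
Proof.
move=> B0; have q10 := q1_gt0; have [[w00 _ _ _ _] _] := rt.
have [m hm] : exists m, B <= 2 ^+ m.
  exists (Num.truncn B).+1; apply: (le_trans (ltW (truncnS_gt _))).
  by rewrite -natrX ler_nat ltnW// ltn_expl.
apply/cvgrPdist_le => e e0; near=> n.
rewrite sub0r normrN ger0_norm ?tailw_ge0//.
have h1 : 2 ^+ m * v n <= w0 by near: n; exact: near_v_small.
have h2 : n%:R * tailw P X (v n) <= C + 1 by near: n; exact: near_tailw_v.
have n0 : (0 < n)%N by near: n; exact: nbhs_infty_gt.
have h3 : q1 ^- m * (C + 1) / e <= n%:R by near: n; apply: nbhs_infty_ger; exact: num_real.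
apply: (@le_trans _ _ (tailw P X (2 ^+ m * v n))).
  by apply: tailw_le => //; rewrite ler_pM2r.
apply: (le_trans (tailw_upscale (ltW (v0 n)) h1)).
move: h3; rewrite ler_pdivrMr// => h3.
rewrite -(ler_pM2l (_ : 0 < n%:R)) ?ltr0n// mulrCA.
by apply: le_trans h3; rewrite ler_pM2l ?invr_gt0 ?exprn_gt0.
Unshelve. all: by end_near. Qed.

(* Boundedly many positions are exceptional, and each has a tail tending to [0]; at each of the
   O(n) others, doubling gives a tail of at most [q2 ^+ m * tailw (v n)], which is O(q2 ^ m / n). *)
Lemma near_window_tail (B : R) (dd : nat -> int -> R) (k : nat -> int) :
  0 <= B -> (forall n j, 0 <= dd n j <= B * v n) ->
  (forall eta, 0 < eta -> exists r, forall n j, (r < absz j)%N -> (r < absz (j - k n))%N ->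
      dd n j <= eta * v n) ->
  forall kap, 0 < kap -> \forall n \near \oo,
    \sum_(j <- zwin (2 * n)) tailw P X (dd n j) <= kap.
Proof.
move=> B0 hB hr kap kap0.
have [[w00 _ /andP[q20 q21] _ _] _] := rt.
(* The 5 comes from the 4n + 1 <= 5n positions of the window. The exceptional positions, within [r]
   of 0 or of [k n], number at most 2 (2r + 1) <= 4 (r + 1). *)
have [m hm] : exists m, 5 * (q2 ^+ m * (C + 1)) <= kap / 2.
  have hc : 5 * (q2 ^+ m * (C + 1)) @[m --> \oo] --> (0 : R).
    rewrite -(mulr0 5) -(mul0r (C + 1)); apply: cvgMr; apply: cvgMl; apply: cvg_expr.
    by rewrite ger0_norm.
  have k20 : 0 < kap / 2 by rewrite divr_gt0.
  by move: hc => /cvgr_lt/(_ _ k20) /filter_ex[m /ltW hm]; exists m.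
have [r hrr] := hr (2 ^+ m)^-1 ltac:(by rewrite invr_gt0 exprn_gt0).
have hsmall := tailw_v_cvg0 B0.
have hp : 0 < kap / 2 / (4 * r.+1%:R) by rewrite !divr_gt0// mulr_gt0.
near=> n.
have h1 : tailw P X (B * v n) <= kap / 2 / (4 * r.+1%:R).
  by apply: ltW; near: n; move: hsmall => /cvgr_lt/(_ _ hp).
have h2 : n%:R * tailw P X (v n) <= C + 1 by near: n; exact: near_tailw_v.
have h3 : 1 * v n <= w0 by near: n; exact: near_v_small.
rewrite mul1r in h3.
have n0 : (0 < n)%N by near: n; exact: nbhs_infty_gt.
pose ex (j : int) := (absz j <= r)%N || (absz (j - k n) <= r)%N.
rewrite (bigID ex)/= [leRHS]splitr; apply: lerD.
  rewrite -big_filter; set s := [seq i <- zwin (2 * n) | ex i].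
  have us : uniq s by rewrite filter_uniq// zwin_uniq.
  have ss : (size s <= 4 * r.+1)%N.
    have -> : (4 * r.+1)%N = ((r + r).+1 + (r + r).+1).+2%N by clear; lia.
    do 2 apply: leqW; rewrite -!size_zwin -{2}(size_map (fun j => j + k n) (zwin r)) -size_cat.
    apply: uniq_leq_size => // j; rewrite mem_filter => /andP[/orP[h|h] _]; rewrite mem_cat.
      by rewrite mem_zwin h.
    by apply/orP; right; apply/mapP; exists (j - k n); rewrite ?subrK// mem_zwin.
  apply: (@le_trans _ _ (\sum_(j <- s) kap / 2 / (4 * r.+1%:R))).
    apply: ler_sum => j _; apply: le_trans h1; apply: tailw_le => //.
    by have /andP[] := hB n j.
  rewrite big_const_seq count_predT iter_addr_0 -[X in X <= _]mulr_natr.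
  have r40 : 0 < 4 * r.+1%:R :> R by rewrite mulr_gt0.
  rewrite mulrAC ler_pdivrMr// ler_wpM2l ?divr_ge0 ?(ltW kap0)//.
  by rewrite -natrM ler_nat.
apply: (@le_trans _ _ (\sum_(j <- zwin (2 * n) | ~~ ex j) tailw P X (v n / 2 ^+ m))).
  apply: ler_sum => j; rewrite negb_or -!ltnNge => /andP[j1 j2]; apply: tailw_le => //.
  by rewrite mulrC; exact: hrr.
apply: (@le_trans _ _ (\sum_(j <- zwin (2 * n)) tailw P X (v n / 2 ^+ m))).
  rewrite [leRHS](bigID (fun j => ~~ ex j))/= lerDl; apply: sumr_ge0 => j _; exact: tailw_ge0.
rewrite big_const_seq count_predT iter_addr_0 size_zwin -[X in X <= _]mulr_natr.
have hd := @tailw_downscale m (v n) ltac:(by rewrite (ltW (v0 n))).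
apply: le_trans hm; apply: (@le_trans _ _ (q2 ^+ m * tailw P X (v n) * (5 * n%:R))).
  apply: ler_pM => //; first exact: tailw_ge0.
  by rewrite -natrM ler_nat; move: n0; clear; lia.
rewrite [leRHS]mulrCA -[leLHS]mulrA ler_wpM2l ?exprn_ge0// mulrCA ler_pM2l//.
by rewrite mulrC.
Unshelve. all: by end_near. Qed.

End tail_scaling.

Lemma sum_geometric_le (R : realFieldType) (e : R) n : 0 <= e ->
  \sum_(l < n) e / 2 ^+ l.+1 <= e.
Proof.
move=> e0; have -> : \sum_(l < n) e / 2 ^+ l.+1 = e - e / 2 ^+ n.
  elim: n => [|n ih]; first by rewrite big_ord0 expr0 divr1 subrr.
  rewrite big_ord_recr/= ih exprS; have := exprn_gt0 n (ltr0n R 2 : 0 < 2).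
  by move: (2 ^+ n) => x x0; field; rewrite gt_eqF.
by rewrite gerBl divr_ge0 ?exprn_ge0.
Qed.

Section measurable_limits.
Context d (T : measurableType d) (R : realType) (P : probability T R).

(** A Cauchy criterion with countable quantifiers only, so that the set of convergence of measurable
    functions is visibly measurable. *)
Lemma cauchy_inv_succP (u : nat -> R) : cvgn u <->
  forall k, exists n, forall m, `|u (n + m)%N - u n| <= k.+1%:R^-1.
Proof.
split=> [/cvg_ex[l hl] k|h].
  have k0 : 0 < k.+1%:R^-1 / 2 :> R by rewrite divr_gt0// invr_gt0 ltr0n.
  move/cvgrPdist_le : hl => /(_ _ k0) [n _ hn]; exists n => m.
  have h1 := hn n (leqnn n); have h2 := hn (n + m)%N (leq_addr _ _); rewrite /= in h1 h2.
  rewrite (_ : u (n + m)%N - u n = (l - u n) - (l - u (n + m)%N)); last by ring.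
  by apply: (le_trans (ler_normB _ _)); rewrite [leRHS]splitr lerD.
apply: cvg_of_cauchy_ex => e e0.
have [k hk] : exists k : nat, k.+1%:R^-1 < e.
  by have /filter_ex[k hk] := near_infty_natSinv_lt (PosNum e0); exists k.
have [n hn] := h k; exists (u n); exists n => // m /= nm.
rewrite /ball/= distrC -(subnKC nm); exact: le_lt_trans (hn _) hk.
Qed.

Lemma measurable_limn (u : nat -> T -> R) : (forall n, measurable_fun setT (u n)) ->
  measurable_fun setT (fun w => limn (u^~ w)).
Proof.
move=> mu; pose D := [set w | cvgn (u^~ w)].
have mD : measurable D.
  rewrite (_ : D = \bigcap_k \bigcup_n \bigcap_m
      [set w | `|u (n + m)%N w - u n w| <= k.+1%:R^-1]).
    apply: bigcap_measurable; first by exists 0%N.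
    move=> k _; apply: bigcup_measurable => n _; apply: bigcap_measurable; first by exists 0%N.
    move=> m _; apply: measurable_set_le; apply: measurableT_comp => //.
    exact: measurable_funB.
  apply/seteqP; split=> w.
    by move=> /cauchy_inv_succP h k _; have [n hn] := h k; exists n => // m _; exact: hn.
  move=> h; apply/cauchy_inv_succP => k; have [n _ hn] := h k I.
  by exists n => m; exact: hn.
(* Off the set of convergence [limn] takes this default value, so the approximants are set to it
   there. *)
pose z : R := point.
apply: (@measurable_fun_cvg _ _ _ setT (fun n w => u n w * \1_D w + z * \1_(~` D) w)).
  move=> n; apply: measurable_funD; apply: measurable_funM => //.
  by apply: measurable_indic; exact: measurableC.
move=> w _; rewrite !indicE in_setC.
case: (boolP (w \in D)); rewrite ?inE ?notin_setE => hw /=.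
  under eq_fun do rewrite mulr1 mulr0 addr0; exact: hw.
under eq_fun do rewrite mulr0 mulr1 add0r.
by rewrite dvgP//; exact: cvg_cst.
Qed.

Lemma Pr_bigcup_le (A : nat -> set T) (e : R) : (forall n, measurable (A n)) ->
  (forall m n, (m <= n)%N -> A m `<=` A n) -> (forall n, Pr P (A n) <= e) ->
  Pr P (\bigcup_n A n) <= e.
Proof.
move=> mA hA he.
have mU : measurable (\bigcup_n A n) by exact: bigcup_measurable.
have hc := nondecreasing_cvg_mu (mu := P) mA mU (fun m n h => introT (subsetPset _ _) (hA m n h)).
rewrite -lee_fin -PrK//; apply: (cvge_to_le hc); apply: nearW => n /=.
by rewrite PrK// lee_fin.
Qed.

Lemma Pr_bigcup_geometric (A : nat -> set T) (e : R) : (forall n, measurable (A n)) ->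
  0 <= e -> (forall n, Pr P (A n) <= e / 2 ^+ n.+1) -> Pr P (\bigcup_n A n) <= e.
Proof.
move=> mA e0 he.
pose B n := [set w | exists2 i, i \in iota 0 n & A i w].
have -> : \bigcup_n A n = \bigcup_n B n.
  apply/seteqP; split=> w [n _]; first by exists n.+1 => //; exists n => //; rewrite mem_iota; lia.
  by move=> [i _ hi]; exists i.
apply: Pr_bigcup_le => [n|m n mn w [i hi hA]|n].
- exact: measurable_exists_seq.
- by exists i => //; move: hi; rewrite !mem_iota; lia.
apply: (le_trans (Pr_bigU_le _ _ mA)).
apply: (@le_trans _ _ (\sum_(i <- iota 0 n) e / 2 ^+ i.+1)).
  by apply: ler_sum => i _; exact: he.
by rewrite -[n in iota 0 n]subn0 -/(index_iota 0 n) big_mkord sum_geometric_le.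
Qed.

End measurable_limits.

Section linear_process.
Context d (T : measurableType d) (R : realType) (P : probability T R).
Variables (Y : int -> T -> R) (X : T -> R).
Hypotheses (mY : forall j, measurable_fun setT (Y j)) (iY : mutual_indep P Y).
Hypotheses (mX : measurable_fun setT X) (dY : forall j, eq_dist P P (Y j) X).
Variables (q1 q2 K w0 : R).
Hypothesis rt : regular_tail P X q1 q2 K w0.

Lemma measurable_linproc (c : int -> R) i : measurable_fun setT (linproc c Y i).
Proof.
apply: (@measurable_limn _ _ _ (fun N w => psum (fun j => c (i - j) * Y j w) N)) => N.
under eq_fun do rewrite psumE.
by apply: measurable_sum_seq => j _; exact: measurable_funM.
Qed.

Variables (c : int -> R) (A B : R).
Hypotheses (cA : finsum_le (fun j => `|c j|) A).
Hypotheses (cB : finsum_le (fun j => tailw P X `|c j|) B).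

(** One exceptional set serves all [M >= N] at once: it is the increasing union over [n] of the
    events that the maximal inequality bounds for [M <= N + n]. *)
Lemma linproc_tail_window i (e : R) : 0 < e -> exists N0, forall N, (N0 <= N)%N ->
  exists2 D, measurable D /\ Pr P D <= e & forall w, ~ D w -> forall M, (N <= M)%N ->
    `|psum (fun j => c (i - j) * Y j w) M - psum (fun j => c (i - j) * Y j w) N| <= e.
Proof.
move=> e0; have [kap kap0 hms] := maximal_small mY iY mX dY rt e0.
have [[w00 _ _ _ _] _] := rt.
have [N1 hN1] := finsum_tail (fun j => normr_ge0 (c j)) cA w00.
have [N2 hN2] := finsum_tail (fun j => tailw_ge0 P X `|c j|) cB kap0.
exists (maxn N1 N2 + absz i)%N => N hN.
pose w (j : int) := if (N < absz j)%N then `|c (i - j)| else 0.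
(* The windows growing with [k] are encoded as monotone 0-1 weights, split by the sign of the
   coefficient; the weighted sum at [k] is then the difference of the partial sums at [N + k] and
   [N]. *)
pose rp k (j : int) : R := ((0 <= c (i - j)) && (absz j <= N + k)%N)%:R.
pose rm k (j : int) : R := ((c (i - j) < 0) && (absz j <= N + k)%N)%:R.
have rpS k j : rp k j <= rp k.+1 j.
  by rewrite /rp ler_nat; case: (0 <= _) => //=; case h: (absz j <= N + k)%N => //; rewrite (_ : (absz j <= N + k.+1)%N = true)//; move: h; clear; lia.
have rmS k j : rm k j <= rm k.+1 j.
  by rewrite /rm ler_nat; case: (_ < 0) => //=; case h: (absz j <= N + k)%N => //; rewrite (_ : (absz j <= N + k.+1)%N = true)//; move: h; clear; lia.
pose F n := [set o | exists2 k, (k <= n)%N &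
      e < `|\sum_(j <- zwin (N + n)) (rp k j - rm k j) * (w j * Y j o)|].
have FE n o k : (k <= n)%N -> \sum_(j <- zwin (N + n)) (rp k j - rm k j) * (w j * Y j o) =
    psum (fun j => c (i - j) * Y j o) (N + k) - psum (fun j => c (i - j) * Y j o) N.
  move=> kn; rewrite !psumE.
  have hw (M : nat) : (M <= N + n)%N -> \sum_(j <- zwin M) c (i - j) * Y j o =
      \sum_(j <- zwin (N + n)) (absz j <= M)%N%:R * (c (i - j) * Y j o).
    move=> hM; rewrite [RHS](bigID (fun j : int => absz j <= M)%N)/= [X in _ + X]big1 ?addr0; last first.
      by move=> j /negbTE ->; rewrite mul0r.
    under [RHS]eq_bigr => j hj do rewrite hj mul1r.
    rewrite -[RHS]big_filter; apply: perm_big; apply: uniq_perm.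
    - exact: zwin_uniq.
    - by rewrite filter_uniq// zwin_uniq.
    by move=> j; rewrite mem_filter !mem_zwin; case: leqP => //=; move: hM; clear; lia.
  rewrite hw ?leq_add2l// [X in _ - X]hw ?leq_addr// -sumrB; apply: eq_bigr => j _.
  rewrite -mulrBl /rp /rm /w.
  have [jN|jN] := leqP (absz j) N.
    by rewrite (leq_trans jN (leq_addr _ _)) subrr !mul0r mulr0.
  by have [c0|c0] := leP 0 (c (i - j)) => /=; rewrite ?(ger0_norm c0) ?(ltr0_norm c0);
    case: (absz j <= _)%N => //=; ring.
have mF n : measurable (F n).
  apply: measurable_exists_gt => k; apply: measurableT_comp => //.
  by apply: measurable_sum_seq => j _; do 2 apply: measurable_funM => //.
have wN j : (N < absz j)%N -> (maxn N1 N2 < absz (i - j))%N by move: hN; clear; lia.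
exists (\bigcup_n F n); last first.
  move=> o ho M NM; rewrite leNgt; apply/negP => hM; apply: ho; exists (M - N)%N => //.
  by exists (M - N)%N => //; rewrite FE// subnKC.
split; first exact: bigcup_measurable.
apply: Pr_bigcup_le => [//|m n mn o [k km hk]|n].
  exists k; first exact: leq_trans mn.
  by rewrite FE ?(leq_trans km)//; rewrite FE in hk.
apply: hms => //.
- exact: zwin_uniq.
- move=> j; rewrite /w; case: ifP => [hj|_]; last by rewrite lexx ltW.
  rewrite normr_ge0/=; have := hN1 [:: i - j] isT; rewrite big_seq1; apply.
  by move=> _ /[!inE] /eqP ->; have := wN _ hj; clear; lia.
- by move=> j; rewrite /rp; case: (_ && _).
- by move=> j; rewrite /rm; case: (_ && _).
rewrite (bigID (fun j : int => N < absz j)%N)/= [X in _ + X]big1 ?addr0; last first.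
  by move=> j /negbTE hj; rewrite /w hj tailw0.
under eq_bigr => j hj do rewrite /w hj.
rewrite -big_filter -(big_map (fun j => i - j) predT (fun j => tailw P X `|c j|)).
apply: hN2.
  by rewrite map_inj_uniq ?filter_uniq ?zwin_uniq// => x y /addrI/oppr_inj.
move=> _ /mapP[j + ->]; rewrite mem_filter => /andP[hj _].
by have := wN _ hj; clear; lia.
Qed.

(** [linproc] is a [limn], meaningful only where the partial sums converge. Errors and probabilities
    e / 2^(l+1) at level l sum to at most e, and off the union of the exceptional sets the partial
    sums are Cauchy. *)
Lemma linproc_window i (e : R) : 0 < e -> exists N0, forall N, (N0 <= N)%N ->
  exists2 D, measurable D /\ Pr P D <= e & forall w, ~ D w ->
    `|linproc c Y i w - psum (fun j => c (i - j) * Y j w) N| <= e.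
Proof.
move=> e0.
have el0 l : 0 < e / 2 ^+ l.+1 by rewrite divr_gt0 ?exprn_gt0.
have [M hM] := choice (fun l => linproc_tail_window i (el0 l)).
exists (M 0%N) => N MN.
have hM' l : exists D, (measurable D /\ Pr P D <= e / 2 ^+ l.+1) /\ forall w, ~ D w ->
    forall M', (maxn N (M l) <= M')%N -> `|psum (fun j => c (i - j) * Y j w) M'
      - psum (fun j => c (i - j) * Y j w) (maxn N (M l))| <= e / 2 ^+ l.+1.
  by have [D h1 h2] := hM l _ (leq_maxr N (M l)); exists D.
have [D hD] := choice hM'.
exists (\bigcup_l D l).
  split; first by apply: bigcup_measurable => l _; case: (hD l) => -[].
  by apply: Pr_bigcup_geometric; [move=> l; case: (hD l) => -[]|exact: ltW|move=> l; case: (hD l) => -[]].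
move=> o ho.
have hDl l : ~ D l o by move=> h; apply: ho; exists l.
pose u N := psum (fun j => c (i - j) * Y j o) N.
have hu l M' : (maxn N (M l) <= M')%N -> `|u M' - u (maxn N (M l))| <= e / 2 ^+ l.+1.
  by have [_ h] := hD l; exact: (h o (hDl l)).
have cu : cvgn u.
  apply: cvg_of_cauchy_ex => eta eta0.
  have h0 : e / 2 ^+ l.+1 @[l --> \oo] --> (0 : R).
    rewrite -(mulr0 e); apply: cvgMr; under eq_fun do rewrite -exprVn.
    have h2 : `|2^-1 : R| < 1 by rewrite ger0_norm// invf_lt1// ltr1n.
    by have := cvg_expr h2; rewrite -cvg_shiftS.
  move: h0 => /cvgr_lt/(_ eta eta0)/filter_ex[l hl].
  exists (u (maxn N (M l))); exists (maxn N (M l)) => // m /= hm.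
  by rewrite /ball/= distrC; apply: le_lt_trans hl; exact: hu.
have -> : linproc c Y i o = limn u by [].
have /maxn_idPl e1 := MN.
have h0 : `|limn u - u N| <= e / 2 ^+ 1.
  have hc : `|u m - u N| @[m --> \oo] --> `|limn u - u N|.
    by apply: cvg_norm; apply: cvgB => //; exact: cvg_cst.
  apply: (cvgr_to_le hc); exists N => // m /= Nm.
  by have := hu 0%N m; rewrite e1; apply.
by apply: (le_trans h0); rewrite expr1 ler_pdivrMr// ler_peMr ?ler1n// ltW.
Qed.

Lemma linproc_sum_window (v : R) n (e : R) : 0 < e -> exists N0, forall N, (N0 <= N)%N ->
  exists2 D, measurable D /\ Pr P D <= e & forall w, ~ D w -> forall k, (k <= n)%N ->
    `|v * \sum_(1 <= i < k.+1) linproc c Y i%:Z w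
      - \sum_(j <- zwin N) (v * bsum c k j) * Y j w| <= e.
Proof.
(* Both the at most [n] errors, multiplied by [|v|], and the [n] exceptional probabilities have to
   sum to at most [e]. *)
move=> e0; pose m : R := n.+1%:R * (1 + `|v|).
have v1 : 1 <= 1 + `|v| by rewrite lerDl.
have m1 : n.+1%:R <= m by rewrite ler_peMr.
have m0 : 0 < m by apply: lt_le_trans m1; rewrite ltr0n.
have em0 : 0 < e / m by rewrite divr_gt0.
have [N0 hN0] := choice (fun i : nat => linproc_window i%:Z em0).
exists (\max_(i < n.+1) N0 i)%N => N hN.
have hN1 i : exists D, (i <= n)%N -> [/\ measurable D, Pr P D <= e / m &
    forall w, ~ D w -> `|linproc c Y i%:Z w - psum (fun j => c (i%:Z - j) * Y j w) N| <= e / m].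
  have [hi|//] := leqP i n; last by exists set0.
  have h : (N0 i <= N)%N by apply: leq_trans hN; exact: (leq_bigmax (Ordinal (hi : (i < n.+1)%N))).
  by have [D [mD PD] hD] := hN0 i N h; exists D.
have [D hD] := choice hN1.
pose D' i := if (i <= n)%N then D i else set0.
have mD' i : measurable (D' i) by rewrite /D'; case: ifP => // /hD[].
exists [set w | exists2 i, i \in iota 1 n & D' i w].
  split; first exact: measurable_exists_seq.
  apply: (le_trans (Pr_bigU_le _ _ mD')).
  apply: (@le_trans _ _ (\sum_(i <- iota 1 n) e / m)).
    apply: ler_sum => i _; rewrite /D'; case: ifP => [/hD[]//|_].
    by rewrite Pr_set0 ltW.
  rewrite big_const_seq count_predT iter_addr_0 size_iota -[X in X <= _]mulr_natr.
  rewrite mulrAC ler_pdivrMr// ler_pM2l//; apply: le_trans m1.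
  by rewrite ler_nat.
move=> o ho k kn.
under [X in _ - X]eq_bigr => j _ do rewrite -mulrA.
rewrite -mulr_sumr -sum_linear -mulrBr -sumrB normrM.
apply: (@le_trans _ _ (`|v| * (n%:R * (e / m)))).
  apply: ler_wpM2l => //; apply: (le_trans (ler_norm_sum _ _ _)).
  apply: (@le_trans _ _ (\sum_(1 <= i < k.+1) e / m)).
    apply: ler_sum_nat => i /andP[i1 ik]; have hi : (i <= n)%N by apply: leq_trans kn.
    have [_ _ h] := hD i hi; rewrite -psumE; apply: h => hDo; apply: ho; exists i.
      by rewrite mem_iota i1 add1n ltnS.
    by rewrite /D' hi.
  rewrite big_const_nat iter_addr_0 subSS subn0 -[X in X <= _]mulr_natr mulrC ler_wpM2r ?(ltW em0)//.
  by rewrite ler_nat.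
rewrite !mulrA ler_pdivrMr// [leRHS]mulrC ler_pM2r// /m mulrC ler_pM//.
  by rewrite ler_nat.
by rewrite lerDr.
Qed.

End linear_process.

Section summable_coefficients.
Variable R : realType.
Variables (c : int -> R) (A : R).
Hypothesis cA : finsum_le (fun j => `|c j|) A.

Lemma sum_subseqB (f : int -> R) (s s' : seq int) : uniq s -> uniq s' -> {subset s <= s'} ->
  \sum_(j <- s') f j - \sum_(j <- s) f j = \sum_(j <- [seq j <- s' | j \notin s]) f j.
Proof.
move=> us us' ss; rewrite (bigID (fun j => j \in s))/= -[X in X + _ - _]big_filter.
suff -> : \sum_(j <- [seq i <- s' | i \in s]) f j = \sum_(j <- s) f j by rewrite addrAC subrr add0r big_filter.
apply: perm_big; apply: uniq_perm => //; first by rewrite filter_uniq.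
by move=> j; rewrite mem_filter; case: (boolP (j \in s)) => //= /ss ->.
Qed.

Lemma psum_cvg : psum c @ \oo --> zsum c.
Proof.
apply: cvg_of_cauchy_ex => e e0; have e20 : 0 < e / 2 by rewrite divr_gt0.
have [N hN] := finsum_tail (fun j => normr_ge0 (c j)) cA e20.
exists (psum c N); exists N => // m /= Nm.
rewrite /ball/= distrC !psumE sum_subseqB ?zwin_uniq//; last first.
  by move=> j; rewrite !mem_zwin => h; exact: leq_trans Nm.
apply: le_lt_trans (_ : e / 2 < e); last by rewrite ltr_pdivrMr// ltr_pMr// ltr1n.
apply: (le_trans (ler_norm_sum _ _ _)); apply: hN.
  by rewrite filter_uniq// zwin_uniq.
by move=> j; rewrite mem_filter mem_zwin -ltnNge => /andP[].
Qed.

(** The indices i - j fill the integer interval from 1 - j to k - j. With both ends further than [r]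
    from 0, it either contains [-r, r], so that only a tail of the full sum is missing, or misses it
    and is itself part of a tail. *)
Lemma bsum_window (e : R) : 0 < e -> exists r : nat, forall (k : nat) (j : int),
  (r < absz j)%N -> (r < absz (j - k%:Z))%N ->
  `|bsum c k j - (1 <= j <= k%:Z)%R%:R * zsum c| <= e.
Proof.
move=> e0; have [r hr] := finsum_tail (fun j => normr_ge0 (c j)) cA e0.
exists r => k j hj hk.
pose s := [seq i%:Z - j | i <- iota 1 k].
have us : uniq s by rewrite map_inj_uniq ?iota_uniq// => x y; lia.
have bE : bsum c k j = \sum_(l <- s) c l by rewrite /bsum big_map /index_iota subSS subn0.
have [jk|jk] := boolP (1 <= j <= k%:Z); last first.
  rewrite mul0r subr0 bE; apply: (le_trans (ler_norm_sum _ _ _)); apply: hr => // l.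
  by move=> /mapP[i]; rewrite mem_iota => hi ->; move: hi jk hj hk; clear; lia.
rewrite mul1r distrC bE.
have hc : `|psum c N - \sum_(l <- s) c l| @[N --> \oo] --> `|zsum c - \sum_(l <- s) c l|.
  by apply: cvg_norm; apply: cvgB; [exact: psum_cvg|exact: cvg_cst].
apply: (cvgr_to_le hc); exists (k + absz j)%N => // N /= hN.
rewrite psumE sum_subseqB ?zwin_uniq//; last first.
  by move=> l /mapP[i]; rewrite mem_iota mem_zwin => hi ->; move: hi hN; clear; lia.
apply: (le_trans (ler_norm_sum _ _ _)); apply: hr; first by rewrite filter_uniq// zwin_uniq.
move=> l; rewrite mem_filter => /andP[+ _]; rewrite ltnNge; apply: contraNN => hl.
apply/mapP; exists (absz (l + j)); last by move: hl jk hj hk; clear; lia.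
by rewrite mem_iota; move: hl jk hj hk; clear; lia.
Qed.

End summable_coefficients.

Lemma zsum_norm_le (R : realType) (c : int -> R) A : finsum_le (fun j => `|c j|) A ->
  `|zsum c| <= zsum (fun j => `|c j|) <= A.
Proof.
move=> cA; have cA' : finsum_le (fun j => `| `|c j| |) A.
  by move=> s us; under eq_bigr do rewrite normr_id; exact: cA.
have h2 := psum_cvg cA'; apply/andP; split.
  apply: (ler_cvg_to (cvg_norm (psum_cvg cA)) h2); apply: nearW => N.
  by rewrite !psumE; exact: ler_norm_sum.
by apply: (cvgr_to_le h2); apply: nearW => N; rewrite psumE; apply: cA; exact: zwin_uniq.
Qed.

(** A substitute for logarithms that also allows vanishing factors: a product bounded away from 0
    bounds the sum of the defects, and a product near 1 makes it small. *)
Lemma prod_one_sum_le (R : realDomainType) (I : eqType) (s : seq I) (p x : I -> R) :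
  (forall i, i \in s -> [/\ 0 <= p i, 0 <= x i & x i <= 1 - p i]) ->
  (\prod_(i <- s) p i) * (1 + \sum_(i <- s) x i) <= 1.
Proof.
elim: s => [_|i s ih h]; first by rewrite !big_nil addr0 mulr1.
rewrite !big_cons; have [p0 x0 hx] := h i (mem_head _ _).
have hs j : j \in s -> [/\ 0 <= p j, 0 <= x j & x j <= 1 - p j].
  by move=> js; apply: h; rewrite inE js orbT.
have := ih hs; have : 0 <= \sum_(j <- s) x j by rewrite big_seq; apply: sumr_ge0 => j /hs[].
have : 0 <= \prod_(j <- s) p j by rewrite big_seq; apply: prodr_ge0 => j /hs[].
move: (\prod_(j <- s) p j) (\sum_(j <- s) x j) => q S q0 S0 hq.
have S1 : 0 <= 1 + (x i + S) by rewrite !addr_ge0.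
have h1 : p i * q * (1 + (x i + S)) <= (1 - x i) * q * (1 + (x i + S)).
  by apply: ler_wpM2r => //; apply: ler_wpM2r => //; rewrite lerBrDl -lerBrDr.
apply: (le_trans h1); have : 0 <= x i * q * (S + x i) by rewrite !mulr_ge0// addr_ge0.
by move: hq; clear -R; nra.
Qed.

Section characteristic_functions.
Context d (T : measurableType d) (R : realType) (P : probability T R).

Lemma cos_lipschitz (x y : R) : `|cos x - cos y| <= `|x - y|.
Proof.
wlog xy : x y / y <= x => [h|].
  by have [|/ltW] := leP y x; [exact: h|move=> /h; rewrite distrC (distrC y)].
have [|z _ ->] := @MVT_segment R cos (fun z => - sin z) _ _ xy (fun z _ => is_derive_cos z).
  by apply: continuous_subspaceT => z; exact: continuous_cos.
by rewrite normrM ler_piMl// normrN; exact: sin_norm_le1.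
Qed.

Lemma sin_lipschitz (x y : R) : `|sin x - sin y| <= `|x - y|.
Proof.
wlog xy : x y / y <= x => [h|].
  by have [|/ltW] := leP y x; [exact: h|move=> /h; rewrite distrC (distrC y)].
have [|z _ ->] := @MVT_segment R sin cos _ _ xy (fun z _ => is_derive_sin z).
  by apply: continuous_subspaceT => z; exact: continuous_sin.
by rewrite normrM ler_piMl// cos_norm_le1.
Qed.

Lemma bmfun_cos (X : T -> R) : measurable_fun setT X -> bmfun (fun w => cos (X w)).
Proof. by move=> mX; apply: (bmfun_comp (M := 1) (@measurable_cos R)) => // x; exact: cos_norm_le1. Qed.

Lemma bmfun_sin (X : T -> R) : measurable_fun setT X -> bmfun (fun w => sin (X w)).
Proof. by move=> mX; apply: (bmfun_comp (M := 1) (@measurable_sin R)) => // x; exact: sin_norm_le1. Qed.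

Lemma charf2_ge0 (X : T -> R) : 0 <= charf2 P X.
Proof. by rewrite addr_ge0 ?sqr_ge0. Qed.

(** Each expectation moves by at most e + 2 e = 3 e, its square by at most twice as much, and there
    are two squares: 12 = 2 * 2 * 3. *)
Lemma charf2_close (X X' : T -> R) D (e : R) : measurable_fun setT X -> measurable_fun setT X' ->
  measurable D -> Pr P D <= e -> (forall w, ~ D w -> `|X w - X' w| <= e) ->
  `|charf2 P X - charf2 P X'| <= 12 * e.
Proof.
move=> mX mX' mD hD hX.
have e0 : 0 <= e by apply: le_trans hD; exact: Pr_ge0.
have hg (g : R -> R) : measurable_fun setT g -> (forall x, `|g x| <= 1) ->
    (forall x y, `|g x - g y| <= `|x - y|) ->
    `|Ex P (fun w => g (X w)) ^+ 2 - Ex P (fun w => g (X' w)) ^+ 2| <= 6 * e.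
  move=> mg g1 gl.
  have bX : bmfun (fun w => g (X w)) by exact: (bmfun_comp mg g1).
  have bX' : bmfun (fun w => g (X' w)) by exact: (bmfun_comp mg g1).
  have b1 (f : T -> R) : bmfun f -> (forall w, `|f w| <= 1) -> `|Ex P f| <= 1.
    move=> bf hf; apply: (le_trans (Ex_norm P bf)); rewrite -[leRHS](Ex_cst P 1).
    by apply: Ex_le => //; [exact: bmfun_norm|exact: bmfun_cst].
  have h1 := @Ex_close _ _ _ P _ _ (~` D) e 1 bX bX' (measurableC mD) (fun w => g1 _)
    (fun w => g1 _) e0 (fun w hw => le_trans (gl _ _) (hX w hw)).
  rewrite setCK mulr1 in h1.
  have h2 := b1 _ bX (fun w => g1 _); have h3 := b1 _ bX' (fun w => g1 _).
  rewrite subr_sqr normrM (_ : 6 * e = (e + 2 * e) * 2); last by ring.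
  apply: ler_pM => //; last by apply: (le_trans (ler_normD _ _)); exact: lerD.
  by apply: (le_trans h1); rewrite lerD2l ler_pM2l.
rewrite /charf2 (_ : _ - _ = (Ex P (fun w => cos (X w)) ^+ 2 - Ex P (fun w => cos (X' w)) ^+ 2) +
  (Ex P (fun w => sin (X w)) ^+ 2 - Ex P (fun w => sin (X' w)) ^+ 2)); last by ring.
apply: (le_trans (ler_normD _ _)); rewrite (_ : 12 * e = 6 * e + 6 * e); last by ring.
apply: lerD; apply: hg.
- exact: measurable_cos.
- exact: cos_norm_le1.
- exact: cos_lipschitz.
- exact: measurable_sin.
- exact: sin_norm_le1.
- exact: sin_lipschitz.
Qed.

End characteristic_functions.

Lemma charf2_cvg d (T : measurableType d) d' (T' : measurableType d') (R : realType)
  (P : probability T R) (Q : probability T' R) (Xn : nat -> T -> R) (X : T' -> R) (u : R) :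
  (forall n, measurable_fun setT (Xn n)) -> measurable_fun setT X -> cvg_dist P Q Xn X ->
  charf2 P (fun w => u * Xn n w) @[n --> \oo] --> charf2 Q (fun w => u * X w).
Proof.
move=> mXn mX hd.
have mu (S : Type) (f : S -> R) : S -> R by exact: (fun w => u * f w).
have cu : continuous (fun x : R => u * x) by move=> x; exact: mulrl_continuous.
have hE (g : R -> R) : continuous g -> (forall x, `|g x| <= 1) -> measurable_fun setT g ->
    Ex P (fun w => g (u * Xn n w)) @[n --> \oo] --> Ex Q (fun w => g (u * X w)).
  move=> cg g1 mg; have hg : continuous (fun x => g (u * x)).
    by move=> x; apply: continuous_comp; [exact: cu|exact: cg].
  have hb : exists M, forall x, `|g (u * x)| <= M by exists 1 => x; exact: g1.
  have := hd _ hg hb.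
  have b1 n : bmfun (fun w => g (u * Xn n w)).
    by apply: (bmfun_comp (M := 1) mg) => //; exact: measurable_funM.
  have b2 : bmfun (fun w => g (u * X w)).
    by apply: (bmfun_comp (M := 1) mg) => //; exact: measurable_funM.
  under eq_fun do rewrite (expectationE _ (b1 _)).
  by rewrite expectationE// => /fine_cvgP[].
have h1 := hE cos (@continuous_cos R) (@cos_norm_le1 R) (@measurable_cos R).
have h2 := hE sin (@continuous_sin R) (@sin_norm_le1 R) (@measurable_sin R).
by apply: cvgD; apply: cvgM.
Qed.

(** * Tail sums of the coefficients *)

Section window_interval.
Variable R : realType.

Lemma sum_zwin_interval (k N : nat) (f : int -> R) : (k <= N)%N ->
  \sum_(j <- zwin N) (1 <= j <= k%:Z)%R%:R * f j = \sum_(1 <= i < k.+1) f i%:Z.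
Proof.
move=> kN; rewrite (bigID (fun j : int => 1 <= j <= k%:Z))/= [X in _ + X]big1 ?addr0; last first.
  by move=> j /negbTE ->; rewrite mul0r.
under eq_bigr => j hj do rewrite hj mul1r.
rewrite -big_filter /index_iota subSS subn0 -(big_map Posz predT f).
apply: perm_big; apply: uniq_perm; first by rewrite filter_uniq// zwin_uniq.
  by rewrite map_inj_uniq ?iota_uniq// => x y [].
move=> j; rewrite mem_filter mem_zwin; apply/idP/mapP.
  by move=> h; exists (absz j); rewrite ?mem_iota; move: h kN; clear; lia.
by move=> [i]; rewrite mem_iota => + ->; move: kN; clear; lia.
Qed.

End window_interval.

Section characteristic_bounds.
Context d (T : measurableType d) (R : realType) (P : probability T R).

Lemma Ex_sqr_ge (f : T -> R) : bmfun f -> Ex P f ^+ 2 <= Ex P (fun w => f w ^+ 2).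
Proof.
move=> bf; set m := Ex P f.
have : 0 <= Ex P (fun w => (f w - m) ^+ 2) by apply: Ex_ge0 => w; exact: sqr_ge0.
have -> : Ex P (fun w => (f w - m) ^+ 2) =
    Ex P (fun w => (f w ^+ 2 - (2 * m) * f w) + m ^+ 2).
  by congr Ex; apply/funext => w; ring.
rewrite ExD; [|by apply: bmfunB; [exact: bmfunX|exact: bmfunZ]|exact: bmfun_cst].
rewrite ExB; [|exact: bmfunX|exact: bmfunZ].
by rewrite ExZ// Ex_cst -/m; move: (Ex P _) => x; clear; nra.
Qed.

Lemma charf2_le1 (X : T -> R) : measurable_fun setT X -> charf2 P X <= 1.
Proof.
move=> mX; have bc := bmfun_cos mX; have bs := bmfun_sin mX.
apply: (le_trans (lerD (Ex_sqr_ge bc) (Ex_sqr_ge bs))).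
rewrite -ExD; [|exact: bmfunX|exact: bmfunX].
under eq_fun do rewrite cos2Dsin2.
by rewrite Ex_cst.
Qed.

End characteristic_bounds.

(** Indeed x <= 2 dl / (phi - dl), where phi - dl > 7/16 and 2 dl <= y / 4. *)
Lemma excess_le (R : realFieldType) (phi dl x y : R) : (phi - dl) * (1 + x) <= phi + dl ->
  0 <= x -> dl <= 16^-1 -> dl <= y / 8 -> 2^-1 < phi -> x <= y.
Proof. by move=> h x0 d1 d2 hphi; nra. Qed.

Lemma close_trans (R : realFieldType) (x y phi dl : R) : x - y <= 12 * (dl / 24) ->
  y < phi + dl / 2 -> x <= phi + dl.
Proof. lra. Qed.

(** * Remote noise, and comparison of S_n with T_n *)

Section iid_linear_process.
Context d (T : measurableType d) (R : realType) (P : probability T R).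
Variables (Y : int -> T -> R) (X : T -> R).
Hypotheses (mY : forall j, measurable_fun setT (Y j)) (iY : mutual_indep P Y).
Hypotheses (mX : measurable_fun setT X) (dY : forall j, eq_dist P P (Y j) X).
Variables (q1 q2 K w0 : R).
Hypothesis rt : regular_tail P X q1 q2 K w0.

(** The maximal bound at the single time 0, the weights recording the signs of the coefficients. *)
Lemma small_combination (e : R) : 0 < e -> exists2 kap, 0 < kap &
  forall (s : seq int) (b : int -> R), uniq s -> (forall j, j \in s -> `|b j| <= w0) ->
  \sum_(j <- s) tailw P X `|b j| <= kap ->
  Pr P [set o | e < `|\sum_(j <- s) b j * Y j o|] <= e.
Proof.
move=> e0; have [kap kap0 h] := maximal_small mY iY mX dY rt e0.
exists kap => // s b us hb hs; have [[w00 _ _ _ _] _] := rt.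
pose w j := if j \in s then `|b j| else 0.
pose rp (k : nat) (j : int) : R := (0 <= b j)%R%:R.
pose rm (k : nat) (j : int) : R := (b j < 0)%R%:R.
have := h s w rp rm 0%N us.
have -> : [set o | exists2 k, (k <= 0)%N &
    e < `|\sum_(i <- s) (rp k i - rm k i) * (w i * Y i o)|] =
    [set o | e < `|\sum_(j <- s) b j * Y j o|].
  have hE k o : \sum_(i <- s) (rp k i - rm k i) * (w i * Y i o) = \sum_(j <- s) b j * Y j o.
    apply: eq_big_seq => j js; rewrite /rp /rm /w js.
    by case: (leP 0 (b j)) => bj; rewrite ?(ger0_norm bj) ?(ltr0_norm bj)/=; ring.
  apply/seteqP; split=> o /=; first by move=> [k _]; rewrite hE.
  by exists 0%N => //; rewrite hE.
apply=> //.
- by move=> j; rewrite /w; case: ifP => [/hb ->|_]; rewrite ?normr_ge0// lexx ltW.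
- by move=> j; rewrite /rp -[leRHS]/(1%:R) ler_nat leq_b1.
- by move=> j; rewrite /rm -[leRHS]/(1%:R) ler_nat leq_b1.
apply: le_trans hs; rewrite le_eqVlt; apply/orP; left; apply/eqP.
by apply: eq_big_seq => j js; rewrite /w js.
Qed.

Variables (v : nat -> R) (C : R).
Hypothesis v0 : forall n, 0 < v n.
Hypothesis vC : n%:R * tailw P X (v n) @[n --> \oo] --> C.

Lemma near_combination (b : nat -> int -> R) (k : nat -> int) (B : R) : 0 <= B ->
  (forall n j, `|b n j| <= B * v n) ->
  (forall eta, 0 < eta -> exists r, forall n j, (r < absz j)%N -> (r < absz (j - k n))%N ->
      `|b n j| <= eta * v n) ->
  forall e, 0 < e -> \forall n \near \oo,
    Pr P [set o | e < `|\sum_(j <- zwin (2 * n)) b n j * Y j o|] <= e.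
Proof.
move=> B0 hB hr e e0; have [kap kap0 hk] := small_combination e0.
have [[w00 _ _ _ _] _] := rt.
have h1 := near_window_tail mX rt v0 vC (dd := fun n j => `|b n j|) B0
  (fun n j => introT andP (conj (normr_ge0 _) (hB n j))) hr kap0.
have h2 := near_v_small mX rt v0 vC B w00.
near=> n; apply: hk; first exact: zwin_uniq.
  by move=> j _; apply: (le_trans (hB n j)); near: n; exact: h2.
by near: n; exact: h1.
Unshelve. all: by end_near. Qed.

Variables (c : int -> R) (A B : R).
Hypotheses (cA : finsum_le (fun j => `|c j|) A).
Hypotheses (cB : finsum_le (fun j => tailw P X `|c j|) B).
Let ca j := `|c j|.

Let caA : finsum_le (fun j => `|ca j|) A.
Proof. by move=> s us; rewrite /ca; under eq_bigr do rewrite normr_id; exact: cA. Qed.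

Let caB : finsum_le (fun j => tailw P X `|ca j|) B.
Proof. by move=> s us; rewrite /ca; under eq_bigr do rewrite normr_id; exact: cB. Qed.

Let ca0 j : 0 <= ca j. Proof. exact: normr_ge0. Qed.

Let A0 : 0 <= A. Proof. by have := @cA [::] isT; rewrite big_nil. Qed.

(** T_n(1) is approximated by sums over windows containing [s]. Every factor is at most 1, so
    discarding those outside [s] only increases the product. *)
Lemma charf2_linproc_le u n s : uniq s ->
  charf2 P (fun w => u * (v n * \sum_(1 <= i < n.+1) linproc ca Y i%:Z w)) <=
  \prod_(j <- s) charf2 P (fun w => (u * (v n * bsum ca n j)) * X w).
Proof.
move=> us; pose f j := charf2 P (fun w => (u * (v n * bsum ca n j)) * X w).
have f0 j : 0 <= f j by exact: charf2_ge0.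
have f1 j : f j <= 1 by apply: charf2_le1; exact: measurable_funM.
apply/ler_addgt0Pr => e e0; have e1 : 0 < e / 12 by rewrite divr_gt0.
have [N0 hN0] := linproc_sum_window mY iY mX dY rt caA caB (u * v n) n e1.
pose M := (\max_(j <- s) absz j)%N; pose N := maxn N0 M.
have [D [mD hD] hDo] := hN0 N (leq_maxl _ _).
have h1 : `|charf2 P (fun w => u * (v n * \sum_(1 <= i < n.+1) linproc ca Y i%:Z w)) -
    charf2 P (fun w => \sum_(j <- zwin N) (u * v n * bsum ca n j) * Y j w)| <= 12 * (e / 12).
  apply: (charf2_close _ _ mD hD).
  - apply: measurable_funM => //; apply: measurable_funM => //.
    by apply: measurable_sum_seq => i _; exact: measurable_linproc.
  - by apply: measurable_sum_seq => j _; exact: measurable_funM.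
  - by move=> w hw; rewrite mulrA; exact: hDo.
rewrite (@charf2_sum _ _ _ P _ Y mY iY _ _ (zwin_uniq N)) in h1.
have h2 : \prod_(j <- zwin N) f j <= \prod_(j <- s) f j.
  rewrite (bigID (fun j => j \in s))/= -[X in X * _]big_filter.
  have -> : \prod_(j <- [seq i <- zwin N | i \in s]) f j = \prod_(j <- s) f j.
    apply: perm_big; apply: uniq_perm => //; first by rewrite filter_uniq// zwin_uniq.
    move=> j; rewrite mem_filter mem_zwin; case: (boolP (j \in s)) => //= js.
    have jM : (absz j <= M)%N by exact: leq_bigmax_seq.
    by rewrite leq_max jM orbT.
  rewrite ler_piMr ?prodr_ge0//.
  by apply: prodr_ile1 => j _; rewrite f0 f1.
have h3 : \prod_(j <- zwin N) charf2 P (fun w => u * v n * bsum ca n j * Y j w) =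
    \prod_(j <- zwin N) f j.
  by apply: eq_bigr => j _; rewrite (iid_charf2 mY mX dY) /f mulrA.
rewrite h3 (_ : 12 * (e / 12) = e) in h1; last by field.
by move: h1; rewrite ler_norml => /andP[_]; move: h2; lra.
Qed.

Context d' (T' : measurableType d') (Q : probability T' R).
Variable Z1 : T' -> R.
Hypothesis mZ1 : measurable_fun setT Z1.
Hypothesis hL : cvg_dist P Q (fun n w => v n * \sum_(1 <= i < n.+1) Y i%:Z w) Z1.
Hypothesis hT : cvg_dist P Q (fun n w => v n * \sum_(1 <= i < n.+1) linproc ca Y i%:Z w)
  (fun w => zsum ca * Z1 w).

Let bca_le n j : bsum ca n j <= A.
Proof. exact: bsum_bound. Qed.

Let bca_ge0 n j : 0 <= bsum ca n j.
Proof. exact: bsum_ge0. Qed.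

Let zA : 0 <= zsum ca <= A.
Proof.
have /andP[h1 h2] := zsum_norm_le cA; rewrite h2 andbT.
by apply: le_trans h1.
Qed.

(** Within the window |b|_n(j) is close to A_{|.|} on [1, n] and to 0 elsewhere, apart from
    boundedly many positions near 0 and n. So the part of T_n(1) with |j| <= 2n alone already has
    the limit of T_n(1). *)
Lemma near_part_close (e : R) : 0 < e -> \forall n \near \oo,
  Pr P [set o | e < `|\sum_(j <- zwin (2 * n)) (v n * bsum ca n j) * Y j o -
     zsum ca * (v n * \sum_(1 <= i < n.+1) Y i%:Z o)|] <= e.
Proof.
move=> e0.
pose b n (j : int) := v n * (bsum ca n j - (1 <= j <= n%:Z)%R%:R * zsum ca).
have hb n o : \sum_(j <- zwin (2 * n)) (v n * bsum ca n j) * Y j o -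
     zsum ca * (v n * \sum_(1 <= i < n.+1) Y i%:Z o) = \sum_(j <- zwin (2 * n)) b n j * Y j o.
  rewrite -(@sum_zwin_interval _ n (2 * n) (fun j => Y j o)); last by rewrite leq_pmull.
  rewrite !mulr_sumr -sumrB; apply: eq_bigr => j _; rewrite /b; ring.
under eq_near => n do (under eq_set => o do rewrite hb).
have /andP[zA1 zA2] := zA.
apply: (@near_combination b (fun n => n%:Z) A) => //.
  move=> n j; rewrite /b normrM (gtr0_norm (v0 n)) mulrC ler_pM2r//.
  have := bca_le n j; have := bca_ge0 n j; rewrite ler_norml.
  by case: ((1 <= j) && _) => /= h1 h2; rewrite ?mul1r ?mul0r; apply/andP; split; lra.
move=> eta eta0; have [r hr] := bsum_window caA eta0.
exists r => n j h1 h2; rewrite /b normrM (gtr0_norm (v0 n)) mulrC ler_pM2r//.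
exact: hr.
Qed.

Definition far (n : nat) (j : int) : bool := (2 * n < absz j)%N.

Lemma linproc_tail_sums : exists u0 M0, [/\ 0 < u0,
  \forall n \near \oo, finsum_le (fun j => tailw P X (u0 * (v n * bsum ca n j))) M0 &
  forall kap, 0 < kap -> \forall n \near \oo, forall s, uniq s -> all (far n) s ->
    \sum_(j <- s) tailw P X (u0 * (v n * bsum ca n j)) <= kap].
Proof.
have [[w00 _ /andP[q20 q21] _ _] hrt] := rt.
have [c1 [s0 [c10 s00 hct]]] := @charf2_tail _ _ _ P X mX q2 w0 w00 q21
  ltac:(by move=> w /andP[/ltW h1 h2]; have [] := hrt w ltac:(by rewrite h1)).
have mAZ : measurable_fun setT (fun w => zsum ca * Z1 w) by exact: measurable_funM.
(* The margin 1/4 makes the mean cosine at least 3/4, so that [phi >= 9/16 > 1/2]. *)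
have [u0 u00 hu0] := @Ex_cos_near1 _ _ _ Q _ mAZ 4^-1 ltac:(by rewrite invr_gt0).
(* [phi] is the limit of |E exp(i u0 T_n(1))| ^ 2. The factors with |j| <= 2n alone have a
   product tending to [phi], so the product of the remaining factors tends to [1]. *)
pose phi := charf2 Q (fun w => u0 * (zsum ca * Z1 w)).
have hphi : 2^-1 < phi.
  have := hu0 u0 ltac:(by rewrite lexx ltW); rewrite /phi /charf2.
  move: (Ex Q _) (Ex Q _) => x y hx; have := sqr_ge0 y.
  by move: hx; nra.
have mU n : measurable_fun setT (fun w => v n * \sum_(1 <= i < n.+1) linproc ca Y i%:Z w).
  apply: measurable_funM => //; apply: measurable_sum_seq => i _; exact: measurable_linproc.
have mL n : measurable_fun setT (fun w => v n * \sum_(1 <= i < n.+1) Y i%:Z w).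
  by apply: measurable_funM => //; apply: measurable_sum_seq.
have cU := charf2_cvg (u := u0) mU mAZ hT.
have cL := charf2_cvg (u := u0 * zsum ca) mL mZ1 hL.
pose f n j := charf2 P (fun w => (u0 * (v n * bsum ca n j)) * X w).
have nsmall : \forall n \near \oo, forall j, 0 <= u0 * (v n * bsum ca n j) <= s0.
  near=> n => j; rewrite !mulr_ge0 ?(ltW u00) ?(ltW (v0 n))//=.
  apply: (@le_trans _ _ (u0 * A * v n)).
    by rewrite [v n * _]mulrC mulrA ler_pM2r// ler_pM2l.
  by near: n; exact: (near_v_small mX rt v0 vC).
have prodsum n s : (forall j, 0 <= u0 * (v n * bsum ca n j) <= s0) ->
    (\prod_(j <- s) f n j) * (1 + c1 * \sum_(j <- s) tailw P X (u0 * (v n * bsum ca n j))) <= 1.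
  move=> hn; rewrite mulr_sumr; apply: prod_one_sum_le => j _; split.
  - exact: charf2_ge0.
  - by rewrite mulr_ge0 ?tailw_ge0// ltW.
  - exact: hct.
(* A product p > 1/2 with p (1 + x) <= 1 forces x <= 1, where x is [c1] times the sum of the
   tails. *)
exists u0, c1^-1; split => //.
  near=> n => s us.
  have h1 : 2^-1 < charf2 P (fun w => u0 * (v n * \sum_(1 <= i < n.+1) linproc ca Y i%:Z w)).
    by near: n; move/cvgr_gt : cU; apply.
  have h2 := charf2_linproc_le u0 n us.
  have hn0 : forall j, 0 <= u0 * (v n * bsum ca n j) <= s0 by near: n; exact: nsmall.
  have h3 := prodsum n s hn0.
  have S0 : 0 <= \sum_(j <- s) tailw P X (u0 * (v n * bsum ca n j)).
    by apply: sumr_ge0 => j _; exact: tailw_ge0.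
  rewrite -(ler_pM2l c10) divff ?gt_eqF//.
  have := lt_le_trans h1 h2; move: h3 (mulr_ge0 (ltW c10) S0); rewrite -/(f n).
  move: (\prod_(j <- s) _) (c1 * _) => p x; nra.
move=> kap kap0.
(* The bounds 1/16 and 1/8 are those of [excess_le]. In [dl / 24], the factor 12 of [charf2_close]
   leaves [dl / 2]; the other half is spent on the convergence to [phi]. *)
pose dl := Num.min 16^-1 (c1 * kap / 8).
have dl0 : 0 < dl by rewrite lt_min invr_gt0 ltr0n/= !mulr_gt0// invr_gt0.
have dl1 : dl <= 16^-1 by rewrite ge_min lexx.
have dl2 : dl <= c1 * kap / 8 by rewrite ge_min lexx orbT.
have e0 : 0 < dl / 24 by rewrite divr_gt0.
have u1 : 0 < 1 + u0 by rewrite addr_gt0.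
have e1 : 0 < dl / 24 / (1 + u0) by rewrite divr_gt0.
have hnear := near_part_close e1.
near=> n => s us fs.
have h1 : phi - dl < charf2 P (fun w => u0 * (v n * \sum_(1 <= i < n.+1) linproc ca Y i%:Z w)).
  by near: n; move/cvgr_gt : cU; apply; rewrite /phi; lra.
have h2 : charf2 P (fun w => u0 * zsum ca * (v n * \sum_(1 <= i < n.+1) Y i%:Z w)) < phi + dl / 2.
  near: n; move/cvgr_lt : cL; apply; rewrite /phi.
  under [X in _ < charf2 _ X + _]eq_fun do rewrite mulrA.
  lra.
have h3 : Pr P [set o | dl / 24 / (1 + u0) < `|\sum_(j <- zwin (2 * n)) (v n * bsum ca n j) * Y j o -
     zsum ca * (v n * \sum_(1 <= i < n.+1) Y i%:Z o)|] <= dl / 24 / (1 + u0).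
  by near: n; exact: hnear.
have h4 : `|charf2 P (fun w => \sum_(j <- zwin (2 * n)) (u0 * (v n * bsum ca n j)) * Y j w) -
    charf2 P (fun w => u0 * zsum ca * (v n * \sum_(1 <= i < n.+1) Y i%:Z w))| <= 12 * (dl / 24).
  apply: (charf2_close (D := [set o | dl / 24 / (1 + u0) <
     `|\sum_(j <- zwin (2 * n)) (v n * bsum ca n j) * Y j o -
     zsum ca * (v n * \sum_(1 <= i < n.+1) Y i%:Z o)|])).
  - by apply: measurable_sum_seq => j _; exact: measurable_funM.
  - exact: measurable_funM.
  - apply: measurable_set_lt; apply: measurableT_comp => //; apply: measurable_funB => //.
      by apply: measurable_sum_seq => j _; exact: measurable_funM.
    exact: measurable_funM.
  - by apply: (le_trans h3); rewrite ler_pdivrMr// ler_peMr ?(ltW e0)// lerDl ltW.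
  move=> w /= /negP; rewrite -leNgt => hw.
  under eq_bigr do rewrite -mulrA.
  rewrite -mulr_sumr -mulrA -mulrBr normrM (gtr0_norm u00).
  move: hw; rewrite ler_pdivlMr// => hw; apply: le_trans hw; rewrite mulrC ler_wpM2l//.
  by rewrite lerDr.
rewrite (@charf2_sum _ _ _ P _ Y mY iY _ _ (zwin_uniq (2 * n))) in h4.
have h5 : \prod_(j <- zwin (2 * n)) charf2 P (fun w => u0 * (v n * bsum ca n j) * Y j w) =
    \prod_(j <- zwin (2 * n)) f n j.
  by apply: eq_bigr => j _; rewrite (iid_charf2 mY mX dY).
rewrite h5 in h4.
(* Adjoin the far positions to the window: the product over both is at least [phi - dl], while the
   product over the window alone is at most [phi + dl]. Their quotient leaves little room for the
   far tails. *)
have us2 : uniq (zwin (2 * n) ++ s).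
  rewrite cat_uniq zwin_uniq us andbT; apply/hasPn => j js.
  by have := allP fs j js; rewrite /far mem_zwin -ltnNge.
have h6 := charf2_linproc_le u0 n us2; rewrite big_cat/= -/(f n) in h6.
have hn0 : forall j, 0 <= u0 * (v n * bsum ca n j) <= s0 by near: n; exact: nsmall.
have h7 := prodsum n s hn0.
have S0 : 0 <= \sum_(j <- s) tailw P X (u0 * (v n * bsum ca n j)).
  by apply: sumr_ge0 => j _; exact: tailw_ge0.
rewrite -(ler_pM2l c10).
move: h4; rewrite ler_norml => /andP[_ h4].
have pz : 0 <= \prod_(j <- zwin (2 * n)) f n j by apply: prodr_ge0 => j _; exact: charf2_ge0.
have h8 : (phi - dl) * (1 + c1 * \sum_(j <- s) tailw P X (u0 * (v n * bsum ca n j))) <= phi + dl.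
  apply: (@le_trans _ _ (\prod_(j <- zwin (2 * n)) f n j)); last exact: (close_trans h4 h2).
  rewrite -[leRHS]mulr1; apply: le_trans (ler_wpM2l pz h7).
  rewrite mulrA ler_wpM2r ?addr_ge0 ?(mulr_ge0 (ltW c10))//.
  exact: le_trans (ltW h1) h6.
exact: (excess_le h8 (mulr_ge0 (ltW c10) S0) dl1 dl2 hphi).
Unshelve. all: by end_near. Qed.

(** The coefficient b_k(j) - rho |b|_k(j) is small both where the sums are near (A, A_{|.|}) and
    where they are near (0, 0), which settles the window. For |j| > 2n it is at most 2 |b|_n(j), so
    the far tails of T_n(1) dominate. *)
Lemma proportional_close (rho : R) (k : nat -> nat) (e : R) :
  zsum c = rho * zsum ca -> `|rho| <= 1 -> (forall n, (k n <= n)%N) -> 0 < e ->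
  \forall n \near \oo, Pr P [set o | e <
    `|v n * \sum_(1 <= i < (k n).+1) linproc c Y i%:Z o -
      rho * (v n * \sum_(1 <= i < (k n).+1) linproc ca Y i%:Z o)|] <= e.
Proof.
move=> hrho rho1 kn e0; have e30 : 0 < e / 3 by rewrite divr_gt0.
have [kap kap0 hsmall] := small_combination e30.
have [u0 [M0 [u00 _ hfar]]] := linproc_tail_sums.
have [[w00 _ _ _ _] _] := rt; have q10 := q1_gt0 rt.
(* The number of doublings that leads from the tails at scale [u0] to those at scale 2, which
   appears in [hb]. *)
have [m hm] : exists m, 2 / u0 <= 2 ^+ m.
  exists (Num.truncn (2 / u0)).+1; apply: (le_trans (ltW (truncnS_gt _))).
  by rewrite -natrX ler_nat ltnW// ltn_expl.
pose b n j := v n * (bsum c (k n) j - rho * bsum ca (k n) j).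
have hb n j : `|b n j| <= 2 * (v n * bsum ca n j).
  rewrite /b normrM (gtr0_norm (v0 n)) mulrCA ler_pM2l//.
  apply: (le_trans (ler_normB _ _)); rewrite mulr_natl mulr2n normrM.
  have hca : bsum ca (k n) j <= bsum ca n j by exact: bsum_le_mono.
  apply: lerD; first by apply: le_trans hca; exact: bsum_norm.
  by rewrite (ger0_norm (bca_ge0 _ _)); apply: le_trans hca; exact: ler_piMl.
have hbA n j : `|b n j| <= 2 * A * v n.
  by apply: (le_trans (hb n j)); rewrite mulrCA [leRHS]mulrC ler_pM2l// ler_pM2l.
have A20 : 0 <= 2 * A by rewrite mulr_ge0.
have k20 : 0 < kap / 2 by rewrite divr_gt0.
have hwin : \forall n \near \oo, \sum_(j <- zwin (2 * n)) tailw P X `|b n j| <= kap / 2.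
  apply: (near_window_tail mX rt v0 vC (k := fun n => (k n)%:Z) A20) => //.
    by move=> n j; rewrite normr_ge0 hbA.
  move=> eta eta0; have eta20 : 0 < eta / 2 by rewrite divr_gt0.
  have [r1 hr1] := bsum_window cA eta20; have [r2 hr2] := bsum_window caA eta20.
  exists (maxn r1 r2) => n j; rewrite !gtn_max => /andP[j1 j2] /andP[j3 j4].
  rewrite /b normrM (gtr0_norm (v0 n)) [leRHS]mulrC ler_pM2l//.
  have h1 := hr1 (k n) j j1 j3; have h2 := hr2 (k n) j j2 j4.
  rewrite hrho in h1; move: h1 h2; move: (_ && _) => bb h1 h2.
  rewrite (_ : _ - _ = (bsum c (k n) j - bb%:R * (rho * zsum ca)) -
    rho * (bsum ca (k n) j - bb%:R * zsum ca)); last by ring.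
  apply: (le_trans (ler_normB _ _)); rewrite [leRHS]splitr; apply: lerD => //.
  by rewrite normrM; apply: le_trans h2; exact: ler_piMl.
have kap1 : 0 < q1 ^+ m * (kap / 2) by rewrite mulr_gt0 ?exprn_gt0.
have hfar1 := hfar _ kap1.
have hs1 := near_v_small mX rt v0 vC (2 * A) w00.
have hs2 := near_v_small mX rt v0 vC (2 ^+ m * (u0 * A)) w00.
near=> n.
have n1 : \sum_(j <- zwin (2 * n)) tailw P X `|b n j| <= kap / 2 by near: n; exact: hwin.
have n2 : forall s, uniq s -> all (far n) s ->
    \sum_(j <- s) tailw P X (u0 * (v n * bsum ca n j)) <= q1 ^+ m * (kap / 2).
  by near: n; exact: hfar1.
have n3 : 2 * A * v n <= w0 by near: n; exact: hs1.
have n4 : 2 ^+ m * (u0 * A) * v n <= w0 by near: n; exact: hs2.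
have [N1 hN1] := linproc_sum_window mY iY mX dY rt cA cB (v n) n e30.
have [N2 hN2] := linproc_sum_window mY iY mX dY rt caA caB (v n) n e30.
pose N := maxn (maxn N1 N2) (2 * n).
have [D1 [mD1 pD1] hD1] := hN1 N ltac:(by rewrite !leq_max leqnn).
have [D2 [mD2 pD2] hD2] := hN2 N ltac:(by rewrite !leq_max leqnn orbT).
pose G := [set o | e / 3 < `|\sum_(j <- zwin N) b n j * Y j o|].
have mG : measurable G.
  apply: measurable_set_lt; apply: measurableT_comp => //.
  by apply: measurable_sum_seq => j _; exact: measurable_funM.
have pG : Pr P G <= e / 3.
  apply: hsmall; first exact: zwin_uniq.
    by move=> j _; exact: le_trans (hbA n j) n3.
  rewrite (bigID (far n))/= addrC [leRHS]splitr; apply: lerD.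
    rewrite -big_filter (_ : \sum_(i <- _) _ = \sum_(j <- zwin (2 * n)) tailw P X `|b n j|)//.
    apply: perm_big; apply: uniq_perm; rewrite ?filter_uniq ?zwin_uniq// => j.
    by rewrite mem_filter !mem_zwin /far -leqNgt; case: leqP => //= h; rewrite leq_max h orbT.
  rewrite -big_filter; set s := [seq j <- zwin N | far n j].
  have us : uniq s by rewrite filter_uniq// zwin_uniq.
  have fs : all (far n) s by exact: filter_all.
  apply: (@le_trans _ _ (\sum_(j <- s) q1 ^- m * tailw P X (u0 * (v n * bsum ca n j)))).
    apply: ler_sum => j _.
    have w_ge0 : 0 <= u0 * (v n * bsum ca n j) by rewrite !mulr_ge0 ?(ltW u00) ?(ltW (v0 n)).
    apply: le_trans (tailw_upscale rt w_ge0 _); last first.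
      apply: le_trans n4; rewrite -mulrA ler_pM2l ?exprn_gt0// -mulrA ler_pM2l//.
      by rewrite mulrC ler_pM2r.
    apply: tailw_le => //; apply: (le_trans (hb n j)); rewrite [leRHS]mulrA ler_wpM2r//.
      by rewrite mulr_ge0// ltW.
    by rewrite -ler_pdivrMr.
  by rewrite -mulr_sumr mulrC ler_pdivrMr ?exprn_gt0// [leRHS]mulrC; exact: n2.
have mS (c' : int -> R) (k' : nat) : measurable_fun setT
    (fun o => v n * \sum_(1 <= i < k'.+1) linproc c' Y i%:Z o).
  by apply: measurable_funM => //; apply: measurable_sum_seq => i _; exact: measurable_linproc.
apply: (@le_trans _ _ (Pr P (D1 `|` (D2 `|` G)))).
  apply: Pr_le; [|by do 2 apply: measurableU => //|].
    apply: measurable_set_lt; apply: measurableT_comp => //; apply: measurable_funB => //.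
    exact: measurable_funM.
  move=> o /= ho; have [d1|d1] := pselect (D1 o); [by left|right].
  have [d2|d2] := pselect (D2 o); [by left|right].
  rewrite /G /= ltNge; apply/negP => hG.
  have h1 := hD1 o d1 (k n) (kn n); have h2 := hD2 o d2 (k n) (kn n).
  move: ho; rewrite ltNge => /negP; apply.
  set S1 := v n * _ in h1 *; set S2 := v n * _ in h2 *.
  have -> : S1 - rho * S2 = (S1 - \sum_(j <- zwin N) v n * bsum c (k n) j * Y j o) -
    rho * (S2 - \sum_(j <- zwin N) v n * bsum ca (k n) j * Y j o) +
    \sum_(j <- zwin N) b n j * Y j o.
    rewrite (_ : \sum_(j <- zwin N) b n j * Y j o =
      \sum_(j <- zwin N) v n * bsum c (k n) j * Y j o -
      rho * \sum_(j <- zwin N) v n * bsum ca (k n) j * Y j o); first by ring.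
    by rewrite mulr_sumr -sumrB; apply: eq_bigr => j _; rewrite /b; ring.
  apply: (le_trans (ler_normD _ _)); rewrite (_ : e = e / 3 + e / 3 + e / 3); last by field.
  apply: lerD => //; apply: (le_trans (ler_normB _ _)); apply: lerD => //.
  by rewrite normrM; apply: le_trans h2; exact: ler_piMl.
apply: (le_trans (PrU_le P mD1 (measurableU _ _ mD2 mG))).
have := PrU_le P mD2 mG; move: pD1 pD2 pG; move: (Pr P _) (Pr P _) (Pr P _) (Pr P _) => x y z t.
lra.
Unshelve. all: by end_near. Qed.

End iid_linear_process.

(** * Tightness *)

Section truncation.
Variable R : realType.

Lemma clip1_split (lam x : R) : 0 < lam ->
  x = lam^-1 * clip1 (lam * x) + x * (1 < lam * `|x|)%R%:R.
Proof.
move=> l0; rewrite /clip1 normrM (gtr0_norm l0).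
by case: leP => _ /=; rewrite ?mulr1 ?mulr0 ?addr0 ?add0r// mulKf// gt_eqF.
Qed.

Lemma exists_expr_le (q a e : R) : 0 <= q -> q < 1 -> 0 < e -> exists m, a * q ^+ m <= e.
Proof.
move=> q0 q1 e0; have hc : a * q ^+ m @[m --> \oo] --> (0 : R).
  by rewrite -(mulr0 a); apply: cvgMr; apply: cvg_expr; rewrite ger0_norm.
by move: hc => /cvgr_lt/(_ _ e0)/filter_ex[m /ltW hm]; exists m.
Qed.

(** Each weight rises from a nonnegative value to at most 1, so its increments add up to at most
    1. *)
Lemma variation_lincomb (I : Type) (s : seq I) (rho : nat -> I -> R) (g : I -> R) n :
  (forall i, 0 <= rho 0%N i) -> (forall k i, rho k i <= rho k.+1 i) -> (forall i, rho n i <= 1) ->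
  \sum_(k < n) `|\sum_(i <- s) rho k.+1 i * g i - \sum_(i <- s) rho k i * g i| <=
  \sum_(i <- s) `|g i|.
Proof.
move=> r0 rS r1.
apply: (@le_trans _ _ (\sum_(k < n) \sum_(i <- s) (rho k.+1 i - rho k i) * `|g i|)).
  apply: ler_sum => k _; rewrite -sumrB; apply: (le_trans (ler_norm_sum _ _ _)).
  by apply: ler_sum => i _; rewrite -mulrBl normrM ger0_norm// subr_ge0.
rewrite exchange_big/=; apply: ler_sum => i _; rewrite -mulr_suml.
rewrite -(big_mkord predT (fun k => rho k.+1 i - rho k i)) telescope_sumr//.
by apply: ler_piMl => //; rewrite lerBlDr; apply: (le_trans (r1 i)); rewrite lerDl.
Qed.

Lemma stp_approximable_close (x y : R -> R) N (L e1 e2 : R) :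
  stp_approximable y N L e1 -> (forall t, 0 <= t <= 1 -> `|x t - y t| <= e2) ->
  stp_approximable x N L (e2 + e1).
Proof.
move=> [b [tau [hb hy]]] hx; exists b, tau; split=> // t ht.
rewrite (_ : x t - _ = (x t - y t) + (y t - stp N b tau t)); last by ring.
by apply: (le_trans (ler_normD _ _)); apply: lerD; [exact: hx|exact: hy].
Qed.

End truncation.

Section tightness.
Context d (T : measurableType d) (R : realType) (P : probability T R).
Variables (Y : int -> T -> R) (X : T -> R).
Hypotheses (mY : forall j, measurable_fun setT (Y j)) (iY : mutual_indep P Y).
Hypotheses (mX : measurable_fun setT X) (dY : forall j, eq_dist P P (Y j) X).
Variables (q1 q2 K w0 : R).
Hypothesis rt : regular_tail P X q1 q2 K w0.
Variables (v : nat -> R) (C : R).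
Hypotheses (v0 : forall n, 0 < v n).
Hypothesis vC : n%:R * tailw P X (v n) @[n --> \oo] --> C.
Variables (c : int -> R) (A B : R).
Hypotheses (cA : finsum_le (fun j => `|c j|) A).
Hypotheses (cB : finsum_le (fun j => tailw P X `|c j|) B).
Variables (u0 M0 : R).
Hypothesis u00 : 0 < u0.
Let ca j := `|c j|.
Hypothesis hM0 : \forall n \near \oo, finsum_le (fun j => tailw P X (u0 * (v n * bsum ca n j))) M0.

Let cp j : R := Num.max (c j) 0.
Let cm j : R := Num.max (- c j) 0.

Let b_le n j : bsum ca n j <= A.
Proof. exact: bsum_bound. Qed.

Let b_ge0 n j : 0 <= bsum ca n j. Proof. by apply: bsum_ge0 => i; exact: normr_ge0. Qed.

Let cp0 j : 0 <= cp j. Proof. by rewrite le_max lexx orbT. Qed.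
Let cm0 j : 0 <= cm j. Proof. by rewrite le_max lexx orbT. Qed.
Let cpa j : cp j <= ca j. Proof. by rewrite ge_max ler_norm normr_ge0. Qed.
Let cma j : cm j <= ca j. Proof. by rewrite ge_max normr_ge0 andbT /ca -normrN ler_norm. Qed.

Let bsum_split k j : bsum c k j = bsum cp k j - bsum cm k j.
Proof.
rewrite /bsum -sumrB; apply: eq_bigr => i _; rewrite /cp /cm; move: (c _) => x.
by have [x0|x0] := leP x 0; [rewrite (max_idPl _) ?oppr_ge0// | rewrite (max_idPr _) ?oppr_le0 ?ltW//]; ring.
Qed.

Let bsum_le (c1 c2 : int -> R) k j : (forall i, c1 i <= c2 i) -> bsum c1 k j <= bsum c2 k j.
Proof. by move=> h; apply: ler_sum => i _. Qed.

Let A0 : 0 <= A. Proof. exact: le_trans (b_ge0 0 0) (b_le 0 0). Qed.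

Lemma linproc_tight (e : R) : 0 < e -> exists N L, \forall n \near \oo,
  exists2 D, measurable D /\ Pr P D <= e & forall o, ~ D o ->
    stp_approximable (gridv n (fun k => v n * \sum_(1 <= i < k.+1) linproc c Y i%:Z o)) N L e.
Proof.
move=> e0; have [[w00 q14 /andP[q20 q21] K0 _] hrt] := rt; have q10 := q1_gt0 rt.
have e40 : 0 < e / 4 by rewrite divr_gt0.
have M00 : 0 <= M0.
  by have [n] := filter_ex hM0; move=> /(_ [::] isT); rewrite big_nil.
have q41 : 1 < 4 * q1 by move: q14; rewrite -ltr_pdivrMl// mulr1.
(* Truncating [W j * Y j] at [1 / lam], the small jumps have variance of order [(4 * q1) ^- m],
   and the drift and the large jumps have bounded variation. *)
have [m hm] : exists m, (256 * K * M0 / (u0 * e) ^+ 2) * ((4 * q1)^-1) ^+ m <= e / 4.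
  by apply: exists_expr_le => //; rewrite ?invr_ge0 ?mulr_ge0 ?(ltW q10)// invf_lt1// mulr_gt0.
(* A term |W_j Y_j| > J = 2^p / u0 has probability at most q2^p times the tail at [u0 * W j]; [p]
   makes the total at most e/4. *)
have [p hp] : exists p, M0 * q2 ^+ p <= e / 4 by exact: exists_expr_le.
pose lam := 2 ^+ m * u0; have lam0 : 0 < lam by rewrite mulr_gt0 ?exprn_gt0.
pose M1 := q1 ^- m * M0; have M10 : 0 <= M1 by rewrite mulr_ge0// invr_ge0 exprn_ge0 ?ltW.
(* Markov's inequality: the mean number of large jumps is at most [M1], so [cnt] is exceeded with
   probability at most e/4. The summand 1 keeps [cnt] positive. *)
pose cnt := M1 / (e / 4) + 1; have cnt0 : 0 < cnt by rewrite ltr_wpDl// divr_ge0// ltW.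
pose J := 2 ^+ p / u0; have J0 : 0 < J by rewrite divr_gt0 ?exprn_gt0.
(* The factor 2 accounts for the positive and the negative part of [c]. Inside stand the total drift
   and at most [cnt] large jumps of size at most [J]. *)
pose L := 2 * (lam^-1 * (K * M1) + J * cnt).
exists (Num.truncn (L / (e / 2))).+1, L.
have hs1 := near_v_small mX rt v0 vC (lam * A) w00.
have hs2 := near_v_small mX rt v0 vC (u0 * A) w00.
near=> n.
have n1 : lam * A * v n <= w0 by near: n; exact: hs1.
have n2 : u0 * A * v n <= w0 by near: n; exact: hs2.
have n3 : finsum_le (fun j => tailw P X (u0 * (v n * bsum ca n j))) M0 by near: n; exact: hM0.
have [N hN] := linproc_sum_window mY iY mX dY rt cA cB (v n) n e40.
have [D0 [mD0 pD0] hD0] := hN N (leqnn N).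
pose W j := v n * bsum ca n j.
have W0 j : 0 <= W j by rewrite mulr_ge0// ltW.
have lamW j : 0 <= lam * W j <= w0.
  rewrite mulr_ge0 ?(ltW lam0)//=; apply: le_trans n1.
  by rewrite /W mulrCA [leRHS]mulrC ler_pM2l// ler_pM2l.
have uW j : 0 <= u0 * W j <= w0.
  rewrite mulr_ge0 ?(ltW u00)//=; apply: le_trans n2.
  by rewrite /W mulrCA [leRHS]mulrC ler_pM2l// ler_pM2l.
(* Dividing by |b|_n(j) normalizes the weights to increase from 0 to at most 1, as the maximal
   inequality requires. Where |b|_n(j) = 0 the quotient is 0, consistently with |b_k(j)| <=
   |b|_n(j). *)
pose rq (c' : int -> R) k j := bsum c' k j / bsum ca n j.
have rq0 c' j : 0 <= rq c' 0%N j by rewrite /rq bsum0 mul0r.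
have rqS c' k j : (forall i, 0 <= c' i) -> rq c' k j <= rq c' k.+1 j.
  by move=> h; rewrite ler_wpM2r ?invr_ge0// bsum_le_mono.
have rq1 c' j : (forall i, c' i <= ca i) -> rq c' n j <= 1.
  move=> h; rewrite /rq; have [->|h0] := eqVneq (bsum ca n j) 0; first by rewrite invr0 mulr0.
  by rewrite ler_pdivrMr ?mul1r ?bsum_le// lt_neqAle eq_sym h0 b_ge0.
pose rho k j := rq cp k j - rq cm k j.
have rhoW k j : (k <= n)%N -> rho k j * W j = v n * bsum c k j.
  move=> kn; rewrite /rho /rq -mulrBl -bsum_split /W mulrCA; congr (_ * _).
  have [h|h] := eqVneq (bsum ca n j) 0; last by rewrite divfK.
  rewrite h mulr0; apply/eqP; rewrite eq_sym -normr_le0 -h.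
  by apply: (le_trans (bsum_norm _ _ _)); apply: bsum_le_mono => // i; exact: normr_ge0.
have tW1 : \sum_(j <- zwin N) tailw P X (lam * W j) <= M1.
  apply: (@le_trans _ _ (\sum_(j <- zwin N) q1 ^- m * tailw P X (u0 * W j))).
    apply: ler_sum => j _; rewrite /lam -mulrA; apply: (tailw_upscale rt).
      by have /andP[] := uW j.
    by rewrite mulrA; have /andP[] := lamW j.
  by rewrite -mulr_sumr ler_pM2l ?invr_gt0 ?exprn_gt0//; apply: n3; exact: zwin_uniq.
pose g j o := lam^-1 * cmean P X (lam * W j) + W j * Y j o * (1 < lam * W j * `|Y j o|)%R%:R.
pose E1 := [set o | exists2 k, (k <= n)%N & lam * (e / 4) <
  `|\sum_(j <- zwin N) rho k j * (clip1 (lam * W j * Y j o) - cmean P X (lam * W j))|].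
pose cntf o : R := \sum_(j <- zwin N) \1_[set o | 1 < lam * W j * `|Y j o|] o.
pose E2 := [set o | cnt < cntf o].
pose E3 := [set o | exists2 j, j \in zwin N & [set o | 1 < u0 * W j / 2 ^+ p * `|Y j o|] o].
have mbig w j : measurable [set o | 1 < w * `|Y j o|] by exact: measurable_tailw.
have mE1 : measurable E1.
  apply: measurable_exists_gt => k; apply: measurableT_comp => //.
  apply: measurable_sum_seq => j _; apply: measurable_funM => //.
  by apply: measurable_funB => //; have [] := bmfun_clip1 (mY j) (lam * W j).
have bcnt : bmfun cntf by apply: bmfun_sum => j; exact: bmfun_indic.
have mE2 : measurable E2 by apply: measurable_set_lt; case: bcnt.
have mE3 : measurable E3 by apply: measurable_exists_seq => j; exact: mbig.
have pE1 : Pr P E1 <= e / 4.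
  have le0 : 0 < lam * (e / 4) by rewrite mulr_gt0.
  apply: (le_trans (maximal_trunc_signed mY iY mX dY rt (zwin_uniq N) lamW (rq0 cp)
    (fun k j => rqS cp k j cp0) (fun j => rq1 cp j cpa) (rq0 cm) (fun k j => rqS cm k j cm0)
    (fun j => rq1 cm j cma) le0)).
  apply: le_trans hm; apply: (@le_trans _ _ (16 * K / (lam * (e / 4)) ^+ 2 * M1)).
    by apply: ler_wpM2l => //; rewrite divr_ge0 ?sqr_ge0// mulr_ge0// ltW.
  rewrite le_eqVlt; apply/orP; left; apply/eqP.
  rewrite /M1 /lam exprVn !exprMn -exprM mulnC exprM (_ : 2 ^+ 2 = 4); last by rewrite expr2; lra.
  have : 4 ^+ m != 0 :> R by rewrite gt_eqF// exprn_gt0.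
  have : q1 ^+ m != 0 by rewrite gt_eqF// exprn_gt0.
  move: (4 ^+ m) (q1 ^+ m) => y z y0 z0; field.
  by rewrite y0 z0/= !gt_eqF.
have pE2 : Pr P E2 <= e / 4.
  have cf0 o : 0 <= cntf o by apply: sumr_ge0 => j _; rewrite indicE; case: (_ \in _).
  have h1 := Ex_markov P bcnt cf0 cnt0.
  have h2 : Ex P cntf <= M1.
    rewrite Ex_sum; last by move=> j; exact: bmfun_indic.
    apply: le_trans tW1; rewrite le_eqVlt; apply/orP; left; apply/eqP.
    by apply: eq_bigr => j _; apply: etrans (Ex_indic P (mbig _ j)) _; rewrite (iid_tailw dY).
  have h3 : M1 <= cnt * (e / 4) by rewrite -ler_pdivrMr// /cnt lerDl.
  by have := le_trans (le_trans h1 h2) h3; rewrite ler_pM2l.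
have pE3 : Pr P E3 <= e / 4.
  apply: (le_trans (Pr_bigU_le _ _ _)); first by move=> j; exact: mbig.
  apply: le_trans hp.
  apply: (@le_trans _ _ (\sum_(j <- zwin N) q2 ^+ p * tailw P X (u0 * W j))).
    by apply: ler_sum => j _; rewrite (iid_tailw dY); exact: (tailw_downscale rt).
  by rewrite -mulr_sumr mulrC ler_wpM2r ?exprn_ge0//; apply: n3; exact: zwin_uniq.
exists (D0 `|` (E1 `|` (E2 `|` E3))).
  split; first by do 3 apply: measurableU => //.
  have h3 := PrU_le P mE2 mE3.
  have h2 := PrU_le P mE1 (measurableU _ _ mE2 mE3).
  have h1 := PrU_le P mD0 (measurableU _ _ mE1 (measurableU _ _ mE2 mE3)).
  apply: (le_trans h1); rewrite [leRHS](_ : e = e / 4 + (e / 4 + (e / 4 + e / 4))); last by field.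
  apply: lerD => //; apply: (le_trans h2); apply: lerD => //; apply: (le_trans h3).
  exact: lerD.
move=> o ho.
have ho0 : ~ D0 o by move=> h; apply: ho; left.
have ho1 : ~ E1 o by move=> h; apply: ho; right; left.
have ho2 : ~ E2 o by move=> h; apply: ho; right; right; left.
have ho3 : ~ E3 o by move=> h; apply: ho; right; right; right.
pose V k := \sum_(j <- zwin N) rho k j * g j o.
have V0 : V 0%N = 0 by apply: big1 => j _; rewrite /rho /rq !bsum0 !mul0r subrr mul0r.
have gL : \sum_(j <- zwin N) `|g j o| <= lam^-1 * (K * M1) + J * cnt.
  have h : forall j, j \in zwin N -> `|g j o| <= lam^-1 * (K * tailw P X (lam * W j)) +
      J * \1_[set o | 1 < lam * W j * `|Y j o|] o.
    move=> j jN; apply: (le_trans (ler_normD _ _)); apply: lerD.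
      rewrite normrM gtr0_norm ?invr_gt0// ler_pM2l ?invr_gt0//.
      by have [_ _ _ h] := hrt _ (lamW j).
    have -> : \1_[set o | 1 < lam * W j * `|Y j o|] o = (1 < lam * W j * `|Y j o|)%R%:R :> R.
      by rewrite indicE; congr (nat_of_bool _)%:R; apply/idP/idP; rewrite inE.
    rewrite normrM normr_nat.
    have hb : `|W j * Y j o| <= J.
      rewrite normrM (ger0_norm (W0 j)) leNgt; apply/negP => hlt; apply: ho3; exists j => //=.
      rewrite mulrAC -(mulrA u0) ltr_pdivlMr ?exprn_gt0// mul1r.
      by move: hlt; rewrite /J ltr_pdivrMr// mulrC.
    exact: ler_wpM2r.
  rewrite big_seq; apply: (le_trans (ler_sum _ h)); rewrite -big_seq big_split/= -!mulr_sumr.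
  apply: lerD.
    by rewrite ler_pM2l ?invr_gt0// ler_pM2l.
  rewrite ler_pM2l// leNgt; apply/negP => hlt; exact: ho2.
have hTV : \sum_(k < n) `|V k.+1 - V k| <= L.
  pose Vq c' k := \sum_(j <- zwin N) rq c' k j * g j o.
  have VE k : V k = Vq cp k - Vq cm k.
    by rewrite /V /Vq -sumrB; apply: eq_bigr => j _; rewrite mulrBl.
  apply: (@le_trans _ _ (\sum_(k < n) (`|Vq cp k.+1 - Vq cp k| + `|Vq cm k.+1 - Vq cm k|))).
    apply: ler_sum => k _; rewrite !VE.
    rewrite (_ : _ - _ = (Vq cp k.+1 - Vq cp k) - (Vq cm k.+1 - Vq cm k)); last by ring.
    exact: ler_normB.
  rewrite big_split/= /L mulr_natl mulr2n; apply: lerD; apply: le_trans gL.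
    apply: variation_lincomb => //; [by move=> k j; exact: rqS|by move=> j; exact: rq1].
  by apply: variation_lincomb => //; [move=> k j; exact: rqS|move=> j; exact: rq1].
have e20 : 0 < e / 2 by rewrite divr_gt0.
have hst := stp_approximable_tv e20 V0 hTV.
rewrite {2}(splitr e); apply: (stp_approximable_close hst) => t ht.
rewrite /gridv; set k := Num.truncn _; have kn : (k <= n)%N by exact: truncn_le_grid.
have h1 := hD0 o ho0 k kn.
have h2 : `|\sum_(j <- zwin N) rho k j * (clip1 (lam * W j * Y j o) - cmean P X (lam * W j))| <=
    lam * (e / 4).
  by rewrite leNgt; apply/negP => h; apply: ho1; exists k.
set S := v n * _ in h1 *.
have -> : S - V k = (S - \sum_(j <- zwin N) v n * bsum c k j * Y j o) + lam^-1 *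
   \sum_(j <- zwin N) rho k j * (clip1 (lam * W j * Y j o) - cmean P X (lam * W j)).
  suff -> : V k = \sum_(j <- zwin N) v n * bsum c k j * Y j o - lam^-1 *
     \sum_(j <- zwin N) rho k j * (clip1 (lam * W j * Y j o) - cmean P X (lam * W j)) by ring.
  rewrite mulr_sumr -sumrB; apply: eq_bigr => j _.
  have hsp := clip1_split (W j * Y j o) lam0; 
  rewrite normrM (ger0_norm (W0 j)) (mulrA lam _ (Y j o)) (mulrA lam _ `|_|) in hsp.
  have {}hsp : W j * Y j o * (1 < lam * W j * `|Y j o|)%R%:R =
      W j * Y j o - lam^-1 * clip1 (lam * W j * Y j o) by apply/eqP; rewrite eq_sym subr_eq addrC; apply/eqP.
  rewrite -rhoW// /g hsp; ring.
rewrite (_ : e / 2 = e / 4 + e / 4); last by field.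
apply: (le_trans (ler_normD _ _)); apply: lerD => //.
by rewrite normrM gtr0_norm ?invr_gt0// ler_pdivrMl.
Unshelve. all: by end_near. Qed.

End tightness.

(** * Convergence in distribution *)

Section measurability.
Context d (T : measurableType d) (R : realType) (P : probability T R).

Lemma floor_scale_close (x : R) (n : nat) :
  `|x - (Num.floor (x * n.+1%:R))%:~R / n.+1%:R| <= n.+1%:R^-1.
Proof.
have n0 : 0 < n.+1%:R :> R by rewrite ltr0n.
have := floor_le (x * n.+1%:R); rewrite -subr_ge0 => h1; have h2 := floorD1_gt (x * n.+1%:R).
have -> : x - (Num.floor (x * n.+1%:R))%:~R / n.+1%:R =
    (x * n.+1%:R - (Num.floor (x * n.+1%:R))%:~R) / n.+1%:R by rewrite mulrBl mulfK// gt_eqF.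
rewrite ger0_norm; last by rewrite divr_ge0// ltW.
rewrite ler_pdivrMr// mulVf ?gt_eqF//.
by move: h2; rewrite intrD -ltrBlDl => /ltW.
Qed.

(** Rounding the coordinates down to multiples of 1/(n+1) leaves countably many vectors, and
    continuity of [g] recovers the limit; no sigma-algebra on row vectors is involved. *)
Lemma measurable_fun_rV (k : nat) (g : 'rV[R]_k -> R) (X : 'I_k -> T -> R) :
  continuous g -> (forall i, measurable_fun setT (X i)) ->
  measurable_fun setT (fun w => g (\row_i X i w)).
Proof.
move=> cg mX; pose fl n i w := Num.floor (X i w * n.+1%:R).
pose G n (z : {ffun 'I_k -> int}) := g (\row_i ((z i)%:~R / n.+1%:R)).
apply: (@measurable_fun_cvg _ _ _ setT (fun n w => G n [ffun i => fl n i w])).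
  move=> n _ B mB; rewrite setTI.
  have -> : (fun w => G n [ffun i => fl n i w]) @^-1` B =
      \bigcup_(z : {ffun 'I_k -> int}) (if G n z \in B then
        \bigcap_(i in [set: 'I_k]) [set w | fl n i w = z i] else set0).
    apply/seteqP; split=> w /=.
      move=> h; exists [ffun i => fl n i w] => //; rewrite mem_set//= => i _ /=.
      by rewrite ffunE.
    move=> [z _]; case: ifPn => // /set_mem hz hw.
    by rewrite (_ : [ffun i => fl n i w] = z)//; apply/ffunP => i; rewrite ffunE hw.
  apply: countable_bigcupT_measurable; first exact: countableP.
  move=> z; case: ifP => // _; apply: fin_bigcap_measurable => // i _.
  have -> : [set w | fl n i w = z i] = [set w | X i w * n.+1%:R < (z i + 1)%:~R] `&`
      ~` [set w | X i w * n.+1%:R < (z i)%:~R].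
    apply/seteqP; split=> w /=; rewrite /fl.
      by move=> <-; split; [exact: floorD1_gt|apply/negP; rewrite -leNgt floor_le].
    by move=> [h1 /negP]; rewrite -leNgt => h2; apply: floor_def; rewrite h2.
  have ms (c : R) : measurable [set w | X i w * n.+1%:R < c].
    rewrite (_ : [set w | _] = [set w | - c < - (X i w * n.+1%:R)]).
      by apply: measurable_set_lt; apply: measurableT_comp => //; exact: measurable_funM.
    by apply/seteqP; split=> w /=; rewrite ltrN2.
  by apply: measurableI => //; exact: measurableC.
move=> w _; apply/cvgrPdist_lt => e e0.
have /cvgrPdist_lt/(_ e e0) := cg (\row_i X i w).
move=> /nbhs_ballP[del /= del0 hdel]; near=> n.
have -> : G n [ffun i => fl n i w] = g (\row_i ((fl n i w)%:~R / n.+1%:R)).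
  by rewrite /G; congr g; apply/rowP => i; rewrite !mxE ffunE.
apply: hdel; split=> // i j; rewrite !mxE.
apply: le_lt_trans (floor_scale_close _ _) _; near: n.
exact: near_infty_natSinv_lt (PosNum del0).
Unshelve. all: by end_near. Qed.

Lemma cvg_EFin_real (u : nat -> R) (l : R) :
  u n @[n --> \oo] --> l -> (u n)%:E @[n --> \oo] --> l%:E.
Proof. by move=> h; apply: cvg_EFin => //; exact: nearW. Qed.

Lemma cvg_fine_real (u : nat -> R) (l : R) :
  (u n)%:E @[n --> \oo] --> l%:E -> u n @[n --> \oo] --> l.
Proof. by move=> /fine_cvgP[]. Qed.

Lemma Ex_dominated_cvg (f : nat -> T -> R) (g : T -> R) (M : R) :
  (forall n, measurable_fun setT (f n)) -> (forall n w, `|f n w| <= M) ->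
  (forall w, f n w @[n --> \oo] --> g w) -> Ex P (f n) @[n --> \oo] --> Ex P g.
Proof.
move=> mf hf hc; have mg : measurable_fun setT g.
  by apply: (@measurable_fun_cvg _ _ _ setT f) => // w _; exact: hc.
have bf n : bmfun (f n) by split=> //; exists M.
have bg : bmfun g.
  split=> //; exists M => w; apply: (cvgr_to_le (cvg_norm (hc w))); exact: nearW.
have iM : P.-integrable setT (EFin \o (fun=> M)) by apply: bmfun_integrable; exact: bmfun_cst.
have [|||||_ _ h] := @dominated_convergence _ _ _ P setT measurableT (fun n w => (f n w)%:E)
  (fun w => (g w)%:E) (EFin \o (fun=> M)).
- by move=> n; exact/measurable_EFinP.
- exact/measurable_EFinP.
- by apply: aeW => w _; exact: cvg_EFin_real.
- exact: iM.
- by apply: aeW => w n _; rewrite lee_fin.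
apply: cvg_fine_real; rewrite -expectationE// unlock.
by under eq_fun do rewrite -expectationE// unlock.
Qed.

End measurability.

Section path_functionals.
Variable R : realType.
Variable f : (R -> R) -> R.
Hypotheses (f01 : on_D01 f) (fc : S_continuous f).

Lemma gridv_row m (x : nat -> R) :
  f (gridv m (fun k => (\row_(i < m.+1) x i) ord0 (inord k))) = f (gridv m x).
Proof.
by apply: f01 => t ht; rewrite /gridv mxE inordK// ltnS truncn_le_grid.
Qed.

Lemma measurable_gridv d (T : measurableType d) m (x : nat -> T -> R) :
  (forall k, measurable_fun setT (x k)) ->
  measurable_fun setT (fun w => f (gridv m (x ^~ w))).
Proof.
move=> mx; have := measurable_fun_rV (@continuous_gridv R f m fc) (fun i : 'I_m.+1 => mx i).
by congr measurable_fun; apply/funext => w; exact: (gridv_row m (x ^~ w)).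
Qed.

Lemma measurable_path_functional d (T : measurableType d) (z : R -> T -> R) :
  (forall t, measurable_fun setT (z t)) -> (forall w, cadlag01 (z ^~ w)) ->
  measurable_fun setT (fun w => f (z ^~ w)).
Proof.
move=> mz cz; apply: (@measurable_fun_cvg _ _ _ setT (fun m w => f (grid m (z ^~ w)))).
  by move=> m; exact: (@measurable_gridv _ T m (fun k => z (k%:R / m%:R))).
by move=> w _; exact: S_continuous_grid.
Qed.

End path_functionals.

Lemma stp_approximable_le (R : realType) (x : R -> R) N (L e e' : R) : e <= e' ->
  stp_approximable x N L e -> stp_approximable x N L e'.
Proof. by move=> ee [b [tau [h1 h2]]]; exists b, tau; split=> // t /h2 /le_trans; apply. Qed.

Theorem theorem3 (R : realType)
  (d : measure_display) (T : measurableType d) (P : probability T R)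
  (Y : int -> T -> R) (alpha : R) (h : R -> R) (p q : R)
  (a : nat -> R) (C : R)
  (d' : measure_display) (T' : measurableType d') (Q : probability T' R)
  (Z : R -> T' -> R) (c : int -> R) :
  (* usual conditions *)
  (forall j, measurable_fun setT (Y j)) ->
  mutual_indep P Y ->
  (forall j, eq_dist P P (Y j) (Y 1)) ->
  0 < alpha < 2 ->
  slowly_varying h ->
  (forall x, 0 < x -> P [set w | x < `|Y 1 w|] = (powR x (- alpha) * h x)%:E) ->
  fine (P [set w | x < Y 1 w]) / fine (P [set w | x < `|Y 1 w|]) @[x --> +oo]
    --> p ->
  fine (P [set w | Y 1 w < - x]) / fine (P [set w | x < `|Y 1 w|]) @[x --> +oo]
    --> q ->
  p + q = 1 ->
  (1 < alpha -> ('E_P[Y 1%R] = 0)%E) ->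
  (alpha = 1 -> eq_dist P P (Y 1) (fun w => - Y 1 w)) ->
  (forall n, 0 < a n) ->
  n%:R * fine (P [set w | a n < `|Y 1 w|]) @[n --> \oo] --> C ->
  0 < C ->
  (* Z is the alpha-stable Levy motion with Z(1) the limit of a_n^{-1} sum Y_i *)
  levy_motion Q Z ->
  cvg_dist P Q (fun n w => (a n)^-1 * \sum_(1 <= i < n.+1) Y (i%:Z) w) (Z 1) ->
  (* coefficients *)
  (\esum_(j in [set: int]) (`|c j|)%:E < +oo)%E ->
  (\esum_(j in [set: int]) (powR `|c j| alpha * h (`|c j|^-1))%:E < +oo)%E ->
  (* finite dimensional convergence of T_n to A_{|.|} Z *)
  (forall (k : nat) (t : 'I_k -> R), (forall i, 0 <= t i <= 1) ->
     cvg_dist_vec P Q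
       (fun n w => \row_(i < k)
          psum_proc a (linproc (fun j => `|c j|) Y) n w (t i))
       (fun w => \row_(i < k) (zsum (fun j => `|c j|) * Z (t i) w))) ->
  (* conclusion: S_n -> A Z in distribution on (D([0,1]), S) *)
  cvg_dist_S P Q (psum_proc a (linproc c Y))
    (fun w t => zsum c * Z t w).
Proof.
move=> mY iY dY alpha02 sv hP _ _ _ mean0 sym1 a0 aC _ [mZ _ cZ _ _] hL esA esB fdd.
have [q1 [q2 [K [w0 rt]]]] := regular_tail_exists (mY 1) sv hP alpha02 mean0 sym1.
pose v n := (a n)^-1; have v0 n : 0 < v n by rewrite invr_gt0.
have vC : n%:R * tailw P (Y 1) (v n) @[n --> \oo] --> C.
  have E n : tailw P (Y 1) (v n) = fine (P [set w | a n < `|Y 1 w|]).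
    rewrite /tailw /Pr; congr (fine (P _)).
    by apply/seteqP; split=> w /=; rewrite -ltr_pdivrMl ?invr_gt0// invrK mulr1.
  by under eq_fun do rewrite E.
have [A _ cA] := esum_finsum (fun j => normr_ge0 (c j)) esA.
have tE j : powR `|c j| alpha * h (`|c j|^-1) = tailw P (Y 1) `|c j|.
  have [c0|c0] := eqVneq (c j) 0; last by rewrite (tailwE hP) ?normr_gt0.
  by rewrite c0 normr0 tailw0 powR0 ?mul0r// gt_eqF//; case/andP: alpha02.
have [B _ cB] : exists2 B, 0 <= B & finsum_le (fun j => tailw P (Y 1) `|c j|) B.
  apply: esum_finsum; first by move=> j; exact: tailw_ge0.
  by move: esB; under eq_esum => j _ do rewrite tE.
pose ca j := `|c j|.
have hT : cvg_dist P Q (fun n w => v n * \sum_(1 <= i < n.+1) linproc ca Y i%:Z w)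
    (fun w => zsum ca * Z 1 w).
  move=> g gc [M hM].
  have gc' : continuous (fun x : 'rV[R]_1 => g (x ord0 ord0)).
    by move=> x; apply: continuous_comp; [exact: coord_continuous|exact: gc].
  have t1 : forall i : 'I_1, 0 <= (fun=> 1 : R) i <= 1 by move=> i; rewrite ler01 lexx.
  have gb : exists M, forall x : 'rV[R]_1, `|g (x ord0 ord0)| <= M by exists M => x; exact: hM.
  have := fdd 1%N (fun=> 1) t1 _ gc' gb.
  under eq_fun => n do under eq_fun => w do rewrite mxE /psum_proc mulr1 natrK.
  have E : (fun w : T' => g ((\row_(i < 1) (zsum ca * Z 1 w)) ord0 ord0)) =
      (fun w => g (zsum ca * Z 1 w)) by apply/funext => w; rewrite mxE.
  by rewrite E.
(* If A_{|.|} = 0 this is 0 / 0 = 0, and [hrho] still holds because |A| <= A_{|.|}. *)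
pose rho := zsum c / zsum ca.
have /andP[zc _] := zsum_norm_le cA.
have zca0 : 0 <= zsum ca by apply: le_trans zc.
have hrho : zsum c = rho * zsum ca.
  rewrite /rho; have [z0|z0] := eqVneq (zsum ca) 0; last by rewrite divfK.
  by rewrite z0 mulr0; apply/eqP; rewrite -normr_le0 -[leRHS]z0.
have rho1 : `|rho| <= 1.
  rewrite /rho normrM normfV (ger0_norm zca0).
  have [z0|z0] := eqVneq (zsum ca) 0; first by rewrite z0 invr0 mulr0.
  by rewrite ler_pdivrMr ?mul1r// lt_neqAle eq_sym z0.
have [u0 [M0 [u00 hM0 _]]] := linproc_tail_sums mY iY (mY 1) dY rt v0 vC cA cB (mZ 1) hL hT.
move=> f f01 [M hM] fc.
have M_ge0 : 0 <= M by apply: le_trans (hM (fun=> 0)).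
pose x n w := psum_proc a (linproc c Y) n w.
have cx n w : cadlag01 (x n w).
  exact: (@cadlag01_gridv R n (fun k => v n * \sum_(1 <= i < k.+1) linproc c Y i%:Z w)).
have mS (c' : int -> R) n k : measurable_fun setT
    (fun w => v n * \sum_(1 <= i < k.+1) linproc c' Y i%:Z w).
  by apply: measurable_funM => //; apply: measurable_sum_seq => i _; exact: measurable_linproc.
have bx n : bmfun (fun w => f (x n w)).
  by split; [exact: (@measurable_gridv _ f f01 fc _ T n
    (fun k w => v n * \sum_(1 <= i < k.+1) linproc c Y i%:Z w))|exists M].
have cz w : cadlag01 (fun t => zsum c * Z t w) by exact: cadlag01Z.
have bz : bmfun (fun w => f (fun t => zsum c * Z t w)).
  split; last by exists M.
  by apply: (@measurable_path_functional _ f f01 fc _ T' (fun t w => zsum c * Z t w)) => // t;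
    exact: measurable_funM.
under eq_fun => n do rewrite (expectationE _ (bx n)).
rewrite expectationE//; apply: cvg_EFin_real; apply/cvgrPdist_le => e0 e00.
(* Three errors [e] (grid for the limit, finite dimensional convergence, equicontinuity) and 2 M
   times the exceptional probability, which is at most 2 e. *)
pose e := e0 / (3 + 4 * M).
have d0 : 0 < 3 + 4 * M by rewrite ltr_wpDr// mulr_ge0.
have ep : 0 < e by rewrite divr_gt0.
have e0E : e0 = e + (e + (e + 4 * M * e)) by rewrite /e; field; rewrite gt_eqF.
(* The first entry gives the accuracy 1/(l+1) at level l, the second makes the exceptional
   probabilities of all levels sum to at most [e]. *)
pose el l := Num.min (inv_succ R l) (e / 2 ^+ l.+1).
have el0 l : 0 < el l by rewrite lt_min invr_gt0 ltr0Sn divr_gt0 ?exprn_gt0.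
have tight l := linproc_tight mY iY (mY 1) dY rt v0 vC cA cB u00 hM0 (el0 l).
have [N hN] := choice tight; have [L hNL] := choice hN.
(* The order of choice matters: [k] depends only on the tightness constants, the grid [m >= k] then
   on the limit process, and [n] comes last. *)
have [k hk] := S_equicontinuous N L fc ep.
have limZ := Ex_dominated_cvg (P := Q) (f := fun m w => f (grid m (fun t => zsum c * Z t w)))
  (fun m => @measurable_gridv _ f f01 fc _ T' m (fun k w => zsum c * Z (k%:R / m%:R) w)
     (fun k => measurable_funM (measurable_cst _) (mZ _)))
  (fun m w => hM _) (fun w => S_continuous_grid fc (cz w)).
have [m [km m0 hm]] : exists m, [/\ (k <= m)%N, (0 < m)%N &
    `|Ex Q (fun w => f (fun t => zsum c * Z t w)) -
      Ex Q (fun w => f (grid m (fun t => zsum c * Z t w)))| <= e].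
  have /filter_ex[m [h1 h2 h3]] : \forall m \near \oo, [/\ (k <= m)%N, (0 < m)%N &
      `|Ex Q (fun w => f (fun t => zsum c * Z t w)) -
        Ex Q (fun w => f (grid m (fun t => zsum c * Z t w)))| <= e].
    near=> m; split; [by near: m; exact: nbhs_infty_ge|by near: m; exact: nbhs_infty_gt|].
    by near: m; move/cvgrPdist_le : limZ; apply.
  by exists m.
(* Close enough for [hk], and with total exceptional probability at most [e] over the m + 1 grid
   points. *)
pose del := Num.min (inv_succ R k) (e / m.+1%:R).
have del0 : 0 < del by rewrite lt_min invr_gt0 ltr0Sn divr_gt0.
pose kn (i : 'I_m.+1) n := Num.truncn (n%:R * (i%:R / m%:R) : R).
have ti (i : 'I_m.+1) : 0 <= (i%:R / m%:R : R) <= 1.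
  by rewrite divr_ge0//= ler_pdivrMr ?ltr0n// mul1r ler_nat -ltnS.
have knn i n : (kn i n <= n)%N by exact: truncn_le_grid.
have hB : \forall n \near \oo, forall i : 'I_m.+1, Pr P [set o | del <
    `|v n * \sum_(1 <= l < (kn i n).+1) linproc c Y l%:Z o -
      rho * (v n * \sum_(1 <= l < (kn i n).+1) linproc ca Y l%:Z o)|] <= del.
  apply: filter_forall => i.
  exact: (proportional_close mY iY (mY 1) dY rt v0 vC cA cB (mZ 1) hL hT hrho rho1 (knn i) del0).
have hD : \forall n \near \oo, forall l : 'I_k.+1, exists2 D, measurable D /\ Pr P D <= el l &
    forall o, ~ D o -> stp_approximable (x n o) (N l) (L l) (el l).
  by apply: filter_forall => l; exact: hNL.
(* The intermediate path: rho T_n sampled on the grid. It depends on m + 1 coordinates of T_n, so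
   [fdd] gives its limit, and off a small event it is close to the sampled S_n. *)
pose y n w := gridv m (fun i => rho * psum_proc a (linproc ca Y) n w (i%:R / m%:R)).
have my n : measurable_fun setT (fun w => f (y n w)).
  apply: (@measurable_gridv _ f f01 fc _ T m
    (fun i w => rho * psum_proc a (linproc ca Y) n w (i%:R / m%:R))) => i.
  by apply: measurable_funM => //; exact: mS.
have by_ n : bmfun (fun w => f (y n w)) by split=> //; exists M.
have limT : Ex P (fun w => f (y n w)) @[n --> \oo] -->
    Ex Q (fun w => f (grid m (fun t => zsum c * Z t w))).
  pose F (r : 'rV[R]_m.+1) := f (gridv m (fun i => r ord0 (inord i))).
  pose G (r : 'rV[R]_m.+1) := F (rho *: r).
  have cG : continuous G.
    move=> r; apply: (@continuous_comp _ _ _ (fun r : 'rV[R]_m.+1 => rho *: r) F).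
      exact: scaler_continuous.
    exact: continuous_gridv.
  have GE (z : nat -> R) : G (\row_(i < m.+1) z i) = f (gridv m (fun i => rho * z i)).
    rewrite /G /F -(gridv_row f01 m (fun i => rho * z i)); congr f; congr gridv.
    by apply/funext => i; rewrite !mxE.
  have hG : exists M, forall r, `|G r| <= M by exists M => r; exact: hM.
  have := fdd m.+1 (fun i => i%:R / m%:R) ti G cG hG.
  have E1 n : (fun w => G (\row_(i < m.+1) psum_proc a (linproc ca Y) n w (i%:R / m%:R))) =
      (fun w => f (y n w)).
    by apply/funext => w; rewrite (GE (fun i => psum_proc a (linproc ca Y) n w (i%:R / m%:R))).
  have E2 : (fun w => G (\row_(i < m.+1) (zsum ca * Z (i%:R / m%:R) w))) =
      (fun w => f (grid m (fun t => zsum c * Z t w))).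
    apply/funext => w; rewrite (GE (fun i => zsum ca * Z (i%:R / m%:R) w)).
    by congr f; congr gridv; apply/funext => i; rewrite mulrA -hrho.
  under eq_fun => n do rewrite E1 (expectationE _ (by_ n)).
  rewrite E2 expectationE; first exact: cvg_fine_real.
  split; last by exists M.
  exact: (@measurable_gridv _ f f01 fc _ T' m (fun k w => zsum c * Z (k%:R / m%:R) w)
     (fun k => measurable_funM (measurable_cst _) (mZ _))).
near=> n.
have n1 : `|Ex Q (fun w => f (grid m (fun t => zsum c * Z t w))) -
    Ex P (fun w => f (y n w))| <= e by near: n; move/cvgrPdist_le : limT; apply.
have n2 : forall i : 'I_m.+1, Pr P [set o | del <
    `|v n * \sum_(1 <= l < (kn i n).+1) linproc c Y l%:Z o -
      rho * (v n * \sum_(1 <= l < (kn i n).+1) linproc ca Y l%:Z o)|] <= del.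
  by near: n; exact: hB.
have n3 : forall l : 'I_k.+1, exists2 D, measurable D /\ Pr P D <= el l &
    forall o, ~ D o -> stp_approximable (x n o) (N l) (L l) (el l).
  by near: n; exact: hD.
have {}n3 (l : 'I_k.+1) : exists D, [/\ measurable D, Pr P D <= el l &
    forall o, ~ D o -> stp_approximable (x n o) (N l) (L l) (el l)].
  by have [D [? ?] ?] := n3 l; exists D.
have [D hDl] := choice n3.
pose B1 (i : 'I_m.+1) := [set o | del <
    `|v n * \sum_(1 <= l < (kn i n).+1) linproc c Y l%:Z o -
      rho * (v n * \sum_(1 <= l < (kn i n).+1) linproc ca Y l%:Z o)|].
have mB1 i : measurable (B1 i).
  apply: measurable_set_lt; apply: measurableT_comp => //; apply: measurable_funB => //.
  exact: measurable_funM.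
have mD l : measurable (D l) by case: (hDl l).
pose E1 := [set o | exists2 l, l \in index_enum 'I_k.+1 & D l o].
pose E2 := [set o | exists2 i, i \in index_enum 'I_m.+1 & B1 i o].
have mE1 : measurable E1 by exact: measurable_exists_seq.
have mE2 : measurable E2 by exact: measurable_exists_seq.
have pE1 : Pr P E1 <= e.
  apply: (le_trans (Pr_bigU_le _ _ mD)).
  apply: (@le_trans _ _ (\sum_(l < k.+1) e / 2 ^+ l.+1)).
    by apply: ler_sum => l _; have [_ h1 _] := hDl l; apply: (le_trans h1); rewrite ge_min lexx orbT.
  by apply: sum_geometric_le; exact: ltW.
have pE2 : Pr P E2 <= e.
  apply: (le_trans (Pr_bigU_le _ _ mB1)).
  apply: (@le_trans _ _ (\sum_(i < m.+1) e / m.+1%:R)).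
    by apply: ler_sum => i _; apply: (le_trans (n2 i)); rewrite ge_min lexx orbT.
  by rewrite sumr_const card_ord -[X in X <= _]mulr_natr divfK.
have n4 := @Ex_close _ _ _ P _ _ (~` (E1 `|` E2)) e M (bx n) (by_ n)
  (measurableC (measurableU _ _ mE1 mE2)) (fun w => hM _) (fun w => hM _) (ltW ep).
rewrite setCK in n4.
have {}n4 : `|Ex P (fun w => f (x n w)) - Ex P (fun w => f (y n w))| <= e + 4 * M * e.
  apply: le_trans (n4 _) _; last first.
    rewrite lerD2l (_ : 4 * M * e = 2 * M * (e + e)); last by ring.
    apply: ler_wpM2l; first by rewrite mulr_ge0.
    by apply: (le_trans (PrU_le P mE1 mE2)); exact: lerD.
  move=> w /= hw; apply: (hk m) => //; first exact: cadlag01_gridv.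
    move=> l lk; have ok : (l < k.+1)%N by rewrite ltnS.
    have [_ _ hx] := hDl (Ordinal ok).
    apply: (@stp_approximable_le _ _ _ _ (el l)); first by rewrite ge_min lexx.
    by apply: hx => hw'; apply: hw; left; exists (Ordinal ok); rewrite ?mem_index_enum.
  move=> t ht; have tm := truncn_le_grid m ht.
  have ok : (Num.truncn (m%:R * t) < m.+1)%N by rewrite ltnS.
  rewrite distrC; apply: (@le_trans _ _ del); last by rewrite ge_min lexx.
  rewrite leNgt; apply/negP => hlt; apply: hw; right; exists (Ordinal ok) => //.
rewrite (_ : _ - _ = (Ex Q (fun w => f (fun t => zsum c * Z t w)) -
      Ex Q (fun w => f (grid m (fun t => zsum c * Z t w)))) +
   ((Ex Q (fun w => f (grid m (fun t => zsum c * Z t w))) - Ex P (fun w => f (y n w))) -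
   (Ex P (fun w => f (x n w)) - Ex P (fun w => f (y n w))))); last by ring.
apply: (le_trans (ler_normD _ _)); rewrite e0E; apply: lerD => //.
by apply: (le_trans (ler_normB _ _)); exact: lerD.
Unshelve. all: by end_near. Qed.
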